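(* Let $\mathrm{val}(w)$ denote the smallest integer $k$ for which there exists an on-line chain partitioning algorithm that partitions every poset of width $w$ into at most $k$ chains. Then $\mathrm{val}(w) \le w^{O(\log\log w)}$; that is, there is an on-line algorithm that partitions posets of width $w$ into at most $w^{O(\log\log w)}$ chains.
   Context: An on-line chain partitioning algorithm receives the elements $x_1,\dots,x_n$ of a finite poset $(P,\le)$ one at a time and, when $x_i$ is received, irrevocably assigns it to a chain; the chain to which $x_i$ is assigned may depend only on the subposet induced by $\{x_1,\dots,x_i\}$ and on the chains to which $x_1,\dots,x_{i-1}$ were assigned. The resulting sets must be chains (sets of pairwise comparable elements) partitioning $P$. The width of a poset is the maximum size of an antichain. The asymptotic notation refers to $w\to\infty$. *)

(* Defs.v *)
From mathcomp Require Import all_boot.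
From Stdlib Require Import Reals.
Set Implicit Arguments. Unset Strict Implicit. Unset Printing Implicit Defensive.

(* A finite poset of size n presented on-line: its elements are the indices
   0 < 1 < ... < n-1 in order of arrival (x_{i+1} is index i), and le is the
   order relation (only its values on indices < n matter). *)
Definition is_poset (n : nat) (le : rel nat) : Prop :=
  (forall x, x < n -> le x x) /\
  (forall x y, x < n -> y < n -> le x y -> le y x -> x = y) /\
  (forall x y z, x < n -> y < n -> z < n -> le x y -> le y z -> le x z).

Definition width_le (n : nat) (le : rel nat) (w : nat) : Prop :=
  forall S : {set 'I_n},
    (forall x y : 'I_n, x \in S -> y \in S -> x != y ->
        ~~ le (val x) (val y) && ~~ le (val y) (val x)) ->
    #|S| <= w.

(* An on-line chain partitioning algorithm: when the element with index i
   arrives, it sees the subposet induced on the indices 0..i (as a relation on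
   'I_i.+1, the new element being ord_max) and the chains (labelled by nat)
   assigned to the indices 0..i-1, and returns the chain label of the new
   element. *)
Definition online_alg := forall i : nat, rel 'I_i.+1 -> ('I_i -> nat) -> nat.

Fixpoint run (A : online_alg) (le : rel nat) (k : nat) : seq nat :=
  match k with
  | 0 => [::]
  | k'.+1 =>
      let s := run A le k' in
      rcons s (A k' (fun x y : 'I_k'.+1 => le (val x) (val y))
                    (fun x : 'I_k' => nth 0 s (val x)))
  end.

Definition online_partitions (A : online_alg) (w k : nat) : Prop :=
  forall (n : nat) (le : rel nat),
    is_poset n le -> width_le n le w ->
    (forall x y, x < n -> y < n ->
       nth 0 (run A le n) x = nth 0 (run A le n) y -> le x y || le y x)
    /\ size (undup (run A le n)) <= k.

(* Main.v *)
Require Import Defs.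
From mathcomp Require Import all_boot.
From mathcomp Require Import zify.
From Stdlib Require Import ClassicalEpsilon FunctionalExtensionality.
Set Implicit Arguments. Unset Strict Implicit. Unset Printing Implicit Defensive.

(** Sort the points into levels so that every point of level [i] completes, on arrival, an antichain of
    size [i], while the levels up to [i] have width [i]; it then suffices to colour points completing a
    maximum antichain of a poset of known width [w], between a bottom and a top antichain.

    Antichains through the points cut the space between bottom and top into a tree of nodes. A node is a
    pair of antichains [X], [Y] whose comparability graph is connected in the strong sense that proper parts
    of [X] have strictly more neighbours than elements. A new point lies between [X] and [Y] for some leaf, a
    maximum antichain [B] through it cuts the leaf, and the connected pieces of [(X, B)] and [(B, Y)] become
    its children. If a node lies completely below another one, so do the points inside; hence it is enough
    to find few colours separating the nodes that are not related in this way. By connectedness an up-set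
    splits the bounds of at most [w] pairwise non-nested nodes, so polynomially many colours deal with nodes
    one of which is split by bounds of the other; the unsplit ones form blocks, a single comparability
    between blocks makes them completely comparable, and blocks of nodes with at least [b] tracks form a poset
    of width [w / b]. Points in nodes with fewer than [b] tracks live in a poset of width [b - 1].

    Therefore [val (b * q) <= poly (b * q) * val q * val (b - 1)], and [b = q = 2 ^ 2 ^ k] gives
    [val (2 ^ 2 ^ k) <= 2 ^ O(k 2 ^ k)]. *)

(** * On-line colourings and levels *)

(** Every label has to be final on arrival. Hence colourings are [local], choices that depend on the
    presentation see only its prefix ([rst], [rsp]), and each attribute of a node refers only to
    nodes of at most its own index; properness is then proved once, for the final tree, where the
    values computed at birth are still valid. The obstacle is a child that keeps all edges of its
    parent's comparability graph: such a split makes no progress, and arbitrarily many nodes can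
    share one graph. They form a family under a common super root. If both sides of a split keep all
    edges, the graph is transitive as well as connected, hence complete, and this makes most pairs
    within the family comparable. The super roots leaving a family can therefore be coloured with
    polynomially many colours. The double logarithm comes from the squaring of the width: with
    [w = 2 ^ 2 ^ k], one round multiplies the bound by a fixed power of the new width and squares
    the old bound, so each of the [k + 1] rounds contributes the same power of the final [w]. *)

Definition asb (Q : Prop) : bool := if excluded_middle_informative Q then true else false.

Lemma asbP Q : reflect Q (asb Q).
Proof. by rewrite /asb; case: excluded_middle_informative => ?; constructor. Qed.

Definition choice_of (T : Type) (x0 : T) (Q : T -> Prop) : T := epsilon (inhabits x0) Q.

Lemma choice_ofP (T : Type) (x0 : T) (Q : T -> Prop) : (exists x, Q x) -> Q (choice_of x0 Q).
Proof. exact: epsilon_spec. Qed.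

Definition ord (D : pred nat) (r : rel nat) : Prop :=
  [/\ forall x, D x -> r x x,
      forall x y, D x -> D y -> r x y -> r y x -> x = y &
      forall y x z, D x -> D y -> D z -> r x y -> r y z -> r x z].

Definition anti (r : rel nat) (s : seq nat) : Prop :=
  uniq s /\ forall x y, x \in s -> y \in s -> r x y -> x = y.

Definition wid (D : pred nat) (r : rel nat) (w : nat) : Prop :=
  forall s, anti r s -> (forall x, x \in s -> D x) -> size s <= w.

Lemma ord_sub (D D' : pred nat) r : (forall x, D' x -> D x) -> ord D r -> ord D' r.
Proof.
move=> sub [rr ra rt]; split=> [x /sub|x y /sub Dx /sub Dy|y x z /sub Dx /sub Dy /sub Dz].
- exact: rr.
- exact: ra.
- exact: rt.
Qed.

Lemma wid_sub (D D' : pred nat) r w : (forall x, D' x -> D x) -> wid D r w -> wid D' r w.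
Proof. by move=> sub W s A sD; apply: W => // x /sD /sub. Qed.

Lemma widW D r w w' : w <= w' -> wid D r w -> wid D r w'.
Proof. by move=> le_w W s A sD; apply: leq_trans le_w; apply: W. Qed.

Lemma max_elt (s : seq nat) r : ord (fun z => z \in s) r -> s != [::] ->
  exists2 a, a \in s & forall x, x \in s -> r a x -> x = a.
Proof.
elim: s => [|b s IHs] // O _.
have Os : ord (fun z => z \in s) r by apply: ord_sub O => x xs; rewrite in_cons xs orbT.
case: (eqVneq s [::]) => [s0|s0].
  by exists b; rewrite ?mem_head // => x; rewrite s0 mem_seq1 => /eqP.
have [a aS amax] := IHs Os s0.
have [rr ra rt] := O.
have aS' : a \in b :: s by rewrite in_cons aS orbT.
have bS' : b \in b :: s by rewrite mem_head.
case rab : (r a b).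
  exists b => // x xS rbx; move: (xS); rewrite in_cons => /orP[/eqP //|xs].
  have rax : r a x by apply: (rt b).
  by apply: ra => //; rewrite (amax x xs rax).
exists a => // x; rewrite in_cons => /orP[/eqP ->|xs]; first by rewrite rab.
exact: amax.
Qed.

Lemma size_inj_bound (T : Type) (s : seq T) (f : T -> nat) w :
  uniq (map f s) -> (forall y, y \in map f s -> y < w) -> size s <= w.
Proof.
move=> u b; rewrite -(size_map f) -(size_iota 0 w).
by apply: uniq_leq_size => // y /b; rewrite mem_iota.
Qed.

Lemma full_colours (s : seq nat) (f : nat -> nat) w i :
  uniq (map f s) -> (forall x, x \in s -> f x < w) -> w <= size s -> i < w ->
  exists2 x, x \in s & f x = i.
Proof.
move=> u b sz iw.
have sub : {subset map f s <= iota 0 w}.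
  by move=> y /mapP[x xs ->]; rewrite mem_iota /= add0n b.
have := (uniq_min_size u sub); rewrite size_map size_iota => /(_ sz) [_ E].
have : i \in map f s by rewrite E mem_iota.
by case/mapP=> x xs ->; exists x.
Qed.

Definition chaincol (D : pred nat) (r : rel nat) w (chi : nat -> nat) : Prop :=
  (forall x, D x -> chi x < w) /\
  (forall x y, D x -> D y -> chi x = chi y -> r x y || r y x).

Lemma anti_chi_uniq D r w chi s : chaincol D r w chi -> anti r s ->
  (forall x, x \in s -> D x) -> uniq (map chi s).
Proof.
move=> [_ C] [u A] sD; rewrite map_inj_in_uniq // => x y xs ys E.
by case/orP: (C x y (sD _ xs) (sD _ ys) E) => h; [|symmetry]; apply: A.
Qed.

(** Galvin's induction: remove a maximal element [a], cover the rest by [w] chains, and in each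
    chain take the top element lying on an antichain of size [w]. These tops form an antichain, so
    [a] lies above one of them; deleting [a] with the part of that chain up to its top lowers the
    width. *)
Lemma dilworth (s : seq nat) r w :
  uniq s -> ord (fun z => z \in s) r -> wid (fun z => z \in s) r w -> exists chi, chaincol (fun z => z \in s) r w chi.
Proof.
have [n] := ubnP (size s); elim: n s w => // n IHn s w sn us O W.
case: (eqVneq s [::]) => [->|s0]; first by exists (fun=> 0); split.
have [a aS amax] := max_elt O s0.
have [rr ra rt] := O.
set s' := rem a s.
have us' : uniq s' by apply: rem_uniq.
have s'E x : (x \in s') = (x != a) && (x \in s) by rewrite mem_rem_uniq.
have sub' x : x \in s' -> x \in s by rewrite s'E => /andP[].
have sz' : size s' < n by rewrite size_rem // -ltnS prednK // lt0n size_eq0.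
have O' : ord (fun z => z \in s') r by apply: ord_sub O => x; apply: sub'.
have W' : wid (fun z => z \in s') r w by apply: wid_sub W => x; apply: sub'.
(* If the rest has smaller width, [a] alone serves as the last chain. *)
case: (asbP (wid (fun z => z \in s') r w.-1 /\ 0 < w)) => [[W1 w0]|W1].
  have [chi [cb cc]] := IHn s' w.-1 sz' us' O' W1.
  exists (fun x => if x == a then w.-1 else chi x); split=> [x xS|x y xS yS].
    case: eqP => [_|/eqP xa]; first by rewrite prednK.
    have : x \in s' by rewrite s'E xa.
    by move/cb; lia.
  case: (eqVneq x a) => [->|xa]; case: (eqVneq y a) => [->|ya] //=.
  - by rewrite rr.
  - by move=> E; have /cb : y \in s' by [rewrite s'E ya]; rewrite -E ltnn.
  - by move=> E; have /cb : x \in s' by [rewrite s'E xa]; rewrite E ltnn.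
  - by move=> E; apply: cc => //; rewrite s'E ?xa ?ya.
have w0 : 0 < w.
  by apply: (W [:: a]) => [|x]; [split=> // x y; rewrite !inE => /eqP-> /eqP->|rewrite inE => /eqP->].
have [chi [cb cc]] := IHn s' w sz' us' O' W'.
pose wa z := exists B, [/\ anti r B, {subset B <= s'}, size B = w & z \in B].
have [B0 [aB0 sB0 zB0]] : exists B, [/\ anti r B, {subset B <= s'} & size B = w].
  apply: NNPP => H; apply: W1; split=> // B aB sB.
  have := W' B aB sB; rewrite leq_eqVlt => /orP[/eqP E|]; last by lia.
  by case: H; exists B.
have fullB B i : anti r B -> {subset B <= s'} -> size B = w -> i < w -> exists2 x, x \in B & chi x = i.
  move=> aB sB zB iw; apply: (@full_colours B chi w) => //; last by rewrite zB.
    by apply: (@anti_chi_uniq (fun z => z \in s') r w).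
  by move=> x /sB; apply: cb.
have Xi i : i < w -> exists x, [/\ x \in s', chi x = i, wa x & forall y, wa y -> chi y = i -> r y x].
  move=> iw; pose t := [seq x <- s' | (chi x == i) && asb (wa x)].
  have Ot : ord (fun z => z \in t) r by apply: ord_sub O' => x; rewrite /= mem_filter => /andP[].
  have [x xB cx] := fullB B0 i aB0 sB0 zB0 iw.
  have t0 : t != [::].
    apply/eqP=> t0; have : x \in t; last by rewrite t0.
    rewrite mem_filter cx eqxx sB0 // andbT; apply/asbP; by exists B0.
  have [m mt mmax] := max_elt Ot t0.
  move: (mt); rewrite mem_filter => /andP[/andP[/eqP cm /asbP wm] ms].
  exists m; split=> // y wy cy.
  have ys : y \in s' by case: wy => B [_ sB _ /sB].
  have yt : y \in t by rewrite mem_filter cy eqxx ys andbT; apply/asbP.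
  case/orP: (cc y m ys ms (etrans cy (esym cm))) => // rmy.
  by rewrite (mmax y yt rmy); apply: rr; apply: sub'.
pose xi i := choice_of 0 (fun x => [/\ x \in s', chi x = i, wa x & forall y, wa y -> chi y = i -> r y x]).
have xiP i : i < w -> [/\ xi i \in s', chi (xi i) = i, wa (xi i) & forall y, wa y -> chi y = i -> r y (xi i)].
  by move=> iw; apply: (choice_ofP 0 (Xi i iw)).
(* The full antichain through [xi j] meets chain [i] in some [y] below [xi i]; comparability would
   put [y] below [xi j] inside this antichain. *)
have xi_anti i j : i < w -> j < w -> r (xi i) (xi j) -> i = j.
  move=> iw jw rij.
  have [xis ci _ mi] := xiP i iw; have [xjs cj [B [aB sB zB xB]] mj] := xiP j jw.
  have [y yB cy] := fullB B i aB sB zB iw.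
  have ryi : r y (xi i) by apply: mi => //; exists B.
  have ryj : r y (xi j) by apply: (rt (xi i)) => //; apply: sub' => //; apply: sB.
  by rewrite -cj -(aB.2 y (xi j) yB xB ryj).
(* Otherwise [a] together with all [xi i] would be an antichain of size [w + 1]. *)
have [i iw rxa] : exists2 i, i < w & r (xi i) a.
  apply: NNPP => H.
  pose A := a :: map xi (iota 0 w).
  have Ain x : x \in map xi (iota 0 w) -> exists2 i, i < w & x = xi i.
    by case/mapP=> i; rewrite mem_iota => /= iw ->; exists i.
  suff aA : anti r A.
    have := W A aA; rewrite /= size_map size_iota ltnn => F; apply: notF; apply: F.
    move=> x; rewrite in_cons => /orP[/eqP->//|/Ain[i iw ->]].
    by apply: sub'; case: (xiP i iw).
  split.
    rewrite /= map_inj_in_uniq ?iota_uniq ?andbT.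
      apply/negP=> /Ain[i iw E]; case: (xiP i iw) => + _ _ _.
      by rewrite -E s'E eqxx.
    move=> i j; rewrite !mem_iota /= => iw jw E; apply: xi_anti => //.
    by rewrite -E; apply: rr; apply: sub'; case: (xiP i iw).
  move=> x y; rewrite !in_cons => /orP[/eqP->|/Ain[i iw ->]] /orP[/eqP->|/Ain[j jw ->]] //.
  - by move/amax => ->//; apply: sub'; case: (xiP j jw).
  - by move=> ria; case: H; exists i.
  - by move/xi_anti => ->.
have [xis ci wi mi] := xiP i iw.
pose K z := (z == a) || ((chi z == i) && r z (xi i)).
pose s2 := [seq z <- s | ~~ K z].
have s2s z : z \in s2 -> z \in s' by rewrite mem_filter s'E negb_or => /andP[/andP[-> _] ->].
have us2 : uniq s2 by apply: filter_uniq.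
have O2 : ord (fun z => z \in s2) r by apply: ord_sub O' => z; apply: s2s.
have sz2 : size s2 < n by apply: leq_ltn_trans sz'; apply: uniq_leq_size.
(* An antichain of size [w] in [s2] would meet chain [i] in a point below [xi i], and those points
   were deleted. *)
have W2 : wid (fun z => z \in s2) r w.-1.
  move=> B aB sB.
  have sB' : {subset B <= s'} by move=> z /sB /s2s.
  have := W' B aB sB'; rewrite leq_eqVlt => /orP[/eqP zB|]; last by lia.
  have [y yB cy] := fullB B i aB sB' zB iw.
  have : y \in s2 by apply: sB.
  rewrite mem_filter negb_or cy eqxx /= mi ?andbF //; by exists B.
have [chi2 [cb2 cc2]] := IHn s2 w.-1 sz2 us2 O2 W2.
exists (fun x => if K x then w.-1 else chi2 x); split=> [x xS|x y xS yS].
  case: ifP => Kx; first by rewrite prednK.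
  have : x \in s2 by rewrite mem_filter Kx.
  by move/cb2; lia.
have aK z : z \in s -> K z -> r z a.
  move=> zs /orP[/eqP->|/andP[_ rz]]; first exact: rr.
  by apply: (rt (xi i)) => //; apply: sub'.
case Kx : (K x); case Ky : (K y).
- move=> _; case/orP: (Kx) => [/eqP->|/andP[cx rx]]; first by rewrite aK ?orbT.
  case/orP: (Ky) => [/eqP->|/andP[cy ry]]; first by rewrite aK.
  case: (eqVneq x a) => [->|xa]; first by rewrite aK ?orbT.
  case: (eqVneq y a) => [->|ya]; first by rewrite aK.
  by apply: cc; rewrite ?s'E ?xa ?ya // (eqP cx) (eqP cy).
- by move=> E; have /cb2 : y \in s2 by [rewrite mem_filter Ky]; rewrite -E ltnn.
- by move=> E; have /cb2 : x \in s2 by [rewrite mem_filter Kx]; rewrite E ltnn.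
- by move=> E; apply: cc2 => //; rewrite mem_filter ?Kx ?Ky.
Qed.

(* The identifiers below [n] satisfying [P] are the points presented so far; allowing gaps lets a
   strategy be run on a subset of the points without renumbering. *)
Definition bl n (P : pred nat) : pred nat := fun x => (x < n) && P x.

Definition agr (x : nat) (P P' : pred nat) (r r' : rel nat) : Prop :=
  (forall y, y <= x -> P y = P' y) /\
  (forall y z, y <= x -> z <= x -> P y -> P z -> r y z = r' y z).

(** Everything outside the prefix is erased, so agreeing presentations give equal relations, and a
    choice made from them by [epsilon] is the same. *)
Definition rst (x : nat) (P : pred nat) (r : rel nat) : rel nat :=
  fun y z => [&& y <= x, z <= x, P y, P z & r y z].
Definition rsp (x : nat) (P : pred nat) : pred nat := fun y => (y <= x) && P y.

Lemma agr_rsp x P P' r r' : agr x P P' r r' -> rsp x P = rsp x P'.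
Proof. by case=> E _; apply: functional_extensionality => y; rewrite /rsp; case: leqP => // /E ->. Qed.

Lemma agr_rst x P P' r r' : agr x P P' r r' -> rst x P r = rst x P' r'.
Proof.
case=> E F; do 2!apply: functional_extensionality => ?; rewrite /rst.
case: leqP => //= h1; case: leqP => //= h2; rewrite -!E //.
by case h3 : (P _); case h4 : (P _) => //=; rewrite F.
Qed.

Lemma agrW x y P P' r r' : y <= x -> agr x P P' r r' -> agr y P P' r r'.
Proof.
move=> yx [E F]; split=> [z zy|z t zy ty]; first by apply: E; apply: leq_trans yx.
by apply: F; apply: leq_trans yx.
Qed.

Definition cproper n (P : pred nat) (r : rel nat) k (f : nat -> nat) : Prop :=
  (forall x, x < n -> P x -> f x < k) /\
  (forall x y, x < n -> y < n -> P x -> P y -> f x = f y -> r x y || r y x).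

Definition colouring := rel nat -> pred nat -> nat -> nat.

Definition local (c : colouring) : Prop :=
  forall r r' P P' x, agr x P P' r r' -> P x -> c r P x = c r' P' x.

(* A [rule] is a condition on the presentation under which a colouring has to be proper. *)
Definition rule := nat -> pred nat -> rel nat -> Prop.

Definition onlQ (Q : rule) w k : Prop := exists c : colouring, local c /\
  forall n P r, ord (bl n P) r -> wid (bl n P) r w -> Q n P r -> cproper n P r k (c r P).

Definition onl w k := onlQ (fun _ _ _ => True) w k.

Definition mlocal (c : rel nat -> pred nat -> pred nat -> nat -> nat) : Prop :=
  forall r r' P P' (M M' : pred nat) x, agr x P P' r r' -> (forall y, y <= x -> M y = M' y) -> M x ->
    c r P M x = c r' P' M' x.

(* Only the points in [M] are coloured; each of them completes an antichain of size [w] on arrival. *)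
Definition monl (Q : rule) w k : Prop :=
  exists c : rel nat -> pred nat -> pred nat -> nat -> nat, mlocal c /\
  forall n P (M : pred nat) r, ord (bl n P) r -> wid (bl n P) r w -> Q n P r ->
    (forall x, x < n -> M x -> P x /\ exists s, [/\ anti r s, x \in s, size s = w &
       forall y, y \in s -> y <= x /\ P y]) ->
    cproper n M r k (c r P M).

Lemma anti_ext (r r' : rel nat) s : (forall x y, x \in s -> y \in s -> r x y = r' x y) -> anti r s -> anti r' s.
Proof. by move=> E [u A]; split=> // x y xs ys; rewrite -E //; apply: A. Qed.

Lemma wid_ext (D : pred nat) (r r' : rel nat) w : (forall x y, D x -> D y -> r x y = r' x y) -> wid D r w -> wid D r' w.
Proof.
move=> E W s A sD; apply: W => //; apply: anti_ext A => x y xs ys.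
by rewrite E //; apply: sD.
Qed.

Lemma rst_in n (P : pred nat) (r : rel nat) x y : x <= n -> y <= n -> P x -> P y -> rst n P r x y = r x y.
Proof. by rewrite /rst => -> -> -> ->. Qed.

Lemma onl_mono Q w w' k k' : w' <= w -> k <= k' -> onlQ Q w k -> onlQ Q w' k'.
Proof.
move=> lw lk [c [lc C]]; exists c; split=> // n P r O W q.
have [b p] := C n P r O (widW lw W) q; split=> // x xn Px.
by apply: leq_trans lk; apply: b.
Qed.

(** * Reduction to points that complete a maximum antichain *)

Section Levels.
Variables (Q : rule) (w k : nat).
Hypothesis Qsub : forall n (P P' : pred nat) r, (forall x, P' x -> P x) -> Q n P r -> Q n P' r.
Hypothesis games : forall i, 0 < i -> i <= w -> monl Q i k.

Definition lset (P : pred nat) (ls : seq nat) n i : pred nat :=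
  fun y => (y == n) || [&& y < n, P y & nth 0 ls y <= i].

(* The least level such that levels up to any [j] above it keep width at most [j]; by minimality the
   point then completes an antichain of its level's size (lemma [lev_anti]). *)
Definition newlev (r : rel nat) (P : pred nat) ls n : nat :=
  find (fun i => asb (forall j, i <= j -> wid (lset (rsp n P) ls n j) (rst n P r) j)) (iota 0 n.+2).

Fixpoint levl (r : rel nat) (P : pred nat) n : seq nat :=
  if n is n'.+1 then rcons (levl r P n') (newlev r P (levl r P n') n') else [::].

Definition lev r P x := nth 0 (levl r P x.+1) x.

Lemma size_levl r P n : size (levl r P n) = n.
Proof. by elim: n => //= n IH; rewrite size_rcons IH. Qed.

Lemma nth_levl r P n x : x < n -> nth 0 (levl r P n) x = lev r P x.
Proof.
elim: n => // n IH; rewrite ltnS leq_eqVlt => /orP[/eqP->//|xn].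
by rewrite /= nth_rcons size_levl xn IH.
Qed.

Lemma levl_agr x P P' r r' n : agr x P P' r r' -> n <= x.+1 -> levl r P n = levl r' P' n.
Proof.
move=> A; elim: n => //= n IH nx; rewrite IH ?(ltnW nx) //.
have A' := agrW (ltnSE nx) A.
by rewrite /newlev (agr_rst A') (agr_rsp A').
Qed.

Lemma lev_agr x y P P' r r' : agr x P P' r r' -> y <= x -> lev r P y = lev r' P' y.
Proof. by move=> A yx; rewrite /lev (levl_agr A). Qed.

Section Fixed.
Variables (n : nat) (P : pred nat) (r : rel nat).

Definition below x i : pred nat := fun y => (y == x) || [&& y < x, P y & lev r P y <= i].

Lemma levP x : P x -> (forall j, lev r P x <= j -> wid (below x j) r j) /\
  (forall i, (forall j, i <= j -> wid (below x j) r j) -> lev r P x <= i).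
Proof.
move=> Px.
have eqs j y : lset (rsp x P) (levl r P x) x j y = below x j y.
  rewrite /lset /below /rsp; case: eqP => //= _; case: ltnP => //= yx.
  by rewrite (ltnW yx) /= nth_levl.
have belowP j y : below x j y -> y <= x /\ P y.
  by case/orP=> [/eqP->|/and3P[/ltnW yx Py _]].
have Ew j : wid (lset (rsp x P) (levl r P x) x j) (rst x P r) j <-> wid (below x j) r j.
  split=> W.
    have W1 : wid (below x j) (rst x P r) j by apply: wid_sub W => y; rewrite eqs.
    by apply: wid_ext W1 => y z /belowP[yx Py] /belowP[zx Pz]; rewrite rst_in.
  have W1 : wid (lset (rsp x P) (levl r P x) x j) r j by apply: wid_sub W => y; rewrite eqs.
  by apply: wid_ext W1 => y z; rewrite !eqs => /belowP[yx Py] /belowP[zx Pz]; rewrite rst_in.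
have -> : lev r P x = newlev r P (levl r P x) x by rewrite /lev /= nth_rcons size_levl ltnn eqxx.
rewrite /newlev; set p := (X in find X _).
have pE i : reflect (forall j, i <= j -> wid (below x j) r j) (p i).
  rewrite /p; apply: (iffP (asbP _)) => H j ij; first by apply/Ew; apply: H.
  by apply/Ew; apply: H.
have hp : has p (iota 0 x.+2).
  (* Only [x + 1] points have arrived, so level [x + 1] always qualifies; this is why the search
     range has length [n + 2]. *)
  apply/hasP; exists x.+1; first by rewrite mem_iota /=; lia.
  apply/pE => j xj s [us _] sb.
  apply: leq_trans xj; rewrite -(size_iota 0 x.+1); apply: uniq_leq_size => // y /sb /belowP[yx _].
  by rewrite mem_iota.
split.
  apply/pE; have := nth_find 0 hp.
  by rewrite nth_iota //; move: hp; rewrite has_find size_iota.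
move=> i Hi; rewrite leqNgt; apply/negP=> lt.
have := before_find 0 lt; rewrite nth_iota ?add0n; first by move/pE: Hi => ->.
by apply: leq_trans lt _; apply: leq_trans (find_size _ _) _; rewrite size_iota.
Qed.

Lemma lev_le x : wid (bl n P) r w -> x < n -> P x -> lev r P x <= w.
Proof.
move=> W xn Px; have [_ H] := levP Px; apply: H => j wj.
apply: (widW wj); apply: wid_sub W => y /orP[/eqP->|/and3P[yx Py _]]; rewrite /bl ?xn //.
by rewrite (ltn_trans yx xn).
Qed.

Lemma lev_gt0 x : x < n -> P x -> 0 < lev r P x.
Proof.
move=> xn Px; case: (posnP (lev r P x)) => // l0.
have [H _] := levP Px; have := H 0; rewrite l0 => /(_ isT [:: x]) F.
suff : 1 <= 0 by []. apply: F; last by move=> y; rewrite inE => /eqP->; rewrite /below eqxx.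
by split=> // y z; rewrite !inE => /eqP-> /eqP->.
Qed.

Lemma wid_lev i m : m <= n -> wid (bl m (fun y => P y && (lev r P y <= i))) r i.
Proof.
elim: m => [|m IH] mn.
  by move=> [|y s] // _ /(_ y (mem_head _ _)).
case Pm : (P m && (lev r P m <= i)); last first.
  apply: wid_sub (IH (ltnW mn)) => y /andP[]; rewrite ltnS leq_eqVlt => /orP[/eqP->|ym]; first by rewrite Pm.
  by rewrite /bl ym.
case/andP: Pm => Pm li; have [H _] := levP Pm; apply: wid_sub (H i li) => y.
by rewrite /bl /below ltnS leq_eqVlt; case: eqP.
Qed.

Lemma lev_anti x : x < n -> P x -> exists s, [/\ anti r s, x \in s, size s = lev r P x &
   forall y, y \in s -> y <= x /\ (P y && (lev r P y <= lev r P x))].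
Proof.
move=> xn Px; have [H1 H2] := levP Px; have l0 := lev_gt0 xn Px.
set i := (lev r P x).-1.
have li : lev r P x = i.+1 by rewrite /i prednK.
have nW : ~ wid (below x i) r i.
  move=> Wi; have : lev r P x <= i; last by rewrite li ltnn.
  apply: H2 => j; rewrite leq_eqVlt => /orP[/eqP<- //|ij]; apply: H1; by rewrite li.
have [s [A sb sz]] : exists s, [/\ anti r s, forall y, y \in s -> below x i y & i < size s].
  apply: NNPP => F; apply: nW => s A sb; rewrite leqNgt; apply/negP => sz.
  by apply: F; exists s.
have sz1 : size s = i.+1.
  apply/eqP; rewrite eqn_leq sz andbT.
  apply: (H1 i.+1) => //; first by rewrite li.
  move=> y /sb /orP[/eqP->|/and3P[yx Py ly]]; rewrite /below ?eqxx // yx Py /= (leq_trans ly) ?orbT //.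
exists s; split=> //; last 2 first.
- by rewrite sz1 li.
- move=> y /sb /orP[/eqP->|/and3P[yx Py ly]]; first by rewrite Px !leqnn.
  by rewrite (ltnW yx) Py /= li (leq_trans ly).
(* Without [x] the antichain would consist of earlier points of levels at most [i], which have width
   at most [i]. *)
apply: contraT => xs.
have := @wid_lev i x (ltnW xn) s A; rewrite sz1 ltnn => F; apply: F => y ys.
case/orP: (sb y ys) => [/eqP yx|/and3P[yx Py ly]]; first by rewrite -yx ys in xs.
by rewrite /bl yx Py ly.
Qed.

End Fixed.

(** Disjoint palettes of [k] colours, one per level. The game for level [i] is played on the points
    of levels up to [i], with those of level exactly [i] marked. *)
Lemma levels : onlQ Q w (w * k).
Proof.
pose C i := choice_of (fun _ _ _ _ => 0) (fun c => mlocal c /\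
  forall n P (M : pred nat) r, ord (bl n P) r -> wid (bl n P) r i -> Q n P r ->
    (forall x, x < n -> M x -> P x /\ exists s, [/\ anti r s, x \in s, size s = i &
       forall y, y \in s -> y <= x /\ P y]) ->
    cproper n M r k (c r P M)).
have CP i : 0 < i -> i <= w -> _ := fun i0 iw => choice_ofP (fun _ _ _ _ => 0) (games i0 iw).
pose PP r (P : pred nat) i y := P y && (lev r P y <= i).
pose MM r (P : pred nat) i y := P y && (lev r P y == i).
pose c (r : rel nat) (P : pred nat) (x : nat) := let i := lev r P x in
  if (0 < i) && (i <= w) then i.-1 * k + C i r (PP r P i) (MM r P i) x else 0.
exists c; split.
  move=> r r' P P' x A Px; rewrite /c (lev_agr A (leqnn x)).
  case: ifP => // /andP[i0 iw]; congr (_ + _).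
  apply: (CP _ i0 iw).1.
  - split=> [y yx|y z yx zx].
      by rewrite /PP (lev_agr A yx) A.1.
    by move=> /andP[Py _] /andP[Pz _]; apply: A.2.
  - by move=> y yx; rewrite /MM (lev_agr A yx) A.1.
  - by rewrite /MM Px (lev_agr A) /=.
move=> n P r O W q.
have G i : 0 < i -> i <= w -> cproper n (MM r P i) r k (C i r (PP r P i) (MM r P i)).
  move=> i0 iw; apply: (CP _ i0 iw).2.
  - by apply: ord_sub O => x /andP[xn /andP[Px _]]; rewrite /bl xn.
  - exact: wid_lev.
  - by apply: Qsub q => x /andP[].
  - move=> x xn /andP[Px /eqP li]; split; first by rewrite /PP Px li leqnn.
    have := lev_anti r xn Px; rewrite li => -[s [A xs sz sP]].
    by exists s.
have val x : x < n -> P x -> [/\ 0 < lev r P x, lev r P x <= w,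
   C (lev r P x) r (PP r P (lev r P x)) (MM r P (lev r P x)) x < k &
   c r P x = (lev r P x).-1 * k + C (lev r P x) r (PP r P (lev r P x)) (MM r P (lev r P x)) x].
  move=> xn Px; have l0 := lev_gt0 r xn Px; have lw := lev_le W xn Px.
  split=> //; last by rewrite /c l0 lw.
  by apply: (G _ l0 lw).1; rewrite // /MM Px eqxx.
split=> [x xn Px|x y xn yn Px Py].
  have [l0 lw cb ->] := val x xn Px.
  apply: (@leq_trans ((lev r P x).-1 * k + k)); first by rewrite ltn_add2l.
  by rewrite addnC -mulSn prednK // leq_mul2r lw orbT.
have [l0 lw cb ->] := val x xn Px; have [l0' lw' cb' ->] := val y yn Py => E.
have k0 : 0 < k by apply: leq_ltn_trans cb.
have Ei : lev r P x = lev r P y.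
  have := congr1 (divn^~ k) E; rewrite !divnMDl // !divn_small // !addn0.
  by move: l0 l0'; case: (lev r P x) => [|a]; case: (lev r P y) => [|a'] //= _ _ ->.
move: E; rewrite Ei => /addnI E.
by apply: (G _ l0' lw').2 E; rewrite // /MM ?Px ?Py ?Ei eqxx.
Qed.

End Levels.

(** * Up-growing presentations and their variants *)

Lemma uniq_map_injin (T U : eqType) (f : T -> U) (s : seq T) : uniq (map f s) -> {in s &, injective f}.
Proof.
elim: s => //= a s IH /andP[fa /IH inj] x y; rewrite !inE.
case/orP=> [/eqP->|xs]; case/orP=> [/eqP->|ys] // E.
- by rewrite E map_f in fa.
- by rewrite -E map_f in fa.
- exact: inj.
Qed.

(** Reads an antichain as a function of its tracks; the default is reached only for tracks that miss
    [s]. *)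
Definition pk (chi : nat -> nat) (s : seq nat) i := nth 0 s (find (fun x => chi x == i) s).

Lemma pkP chi s i : i \in map chi s -> pk chi s i \in s /\ chi (pk chi s i) = i.
Proof.
move=> /mapP[x xs Ei].
have hp : has (fun x => chi x == i) s by apply/hasP; exists x; rewrite // Ei.
split; last by apply/eqP; apply: (nth_find 0 hp).
by apply: mem_nth; rewrite -has_find.
Qed.

Lemma pk_id chi s x : uniq (map chi s) -> x \in s -> pk chi s (chi x) = x.
Proof.
by move=> u xs; have [h1 h2] := pkP (map_f chi xs); apply: (uniq_map_injin u).
Qed.

Lemma full_mem (chi : nat -> nat) (s : seq nat) w i : uniq (map chi s) -> (forall x, x \in s -> chi x < w) -> size s = w ->
  i < w -> i \in map chi s.
Proof. by move=> u b sz iw; have [x xs <-] := full_colours u b (eq_leq (esym sz)) iw; apply: map_f. Qed.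

Lemma dilworth_bl n P r w : ord (bl n P) r -> wid (bl n P) r w -> exists chi, chaincol (bl n P) r w chi.
Proof.
move=> O W; pose s := [seq x <- iota 0 n | P x].
have sE x : (x \in s) = bl n P x by rewrite mem_filter mem_iota /= add0n andbC.
have [] := @dilworth s r w (filter_uniq _ (iota_uniq _ _)).
- by apply: ord_sub O => x; rewrite sE.
- by apply: wid_sub W => x; rewrite sE.
by move=> chi [b c]; exists chi; split=> [x|x y]; rewrite -!sE; [apply: b|apply: c].
Qed.

(* the join of two maximum antichains, computed chain by chain *)
Lemma join_anti D r w chi (T S : seq nat) : ord D r -> chaincol D r w chi -> anti r T -> anti r S ->
  (forall x, x \in T -> D x) -> (forall x, x \in S -> D x) -> size T = w -> size S = w ->
  let m i := if r (pk chi S i) (pk chi T i) then pk chi T i else pk chi S i in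
  let J := map m (iota 0 w) in
  [/\ anti r J, uniq (map chi J), forall i, i < w -> chi (m i) = i,
      forall i, i < w -> r (pk chi T i) (m i) & forall x, x \in J -> x \in T \/ x \in S].
Proof.
move=> [rr ra rt] C aT aS TD SD zT zS m J.
have uT := anti_chi_uniq C aT TD; have uS := anti_chi_uniq C aS SD.
have ti i : i < w -> pk chi T i \in T /\ chi (pk chi T i) = i.
  by move=> iw; apply: pkP; apply: (@full_mem chi T w) => // x /TD; apply: C.1.
have si i : i < w -> pk chi S i \in S /\ chi (pk chi S i) = i.
  by move=> iw; apply: pkP; apply: (@full_mem chi S w) => // x /SD; apply: C.1.
have cm i : i < w -> chi (m i) = i.
  by move=> iw; rewrite /m; case: ifP => _; [case: (ti i iw)|case: (si i iw)].
have dm i : i < w -> D (m i).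
  by move=> iw; rewrite /m; case: ifP => _; [apply: TD; case: (ti i iw)|apply: SD; case: (si i iw)].
have rT i : i < w -> r (pk chi T i) (m i).
  move=> iw; have [tT ct] := ti i iw; have [sS cs] := si i iw; rewrite /m; case: ifP => E.
    by apply: rr; apply: TD.
  by have := C.2 _ _ (TD _ tT) (SD _ sS) (etrans ct (esym cs)); rewrite E orbF.
have rS i : i < w -> r (pk chi S i) (m i).
  move=> iw; have [sS cs] := si i iw; rewrite /m; case: ifP => // _.
  by apply: rr; apply: SD.
have mT i : i < w -> m i \in T \/ m i \in S.
  by move=> iw; rewrite /m; case: ifP => _; [left; case: (ti i iw)|right; case: (si i iw)].
have jP x : x \in J -> exists2 i, i < w & x = m i.
  by case/mapP=> i; rewrite mem_iota /= add0n => iw ->; exists i.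
have uJ : uniq (map chi J).
  rewrite -map_comp; have /eq_in_map-> : {in iota 0 w, chi \o m =1 id}.
    by move=> i; rewrite mem_iota /= add0n; apply: cm.
  by rewrite map_id iota_uniq.
split=> //; last by move=> x /jP[i iw ->]; apply: mT.
split; first exact: map_uniq uJ.
move=> _ _ /jP[i iw ->] /jP[j jw ->] rij.
have [tTi cti] := ti i iw; have [sSi csi] := si i iw.
have [tTj ctj] := ti j jw; have [sSj csj] := si j jw.
case: (mT j jw) => mj.
  have E := aT.2 _ _ tTi mj (rt _ _ _ (TD _ tTi) (dm _ iw) (dm _ jw) (rT _ iw) rij).
  by have <- : i = j by rewrite -(cm j jw) -E cti.
have E := aS.2 _ _ sSi mj (rt _ _ _ (SD _ sSi) (dm _ iw) (dm _ jw) (rS _ iw) rij).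
by have <- : i = j by rewrite -(cm j jw) -E csi.
Qed.

Definition Qup : rule := fun n P r =>
  forall x y, y < x -> x < n -> P x -> P y -> ~~ r x y.

Section UpGame.
Variable w : nat.

(* The state is a maximum antichain with labels below [w]; it only moves up, and the labels follow the
   chains of a Dilworth decomposition. *)
Definition upspec (r : rel nat) (P : pred nat) x (st st' : seq nat * (nat -> nat)) : Prop :=
  [/\ x \in st'.1, anti r st'.1, size st'.1 = w &
      forall y, y \in st'.1 -> y <= x /\ P y] /\
  [/\ forall y, y \in st'.1 -> st'.2 y < w, uniq (map st'.2 st'.1) &
      forall a b, a \in st.1 -> b \in st'.1 -> st.2 a = st'.2 b -> r a b].

Fixpoint ust (r : rel nat) (P M : pred nat) n : seq nat * (nat -> nat) :=
  if n is n'.+1 then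
    if M n' then choice_of ([::], id) (upspec (rst n' P r) (rsp n' P) n' (ust r P M n'))
    else ust r P M n'
  else ([::], id).

Definition ucol r P M x := (ust r P M x.+1).2 x.

Lemma ust_agr x P P' r r' (M M' : pred nat) n : agr x P P' r r' -> (forall y, y <= x -> M y = M' y) ->
  n <= x.+1 -> ust r P M n = ust r' P' M' n.
Proof.
move=> A E; elim: n => //= n IH nx; rewrite IH ?(ltnW nx) //.
have A' := agrW (ltnSE nx) A.
by rewrite (agr_rst A') (agr_rsp A') E.
Qed.

Definition wanti r (P : pred nat) x T := [/\ anti r T, size T = w & forall y, y \in T -> y < x /\ P y].
Definition uinv r (P : pred nat) n (st : seq nat * (nat -> nat)) : Prop :=
  st.1 = [::] \/ [/\ wanti r P n st.1, forall y, y \in st.1 -> st.2 y < w & uniq (map st.2 st.1)].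

(** The witness is the join of the current antichain with one through [x]; the point [x] survives in
    it because nothing earlier lies above [x]. The Dilworth decomposition of the final poset only
    shows that a legal move exists; the move itself is chosen from the prefix. *)
Lemma ustep n P r x (st : seq nat * (nat -> nat)) :
  ord (bl n P) r -> wid (bl n P) r w -> Qup n P r -> x < n -> P x -> uinv r P x st ->
  (exists s, [/\ anti r s, x \in s, size s = w & forall y, y \in s -> y <= x /\ P y]) ->
  exists st', upspec r P x st st'.
Proof.
move=> O W q xn Px inv [S [aS xS zS SP]].
have [chi C] := dilworth_bl O W.
have SD y : y \in S -> bl n P y by move=> /SP[yx Py]; rewrite /bl Py (leq_ltn_trans yx).
have uS := anti_chi_uniq C aS SD.
have cS y : y \in S -> chi y < w by move/SD; apply: C.1.
case: inv => [T0|[[aT zT TP] lb lu]].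
  by exists (S, chi); split; split=> //= a b; rewrite T0.
set T := st.1 in aT zT TP lb lu.
have TD y : y \in T -> bl n P y by move=> /TP[yx Py]; rewrite /bl Py (ltn_trans yx).
have [aJ uJ cm rT JTS] := join_anti O C aT aS TD SD zT zS.
set m := fun i : nat => _ in aJ uJ cm rT JTS.
set J := map m _ in aJ uJ JTS.
have uT := anti_chi_uniq C aT TD.
have Tfull i : i < w -> i \in map chi T.
  by move=> iw; apply: (@full_mem chi T w) => // y /TD; apply: C.1.
have jP z : z \in J -> exists2 i, i < w & z = m i.
  by case/mapP=> i; rewrite mem_iota /= add0n => iw ->; exists i.
exists (J, fun b => st.2 (pk chi T (chi b))); split; split=> /=.
- have -> : x = m (chi x); last by apply: map_f; rewrite mem_iota /= add0n cS.
  rewrite /m; rewrite (pk_id uS xS); case: ifP => // rx.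
  have [tT _] := pkP (Tfull _ (cS _ xS)); have [tx tP] := TP _ tT.
  by have := q x _ tx xn Px tP; rewrite rx.
- exact: aJ.
- by rewrite size_map size_iota.
- by move=> y /JTS[/TP[/ltnW]|/SP].
- by move=> y /jP[i iw ->]; rewrite cm //; apply: lb; case: (pkP (Tfull i iw)).
- rewrite map_inj_in_uniq; first by apply: map_uniq uJ.
  move=> _ _ /jP[i iw ->] /jP[j jw ->]; rewrite !cm // => E.
  have [ti ci] := pkP (Tfull i iw); have [tj cj] := pkP (Tfull j jw).
  by have := uniq_map_injin lu ti tj E; rewrite -{2}ci -{2}cj => ->; rewrite ?ci ?cj.
- move=> a _ aT' /jP[i iw ->]; rewrite cm // => E.
  have [ti ci] := pkP (Tfull i iw).
  by rewrite (uniq_map_injin lu aT' ti E); apply: rT.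
Qed.

Lemma up_game : monl Qup w w.
Proof.
exists ucol; split.
  by move=> r r' P P' M M' x A E _; rewrite /ucol (ust_agr A E).
move=> n P M r O W q HM.
(* Invariant: above every coloured point the current antichain has an element labelled with its
   colour. A new point taking this colour lies above that element, hence above all earlier points of
   the colour. *)
pose track x m := exists2 a, a \in (ust r P M m).1 & (ust r P M m).2 a = ucol r P M x /\ r x a.
have main m : m <= n -> uinv r P m (ust r P M m) /\ (forall x, x < m -> M x ->
     [/\ track x m, ucol r P M x < w & forall y, y < x -> M y -> ucol r P M y = ucol r P M x -> r y x]).
  elim: m => [|m IH] mn; first by split=> //; left.
  have [inv tr] := IH (ltnW mn).
  case Mm : (M m); last first.
    have E : ust r P M m.+1 = ust r P M m by rewrite /= Mm.
    split.
      rewrite E; case: inv => [|[[a b c] d e]]; [by left|right; split=> //; split=> // y /c[ym Py]].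
      by rewrite (leq_trans ym).
    move=> x; rewrite ltnS leq_eqVlt => /orP[/eqP->|xm Mx]; first by rewrite Mm.
    by rewrite /track E; apply: tr.
  have [Pm sm] := HM m mn Mm.
  have [st' sp] := ustep O W q mn Pm inv sm.
  have sp' : upspec (rst m P r) (rsp m P) m (ust r P M m) (ust r P M m.+1).
    rewrite [ust r P M m.+1]/= Mm; apply: choice_ofP; exists st'.
    case: sp => [[h1 h2 h3 h4] [h5 h6 h7]]; split; split=> //.
    - by apply: anti_ext h2 => y z /h4[ym Py] /h4[zm Pz]; rewrite rst_in.
    - by move=> y /h4[ym Py]; rewrite /rsp ym.
    - move=> a b aT bT E; have [bm Pb] := h4 b bT.
      have [am Pa] : a <= m /\ P a.
        case: inv => [T0|[[_ _ TP] _ _]]; first by rewrite T0 in aT.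
        by case: (TP a aT) => /ltnW.
      by rewrite rst_in //; apply: h7.
  case: sp' => [[h1 h2 h3 h4] [h5 h6 h7]].
  have h4' y : y \in (ust r P M m.+1).1 -> y <= m /\ P y by move=> /h4[ym]; rewrite /rsp ym.
  have rE a b : rst m P r a b -> r a b by case/and5P.
  have cm : ucol r P M m = (ust r P M m.+1).2 m by [].
  have wa : anti r (ust r P M m.+1).1.
    by apply: anti_ext h2 => y z /h4'[ym Py] /h4'[zm Pz]; rewrite rst_in.
  have [rr _ rt] := O.
  have bm : bl n P m by rewrite /bl mn.
  split; first by right; split=> //; split=> // y /h4'.
  move=> x; rewrite ltnS leq_eqVlt => /orP[/eqP->|xm] Mx.
    split.
    - by exists m => //; split=> //; apply: rr.
    - by rewrite cm; apply: h5.
    - move=> y ym My E; have [[a aT [la ra]] _ _] := tr y ym My.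
      have ram : r a m by apply/rE/h7 => //; rewrite la E.
      have [am Pa] : a < m /\ P a.
        by case: inv => [T0|[[_ _ TP] _ _]]; [rewrite T0 in aT|apply: TP].
      have [Py _] := HM y (ltn_trans ym mn) My.
      by apply: (rt a) => //; rewrite /bl ?Py ?Pa ?(ltn_trans ym) ?(ltn_trans am).
  have [[a aT [la ra]] cx pr] := tr x xm Mx; split=> //.
  have iw : (ust r P M m).2 a < w by rewrite la.
  have [b bT lbE] := full_colours h6 h5 (eq_leq (esym h3)) iw.
  exists b => //; split; first by rewrite lbE.
  have rab : r a b by apply/rE/h7.
  have [am Pa] : a < m /\ P a.
    by case: inv => [T0|[[_ _ TP] _ _]]; [rewrite T0 in aT|apply: TP].
  have [bm' Pb] := h4' b bT; have [Px _] := HM x (ltn_trans xm mn) Mx.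
  by apply: (rt a) => //; rewrite /bl ?Px ?Pa ?Pb ?(ltn_trans xm) ?(ltn_trans am) ?(leq_ltn_trans bm').
have [_ F] := main n (leqnn n).
split=> [x xn Mx|x y xn yn Mx My E]; first by case: (F x xn Mx).
have [xy|yx|->] := ltngtP x y.
- by have [_ _ ->] := F y yn My.
- by have [_ _ ->] := F x xn Mx; rewrite ?orbT.
- by have [Py _] := HM y yn My; case: O => rr _ _; rewrite rr // /bl yn.
Qed.

End UpGame.

(** Level [i] needs [i] colours, hence at most [w], and there are [w] levels. *)
Lemma up_online w : onlQ Qup w (w * w).
Proof.
apply: levels => [n P P' r sub q x y yx xn /sub Px /sub Py|i i0 iw]; first exact: q.
have [c [L C]] := up_game i; exists c; split=> // n P M r O W q HM.
by have [b p] := C n P M r O W q HM; split=> // x xn Mx; apply: leq_trans iw; apply: b.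
Qed.

(** The first clause makes the sets [ell r P x] coherent: the set of a member is an initial part of
    the set of [x]. By the second, an earlier point that is not above [x] is below [x] or belongs to
    this set. *)
Definition Qcut : rule := fun n P r =>
  (forall x u l, x < n -> u < x -> l < x -> P x -> P u -> P l -> r x u -> ~~ r x l -> r l u) /\
  (forall x y, x < n -> y < x -> P x -> P y -> ~~ r x y ->
     r y x \/ forall u, u < y -> P u -> r y u -> r x u).

(* Under [Qcut] these points together with [x] are presented upwards, so [x] can take its colour in the
   up-growing strategy played on them. *)
Definition ell (r : rel nat) (P : pred nat) x y :=
  [&& y < x, P y, ~~ r x y & all (fun u => P u && r y u ==> r x u) (iota 0 y)].

Lemma ellP (r : rel nat) (P : pred nat) x y : reflect [/\ y < x, P y, ~~ r x y &
  forall u, u < y -> P u -> r y u -> r x u] (ell r P x y).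
Proof.
apply: (iffP and4P) => -[yx Py nr H]; split=> //.
  move=> u uy Pu ryu; have /allP/(_ u) := H.
  by rewrite mem_iota uy Pu ryu; apply.
apply/allP => u; rewrite mem_iota /= add0n => uy; apply/implyP => /andP[Pu ryu].
exact: H.
Qed.

Lemma cut_online w : onlQ Qcut w (w * w).
Proof.
have [c0 [L C]] := up_online w.
pose D r P x y := ell r P x y || (y == x).
exists (fun r P x => c0 r (D r P x) x); split.
  move=> r r' P P' x [E F] Px.
  have EE y : y <= x -> D r P x y = D r' P' x y.
    move=> yx; rewrite /D; case: eqP => [->|_]; first by rewrite !orbT.
    rewrite !orbF; apply/idP/idP => /ellP[lt Py nr H].
      have Py' : P' y by rewrite -E.
      have Px' : P' x by rewrite -E.
      apply/ellP; split=> //; first by rewrite -F.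
      move=> u uy Pu; have ux : u <= x by lia.
      by rewrite -!F ?E // => /H; apply; rewrite // E.
    have Py' : P y by rewrite E.
    apply/ellP; split=> //; first by rewrite F.
    move=> u uy Pu; have ux : u <= x by lia.
    by rewrite !F // => /H; apply; rewrite // -E.
  apply: L; last by rewrite /D eqxx orbT.
  split=> // y z yx zx Dy Dz; apply: F => //.
    by case/orP: Dy => [/ellP[]//|/eqP->].
  by case/orP: Dz => [/ellP[]//|/eqP->].
move=> n P r O W [H1 H2].
(* By coherence the strategy played for [x] gives the member [y] the colour that [y] received on
   arrival. *)
have cons x y : x < n -> P x -> ell r P x y -> forall z, z <= y -> D r P x z = D r P y z.
  move=> xn Px /ellP[yx Py nxy Hy] z; rewrite leq_eqVlt => /orP[/eqP->|zy].
    rewrite /D eqxx orbT; have -> // : ell r P x y by apply/ellP.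
  rewrite /D !ltn_eqF ?orbF //; last by apply: ltn_trans yx.
  have yn := ltn_trans yx xn.
  apply/ellP/ellP => -[zx Pz nz Hz]; split=> //.
  - by apply: contra nz => /Hy; apply.
  - move=> u uz Pu rzu; apply: (H1 x) => //; first by lia.
    exact: Hz.
  - exact: ltn_trans yx.
  - by apply: contra nz => rxz; apply: (H1 x) => //; lia.
  - move=> u uz Pu rzu; apply: Hy => //; [by lia|exact: Hz].
have DP x y : x < n -> P x -> D r P x y -> bl n P y.
  move=> xn Px /orP[/ellP[yx Py _ _]|/eqP->]; last by rewrite /bl xn.
  by rewrite /bl Py (ltn_trans yx).
have pr x : x < n -> P x -> cproper x.+1 (D r P x) r (w * w) (c0 r (D r P x)).
  move=> xn Px; apply: C.
  - by apply: ord_sub O => y /andP[_ /DP]; apply.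
  - by apply: wid_sub W => y /andP[_ /DP]; apply.
  move=> y z zy yx; rewrite /D; case: (eqVneq y x) => [->|ne].
    by case/orP=> [/ellP[]|]; rewrite ?ltnn // => _ /orP[/ellP[_ _ //]|/eqP E]; lia.
  rewrite orbF => /ellP[yx' Py nxy Hy] /orP[/ellP[_ Pz nxz _]|/eqP E]; last by lia.
  by apply: contra nxz; apply: Hy.
have key x y : x < n -> P x -> P y -> y < x -> c0 r (D r P y) y = c0 r (D r P x) x -> r x y || r y x.
  move=> xn Px Py yx E; case e : (ell r P x y).
    rewrite orbC; apply: (pr x xn Px).2 => //; first exact: leqW.
    - by rewrite /D e.
    - by rewrite /D eqxx orbT.
    rewrite -E; apply: L; last by rewrite /D e.
    split=> // z; exact: cons.
  case rxy : (r x y) => //=.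
  case: (H2 x y xn yx Px Py (negbT rxy)) => // H.
  by move/ellP: e; case; split=> //; rewrite rxy.
split=> [x xn Px|x y xn yn Px Py E].
  by apply: (pr x xn Px).1; rewrite // /D eqxx orbT.
have [xy|yx|->] := ltngtP x y.
- by rewrite orbC; apply: key.
- by apply: key.
- by have [rr _ _] := O; rewrite rr // /bl yn.
Qed.

Definition Qdeg : rule := fun n P r =>
  forall x s, x < n -> P x -> uniq s ->
   (forall y, y \in s -> [&& y < x, P y, ~~ r x y & ~~ r y x]) -> size s <= 2.

Fixpoint ffl (r : rel nat) (P : pred nat) n : seq nat :=
  if n is m.+1 then rcons (ffl r P m)
    (find (fun v => v \notin [seq nth 0 (ffl r P m) y | y <- iota 0 m &
        [&& P y, ~~ rst m P r m y & ~~ rst m P r y m]]) (iota 0 3))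
  else [::].

Definition fstep (r : rel nat) (P : pred nat) m (ls : seq nat) :=
  find (fun v => v \notin [seq nth 0 ls y | y <- iota 0 m &
        [&& P y, ~~ rst m P r m y & ~~ rst m P r y m]]) (iota 0 3).

Lemma fflS r P m : ffl r P m.+1 = rcons (ffl r P m) (fstep r P m (ffl r P m)).
Proof. by []. Qed.

(** First fit: at most two earlier points are incomparable to a new one, so one of three colours is
    free. *)
Lemma deg_online w : onlQ Qdeg w 3.
Proof.
have sz r P n : size (ffl r P n) = n by elim: n => //= n IH; rewrite size_rcons IH.
pose cf r P x := nth 0 (ffl r P x.+1) x.
have nthE r P n x : x < n -> nth 0 (ffl r P n) x = cf r P x.
  elim: n => // n IH; rewrite ltnS leq_eqVlt => /orP[/eqP->//|xn].
  by rewrite fflS nth_rcons sz xn IH.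
exists cf; split.
  move=> r r' P P' x A Px; rewrite /cf; congr nth.
  suff : forall n, n <= x.+1 -> ffl r P n = ffl r' P' n by apply.
  elim=> // n IH nx; rewrite !fflS IH ?(ltnW nx) //.
  rewrite /fstep (agr_rst (agrW (ltnSE nx) A)); congr rcons.
  apply: eq_find => v; congr (_ \notin map _ _); apply: eq_in_filter => y.
  by rewrite mem_iota /= add0n => yn; rewrite A.1 //; lia.
move=> n P r O W q.
have cE x : x < n -> P x -> exists t, [/\ size t <= 2, cf r P x = find (fun v => v \notin t) (iota 0 3) &
    forall y, y < x -> P y -> ~~ r x y -> ~~ r y x -> cf r P y \in t].
  move=> xn Px; set s := [seq y <- iota 0 x | [&& P y, ~~ rst x P r x y & ~~ rst x P r y x]].
  exists (map (nth 0 (ffl r P x)) s); split.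
  - rewrite size_map; apply: (q x) => //; first by rewrite filter_uniq ?iota_uniq.
    move=> y; rewrite mem_filter mem_iota /= add0n => /andP[/and3P[Py h1 h2] yx].
    by rewrite yx Py; move: h1 h2; rewrite !rst_in ?(ltnW yx) // => -> ->.
  - by rewrite /cf fflS nth_rcons sz ltnn eqxx.
  move=> y yx Py h1 h2; rewrite -(nthE r P x) //; apply: map_f.
  by rewrite mem_filter mem_iota /= add0n yx Py !rst_in ?(ltnW yx) // h1 h2.
have fb t : size t <= 2 -> has (fun v => v \notin t) (iota 0 3).
  move=> st; apply: contraT; rewrite -all_predC => /allP H.
  suff : size (iota 0 3) <= size t by rewrite size_iota; lia.
  by apply: uniq_leq_size (iota_uniq _ _) _ => v /H /=; rewrite negbK.
split=> [x xn Px|x y xn yn Px Py].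
  by have [t [st -> _]] := cE x xn Px; have := fb t st; rewrite has_find size_iota.
have key u v : u < n -> v < u -> P u -> P v -> cf r P u = cf r P v -> r u v || r v u.
  move=> un vu Pu Pv E; have [t [st cu H]] := cE u un Pu.
  apply: contraT; rewrite negb_or => /andP[h1 h2].
  have := H v vu Pv h1 h2; rewrite -E cu.
  have hf := fb t st; have := nth_find 0 hf; rewrite nth_iota.
    by rewrite add0n => /negbTE->.
  by move: hf; rewrite has_find size_iota.
move=> E; have [xy|yx|->] := ltngtP x y.
- by rewrite orbC; apply: key.
- by apply: key.
- by have [rr _ _] := O; rewrite rr // /bl yn.
Qed.

(** * Nodes between maximum antichains *)

Definition nbr (r : rel nat) (p : pred nat) (X : seq nat) : pred nat :=
  fun y => has (fun x => p x && r x y) X.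

(* Hall's condition with strict surplus on proper parts: no splitting at a tight part is possible. *)
Definition conn (r : rel nat) (X Y : seq nat) : Prop :=
  forall p : pred nat, has p X -> ~~ all p X -> count p X < count (nbr r p X) Y.

Definition btw (r : rel nat) (X Y : seq nat) : Prop :=
  (forall x, x \in X -> has (r x) Y) /\ (forall y, y \in Y -> has (r^~ y) X).

Definition wa (D : pred nat) (r : rel nat) w (S : seq nat) : Prop :=
  [/\ anti r S, size S = w & forall x, x \in S -> D x].

(* [O ++ X] and [O ++ Y] are maximum antichains with [X] below [Y]; [O] is their common rest. *)
Definition good D r w (O X Y : seq nat) : Prop :=
  [/\ wa D r w (O ++ X), wa D r w (O ++ Y) & btw r X Y].

Definition blk : Type := seq nat * seq nat * seq nat.

(** A tight [p] splits the pair into [p] with its neighbours and the two complements. The first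
    piece moves the non-neighbours in [Y] to the common rest, the second moves the part [p] of [X].
    As [p] is incomparable to the non-neighbours and the sizes match, all bounds remain maximum
    antichains. *)
Inductive decomp (r : rel nat) : seq nat -> seq nat -> seq nat -> seq blk -> Prop :=
| Dleaf O X Y : conn r X Y -> decomp r O X Y [:: (O, X, Y)]
| Dsplit O X Y (p : pred nat) b1 b2 : has p X -> ~~ all p X ->
    count (nbr r p X) Y = count p X ->
    decomp r (O ++ filter (predC (nbr r p X)) Y) (filter p X) (filter (nbr r p X) Y) b1 ->
    decomp r (O ++ filter p X) (filter (predC p) X) (filter (predC (nbr r p X)) Y) b2 ->
    decomp r O X Y (b1 ++ b2).

Lemma count_subin (T : eqType) (p q : pred T) s : (forall x, x \in s -> p x -> q x) -> count p s <= count q s.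
Proof.
elim: s => //= a s IH H; apply: leq_add; last by apply: IH => x xs; apply: H; rewrite in_cons xs orbT.
by case pa : (p a) => //; rewrite (H a) ?mem_head.
Qed.

Section Local.
Variables (D : pred nat) (r : rel nat) (w : nat) (chi : nat -> nat).
Hypothesis HO : ord D r.
Hypothesis HC : chaincol D r w chi.

Lemma wa_mem S i : wa D r w S -> (i \in map chi S) = (i < w).
Proof.
move=> [aS zS SD]; have u := anti_chi_uniq HC aS SD; apply/idP/idP.
  by case/mapP=> x /SD Dx ->; apply: HC.1.
by move=> iw; apply: (full_mem u _ zS) => // x /SD; apply: HC.1.
Qed.

Lemma wa_inj S : wa D r w S -> {in S &, injective chi}.
Proof. by move=> [aS _ SD]; apply: uniq_map_injin; apply: anti_chi_uniq HC aS SD. Qed.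

Lemma tracks_eq O X Y i : wa D r w (O ++ X) -> wa D r w (O ++ Y) ->
  (i \in map chi X) = (i \in map chi Y).
Proof.
have aux Z : wa D r w (O ++ Z) -> (i \in map chi Z) = (i < w) && (i \notin map chi O).
  move=> wZ; have := wa_mem i wZ; rewrite map_cat mem_cat => <-.
  have [aS _ SD] := wZ; have := anti_chi_uniq HC aS SD; rewrite map_cat cat_uniq => /and3P[_ h _].
  case iO : (i \in map chi O) => /=; last by rewrite andbT.
  by apply: contraNF h => iZ; apply/hasP; exists i.
by move=> /aux-> /aux->.
Qed.

Lemma wa_r O X x : wa D r w (O ++ X) -> x \in X -> D x.
Proof. by case=> _ _ H xX; apply: H; rewrite mem_cat xX orbT. Qed.

Lemma wa_anti O X x y : wa D r w (O ++ X) -> x \in X -> y \in X -> r x y -> x = y.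
Proof. by case=> -[_ A] _ _ xX yX; apply: A; rewrite mem_cat ?xX ?yX orbT. Qed.

Lemma wa_chi O X x y : wa D r w (O ++ X) -> x \in X -> y \in X -> chi x = chi y -> x = y.
Proof. by move=> /wa_inj I xX yX; apply: I; rewrite mem_cat ?xX ?yX orbT. Qed.

Lemma wa_uniq O X : wa D r w (O ++ X) -> uniq X.
Proof. by case=> -[+ _] _ _; rewrite cat_uniq => /and3P[]. Qed.

(** If the chain ran the other way, an element of [X] below [y] would lie below [x], hence be
    [x]. *)
Lemma half_dn O X Y x y : wa D r w (O ++ X) -> wa D r w (O ++ Y) ->
  (forall z, z \in Y -> has (r^~ z) X) -> x \in X -> y \in Y -> chi x = chi y -> r x y.
Proof.
move=> wX wY H xX yY E; have Dx := wa_r wX xX; have Dy := wa_r wY yY.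
have [rr ra rt] := HO.
case/orP: (HC.2 _ _ Dx Dy E) => // ryx.
have [z zX rzy] := hasP (H _ yY).
have Dz := wa_r wX zX.
by have <- : z = x by [apply: (wa_anti wX) => //; apply: (rt y)].
Qed.

Lemma half_up O X Y x y : wa D r w (O ++ X) -> wa D r w (O ++ Y) ->
  (forall z, z \in X -> has (r z) Y) -> x \in X -> y \in Y -> chi x = chi y -> r x y.
Proof.
move=> wX wY H xX yY E; have Dx := wa_r wX xX; have Dy := wa_r wY yY.
have [rr ra rt] := HO.
case/orP: (HC.2 _ _ Dx Dy E) => // ryx.
have [z zY rxz] := hasP (H _ xX).
have Dz := wa_r wY zY.
by have -> : y = z by [apply: (wa_anti wY) => //; apply: (rt x)].
Qed.

Lemma btw_of O X Y : wa D r w (O ++ X) -> wa D r w (O ++ Y) ->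
  (forall x y, x \in X -> y \in Y -> chi x = chi y -> r x y) -> btw r X Y.
Proof.
move=> wX wY H; split=> [x xX|y yY].
  have : chi x \in map chi Y by rewrite -(tracks_eq _ wX wY) map_f.
  by case/mapP=> y yY E; apply/hasP; exists y => //; apply: H.
have : chi y \in map chi X by rewrite (tracks_eq _ wX wY) map_f.
by case/mapP=> x xX E; apply/hasP; exists x => //; apply: H.
Qed.

Lemma good_dn O X Y : wa D r w (O ++ X) -> wa D r w (O ++ Y) ->
  (forall z, z \in Y -> has (r^~ z) X) -> good D r w O X Y.
Proof. by move=> wX wY H; split=> //; apply: (btw_of wX wY) => x y; apply: (half_dn wX wY H). Qed.

Lemma good_up O X Y : wa D r w (O ++ X) -> wa D r w (O ++ Y) ->
  (forall z, z \in X -> has (r z) Y) -> good D r w O X Y.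
Proof. by move=> wX wY H; split=> //; apply: (btw_of wX wY) => x y; apply: (half_up wX wY H). Qed.

Lemma good_le O X Y x y : good D r w O X Y -> x \in X -> y \in Y -> chi x = chi y -> r x y.
Proof. by case=> wX wY [_ H]; apply: (half_dn wX wY H). Qed.

(** Each [x] has the element of [Y] on its own track as a neighbour, and different tracks give
    different neighbours. *)
Lemma hall O X Y p : good D r w O X Y -> count p X <= count (nbr r p X) Y.
Proof.
move=> g; have [wX wY _] := g.
rewrite -!size_filter -(size_map chi) -(size_map chi (filter _ Y)).
apply: uniq_leq_size.
  rewrite map_inj_in_uniq ?filter_uniq ?(wa_uniq wX) // => x y.
  by rewrite !mem_filter => /andP[_ xX] /andP[_ yX]; apply: (wa_chi wX).
move=> i /mapP[x]; rewrite mem_filter => /andP[px xX] ->.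
have : chi x \in map chi Y by rewrite -(tracks_eq _ wX wY) map_f.
case/mapP=> y yY E; rewrite E; apply: map_f; rewrite mem_filter yY andbT.
by apply/hasP; exists x; rewrite // px (good_le g).
Qed.

Lemma good_size O X Y : good D r w O X Y -> size X = size Y.
Proof. by case=> -[_ h1 _] [_ h2 _] _; apply/eqP; rewrite -(eqn_add2l (size O)) -!size_cat h1 h2. Qed.

(* replacing a tight part of the lower antichain by its neighbours keeps a maximum antichain *)
Lemma swap O X B Y (p : pred nat) : good D r w O X B -> good D r w O B Y -> wa D r w (O ++ X) ->
  wa D r w (O ++ Y) -> btw r X Y ->
  count (nbr r p X) Y = count p X ->
  wa D r w ((O ++ filter (predC (nbr r p X)) Y) ++ filter (nbr r p X) B) /\
  wa D r w ((O ++ filter p X) ++ filter (predC (nbr r p X)) B).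
Proof.
move=> gXB gBY wX wY b tight; have [_ wB _] := gXB.
have [rr ra rt] := HO.
(* The neighbours in [B] are at least as many as [p], and by transitivity their neighbours in [Y]
   are among the tight set. *)
have cB : count (nbr r p X) B = count p X.
  apply/eqP; rewrite eqn_leq (hall _ gXB) andbT -tight.
  apply: leq_trans (hall _ gBY) _; apply: count_subin => y yY /hasP[z zB /andP[/hasP[x xX /andP[px rxz]] rzy]].
  apply/hasP; exists x; rewrite // px /=.
  by apply: (rt z) => //; [apply: wa_r wX xX|apply: wa_r wB zB|apply: wa_r wY yY].
have zXB := good_size gXB; have zBY := good_size gBY.
have [[uOX aOX] zOX DX] := wX; have [[uOY aOY] zOY DY] := wY; have [[uOB aOB] zOB DB] := wB.
have mc T x : x \in T -> x \in O ++ T by rewrite mem_cat orbC => ->.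
have mo T x : x \in O -> x \in O ++ T by rewrite mem_cat => ->.
have cPX := count_predC p X; have cPY := count_predC (nbr r p X) Y; have cPB := count_predC (nbr r p X) B.
have YB y z : y \in Y -> ~~ nbr r p X y -> z \in B -> nbr r p X z -> ~~ r y z && ~~ r z y.
  move=> yY ny zB nz; have Dy := DY _ (mc _ _ yY); have Dz := DB _ (mc _ _ zB); apply/andP; split.
    apply/negP => ryz; 
    case: gBY => _ _ [_ /(_ _ yY) /hasP[t tB rty]].
    have Dt := DB _ (mc _ _ tB).
    have E : t = z by apply: aOB; rewrite ?mc //; apply: (rt y).
    have E2 : y = z by apply: ra => //; rewrite -E.
    by rewrite E2 nz in ny.
  apply: contra ny => rzy; case/hasP: nz => x xX /andP[px rxz].
  apply/hasP; exists x; rewrite // px /=; apply: (rt z) => //; exact: DX (mc _ _ xX).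
have XB x z : x \in X -> p x -> z \in B -> ~~ nbr r p X z -> ~~ r x z && ~~ r z x.
  move=> xX px zB nz; have Dx := DX _ (mc _ _ xX); have Dz := DB _ (mc _ _ zB); apply/andP; split.
    by apply: contra nz => rxz; apply/hasP; exists x; rewrite // px.
  apply/negP => rzx; case: gXB => _ _ [_ /(_ _ zB) /hasP[t tX rtz]].
  have Dt := DX _ (mc _ _ tX).
  have E : t = x by apply: aOX; rewrite ?mc //; apply: (rt z).
  have E2 : x = z by apply: ra => //; rewrite -E.
  by move/negP: nz; apply; apply/hasP; exists x; rewrite // px -E2 rr.
have comb (S T : seq nat) (q q' : pred nat) : uniq (O ++ S) -> uniq (O ++ T) -> 
    (forall x y, x \in O ++ S -> y \in O ++ S -> r x y -> x = y) ->
    (forall x y, x \in O ++ T -> y \in O ++ T -> r x y -> x = y) ->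
    (forall x, x \in O ++ S -> D x) -> (forall x, x \in O ++ T -> D x) ->
    (forall y z, y \in S -> q y -> z \in T -> q' z -> ~~ r y z && ~~ r z y) ->
    size O + (count q S + count q' T) = w ->
    wa D r w ((O ++ filter q S) ++ filter q' T).
  move=> uS uT aS aT DS DT I sz; split.
  - split.
      rewrite -catA cat_uniq; move: uS uT; rewrite !cat_uniq => /and3P[-> h1 h2] /and3P[_ h3 h4] /=.
      rewrite !filter_uniq // andbT /=; apply/andP; split.
        rewrite has_cat negb_or; apply/andP; split.
          by apply: contra h1 => /hasP[x]; rewrite mem_filter => /andP[_ xS] xO; apply/hasP; exists x.
        by apply: contra h3 => /hasP[x]; rewrite mem_filter => /andP[_ xS] xO; apply/hasP; exists x.
      apply/negP => /hasP[x]; rewrite !mem_filter => /andP[qx xT] /andP[qx' xS].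
      have /andP[] := I x x xS qx' xT qx; rewrite rr //; exact: DS (mc _ _ xS).
    move=> x y; rewrite !mem_cat !mem_filter -!orbA.
    case/or3P=> [xO|/andP[qx xS]|/andP[qx xT]]; case/or3P=> [yO|/andP[qy yS]|/andP[qy yT]].
    - exact: aS (mo _ _ xO) (mo _ _ yO).
    - exact: aS (mo _ _ xO) (mc _ _ yS).
    - exact: aT (mo _ _ xO) (mc _ _ yT).
    - exact: aS (mc _ _ xS) (mo _ _ yO).
    - exact: aS (mc _ _ xS) (mc _ _ yS).
    - by have /andP[/negbTE->] := I _ _ xS qx yT qy.
    - exact: aT (mc _ _ xT) (mo _ _ yO).
    - by have /andP[_ /negbTE->] := I _ _ yS qy xT qx.
    - exact: aT (mc _ _ xT) (mc _ _ yT).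
  - by rewrite !size_cat !size_filter -addnA.
  move=> x; rewrite !mem_cat !mem_filter -orbA.
  case/or3P=> [xO|/andP[_ xS]|/andP[_ xT]]; first by apply: DS; rewrite mo.
    by apply: DS; rewrite mc.
  by apply: DT; rewrite mc.
rewrite size_cat in zOX.
split; apply: comb => //.
- by rewrite cB; lia.
- by rewrite -cB; lia.
Qed.

Lemma good_refl O X : wa D r w (O ++ X) -> good D r w O X X.
Proof.
move=> wX; split=> //; have [rr _ _] := HO.
by split=> x xX; apply/hasP; exists x => //; apply: rr; apply: wa_r wX xX.
Qed.

Lemma nbr_self O X (p : pred nat) x : wa D r w (O ++ X) -> x \in X -> nbr r p X x = p x.
Proof.
move=> wX xX; apply/hasP/idP => [[z zX /andP[pz rzx]]|px].
  by rewrite -(wa_anti wX zX xX rzx).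
by exists x; rewrite // px; have [rr _ _] := HO; apply: rr; apply: wa_r wX xX.
Qed.

Lemma split_good O X Y (p : pred nat) : good D r w O X Y -> count (nbr r p X) Y = count p X ->
  good D r w (O ++ filter (predC (nbr r p X)) Y) (filter p X) (filter (nbr r p X) Y) /\
  good D r w (O ++ filter p X) (filter (predC p) X) (filter (predC (nbr r p X)) Y).
Proof.
move=> g t; have [wX wY b] := g.
have [h1 h2] := swap (good_refl wX) g wX wY b t.
have [h3 h4] := swap g (good_refl wY) wX wY b t.
have E : {in X, nbr r p X =1 p} by move=> x xX; apply: nbr_self wX xX.
have E' : {in X, predC (nbr r p X) =1 predC p} by move=> x xX; rewrite /= (nbr_self p wX xX).
rewrite (eq_in_filter E) in h1; rewrite (eq_in_filter E') in h2.
split.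
  apply: good_dn => // y; rewrite mem_filter => /andP[/hasP[x xX /andP[px rxy]] _].
  by apply/hasP; exists x; rewrite // mem_filter px.
apply: good_dn => // y; rewrite mem_filter => /andP[ny yY].
have [x xX rxy] := hasP (b.2 y yY); apply/hasP; exists x; rewrite // mem_filter xX andbT /=.
by apply: contra ny => px; apply/hasP; exists x; rewrite // px.
Qed.

(** The cut of the bounds also cuts every maximum antichain between them, so that a point on [B]
    descends to one of the two pieces. *)
Lemma split_descent O X B Y (p : pred nat) : good D r w O X Y -> good D r w O X B -> good D r w O B Y ->
  count (nbr r p X) Y = count p X ->
  let X1 := filter p X in let Y1 := filter (nbr r p X) Y in
  let X2 := filter (predC p) X in let Y2 := filter (predC (nbr r p X)) Y in
  let B1 := filter (nbr r p X) B in let B2 := filter (predC (nbr r p X)) B in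
  [/\ good D r w (O ++ Y2) X1 B1, good D r w (O ++ Y2) B1 Y1,
      good D r w (O ++ X1) X2 B2 & good D r w (O ++ X1) B2 Y2].
Proof.
move=> g gXB gBY t X1 Y1 X2 Y2 B1 B2; have [wX wY b] := g.
have [[h1 h2 _] [h3 h4 _]] := split_good g t.
have [h5 h6] := swap gXB gBY wX wY b t.
have [_ wB bXB] := gXB; have [_ _ bBY] := gBY.
have [rr ra rt] := HO.
split.
- apply: good_dn => // y; rewrite mem_filter => /andP[/hasP[x xX /andP[px rxy]] _].
  by apply/hasP; exists x; rewrite // mem_filter px.
- apply: good_up => // z; rewrite mem_filter => /andP[/hasP[x xX /andP[px rxz]] zB].
  have [y yY rzy] := hasP (bBY.1 z zB); apply/hasP; exists y; rewrite // mem_filter yY andbT.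
  apply/hasP; exists x; rewrite // px /=.
  by apply: (rt z) => //; [apply: wa_r wX xX|apply: wa_r wB zB|apply: wa_r wY yY].
- apply: good_dn => // z; rewrite mem_filter => /andP[nz zB].
  have [x xX rxz] := hasP (bXB.2 z zB); apply/hasP; exists x; rewrite // mem_filter xX andbT /=.
  by apply: contra nz => px; apply/hasP; exists x; rewrite // px.
apply: good_dn => // y; rewrite mem_filter => /andP[ny yY].
have [z zB rzy] := hasP (bBY.2 y yY); apply/hasP; exists z; rewrite // mem_filter zB andbT /=.
apply: contra ny => /hasP[x xX /andP[px rxz]]; apply/hasP; exists x; rewrite // px /=.
by apply: (rt z) => //; [apply: wa_r wX xX|apply: wa_r wB zB|apply: wa_r wY yY].
Qed.

Lemma decomp_ex O X Y : good D r w O X Y -> exists bl, decomp r O X Y bl.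
Proof.
have [n] := ubnP (size X); elim: n O X Y => // n IH O X Y zX g.
case: (asbP (conn r X Y)) => [c|nc]; first by exists [:: (O, X, Y)]; apply: Dleaf.
have [p [hp ap tp]] : exists p : pred nat, [/\ has p X, ~~ all p X & count (nbr r p X) Y = count p X].
  apply: NNPP => F; apply: nc => p hp ap; have := hall p g.
  rewrite leq_eqVlt => /orP[/eqP E|//]; by case: F; exists p.
have [g1 g2] := split_good g tp.
have c1 := count_predC p X; have cp : 0 < count p X by rewrite -has_count.
have cp' : 0 < count (predC p) X by rewrite -has_count has_predC.
have [|b1 d1] := IH _ _ _ _ g1; first by rewrite size_filter; lia.
have [|b2 d2] := IH _ _ _ _ g2; first by rewrite size_filter; lia.
by exists (b1 ++ b2); apply: Dsplit tp d1 d2.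
Qed.

Definition bdisj (b c : blk) : bool :=
  ~~ has (fun x => x \in c.1.2) b.1.2 && ~~ has (fun x => x \in c.2) b.2.

(** The last clause is what lets a point move down the tree: an antichain through [x] between the
    bounds yields one between the bounds of a single piece. *)
Lemma decompP O X Y bl : decomp r O X Y bl -> good D r w O X Y -> X != [::] ->
  [/\ forall b, b \in bl -> [/\ good D r w b.1.1 b.1.2 b.2, conn r b.1.2 b.2, b.1.2 != [::],
          {subset b.1.2 <= X} & {subset b.2 <= Y}],
      (forall x, x \in X -> exists2 b, b \in bl & x \in b.1.2) /\
      (forall y, y \in Y -> exists2 b, b \in bl & y \in b.2),
      pairwise bdisj bl &
      forall x B, x \in B -> good D r w O X B -> good D r w O B Y ->
        exists b B', [/\ b \in bl, x \in B', good D r w b.1.1 b.1.2 B' & good D r w b.1.1 B' b.2]].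
Proof.
elim=> {O X Y bl} [O X Y c|O X Y p b1 b2 hp ap tp d1 IH1 d2 IH2] g X0.
  split.
  - by move=> b; rewrite inE => /eqP->; split.
  - by split=> x xX; exists (O, X, Y); rewrite ?inE.
  - by [].
  - by move=> x B xB gX gY; exists (O, X, Y), B; rewrite inE.
have [g1 g2] := split_good g tp.
have X1 : filter p X != [::] by rewrite -has_filter.
have X2 : filter (predC p) X != [::] by rewrite -has_filter has_predC.
have [a1 [c1 c1'] p1 e1] := IH1 g1 X1.
have [a2 [c2 c2'] p2 e2] := IH2 g2 X2.
split.
- move=> b; rewrite mem_cat => /orP[/a1[h1 h2 h3 h4 h5]|/a2[h1 h2 h3 h4 h5]]; split=> // x.
  + by move/h4; rewrite mem_filter => /andP[].
  + by move/h5; rewrite mem_filter => /andP[].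
  + by move/h4; rewrite mem_filter => /andP[].
  + by move/h5; rewrite mem_filter => /andP[].
- split=> x xX.
    case px : (p x).
      by have [|b bb xb] := c1 x; [rewrite mem_filter px|exists b; rewrite // mem_cat bb].
    by have [|b bb xb] := c2 x; [rewrite mem_filter /= px|exists b; rewrite // mem_cat bb orbT].
  case px : (nbr r p X x).
    by have [|b bb xb] := c1' x; [rewrite mem_filter px|exists b; rewrite // mem_cat bb].
  by have [|b bb xb] := c2' x; [rewrite mem_filter /= px|exists b; rewrite // mem_cat bb orbT].
- rewrite pairwise_cat p1 p2 !andbT; apply/allrelP => b c /a1[_ _ _ h4 h5] /a2[_ _ _ h4' h5'].
  apply/andP; split; apply/negP => /hasP[x].
    by move=> /h4; rewrite mem_filter => /andP[px _] /h4'; rewrite mem_filter /= px.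
  by move=> /h5; rewrite mem_filter => /andP[px _] /h5'; rewrite mem_filter /= px.
move=> x B xB gX gY; have [k1 k2 k3 k4] := split_descent g gX gY tp.
case px : (nbr r p X x).
  have [|b [B' [bb xB' gB gB']]] := e1 x (filter (nbr r p X) B) _ k1 k2; first by rewrite mem_filter px.
  by exists b, B'; rewrite mem_cat bb.
have [|b [B' [bb xB' gB gB']]] := e2 x (filter (predC (nbr r p X)) B) _ k3 k4; first by rewrite mem_filter /= px.
by exists b, B'; rewrite mem_cat bb orbT.
Qed.

(* descending past an event: B is replaced by its join or meet with the event antichain *)
Lemma event_up O X Y E B x : good D r w O X E -> good D r w O E Y -> x \in B ->
  good D r w O X B -> good D r w O B Y -> has (r^~ x) E ->
  exists B', [/\ x \in B', good D r w O E B' & good D r w O B' Y].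
Proof.
move=> gXE gEY xB gXB gBY /hasP[e eE rex].
have [_ wE _] := gXE; have [wB wY _] := gBY.
have [rr ra rt] := HO.
pose m e := let b := pk chi B (chi e) in if r b e then e else b.
have pkB z : z \in E -> pk chi B (chi z) \in B /\ chi (pk chi B (chi z)) = chi z.
  by move=> zE; apply: pkP; rewrite -(tracks_eq _ wE wB) map_f.
have rE z : z \in E -> r z (m z).
  move=> zE; have [bB cb] := pkB z zE; rewrite /m; case: ifP => h.
    by apply: rr; apply: wa_r wE zE.
  by have := HC.2 _ _ (wa_r wB bB) (wa_r wE zE) cb; rewrite h.
have rB z : z \in E -> r (pk chi B (chi z)) (m z).
  move=> zE; have [bB cb] := pkB z zE; rewrite /m; case: ifP => h //.
  by apply: rr; apply: wa_r wB bB.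
have mm z : z \in E -> m z \in E \/ m z \in B.
  by move=> zE; rewrite /m; case: ifP => _; [left|right; case: (pkB z zE)].
have mD z : z \in E -> D (m z).
  by move=> zE; case: (mm z zE) => h; [apply: wa_r wE h|apply: wa_r wB h].
have mc z : z \in E -> chi (m z) = chi z.
  by move=> zE; rewrite /m; case: ifP => _ //; case: (pkB z zE).
have minj z t : z \in E -> t \in E -> r (m z) (m t) -> z = t.
  move=> zE tE rzt; apply: (wa_chi wE) => //.
  have [bz cz] := pkB z zE; have [bt ct] := pkB t tE.
  case: (mm t tE) => h.
    have F : z = m t.
      apply: (wa_anti wE) => //; apply: (rt (m z)) => //; first exact: wa_r wE zE.
      - exact: mD.
      - exact: mD.
      - exact: rE.
    by rewrite F mc.
  have F : pk chi B (chi z) = m t.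
    apply: (wa_anti wB) => //; apply: (rt (m z)) => //; first exact: wa_r wB bz.
    - exact: mD.
    - exact: mD.
    - exact: rB.
  by rewrite -cz F mc.
have [[uE aE] zE DE] := wE; have [[uB aB] zB DB] := wB.
have mO z t : z \in O -> t \in E -> r z (m t) || r (m t) z -> False.
  move=> zO tE h.
  case: (mm t tE) => mt.
    have F : z = m t.
      have h1 : z \in O ++ E by rewrite mem_cat zO.
      have h2 : m t \in O ++ E by rewrite mem_cat mt orbT.
      by case/orP: h => h; [apply: aE|symmetry; apply: aE].
    by move: uE; rewrite cat_uniq => /and3P[_ /hasP[]]; exists (m t); rewrite // -F.
  have F : z = m t.
    have h1 : z \in O ++ B by rewrite mem_cat zO.
    have h2 : m t \in O ++ B by rewrite mem_cat mt orbT.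
    by case/orP: h => h; [apply: aB|symmetry; apply: aB].
  by move: uB; rewrite cat_uniq => /and3P[_ /hasP[]]; exists (m t); rewrite // -F.
have DO z : z \in O -> D z by move=> zO; apply: DE; rewrite mem_cat zO.
have wJ : wa D r w (O ++ map m E).
  split.
  - split.
      move: (uE); rewrite !cat_uniq => /and3P[-> h1 h2] /=; apply/andP; split.
        apply/negP => /hasP[_ /mapP[t tE ->]] mtO.
        by apply: (@mO (m t) t) => //; rewrite rr //; apply: mD.
      rewrite map_inj_in_uniq // => z t zE' tE F; apply: minj => //.
      by rewrite F; apply: rr; apply: mD.
    move=> z t; rewrite !mem_cat => /orP[zO|/mapP[z' zE' ->]] /orP[tO|/mapP[t' tE' ->]] h.
    + by apply: aE; rewrite ?mem_cat ?zO ?tO.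
    + by case: (@mO z t') => //; rewrite h.
    + by case: (@mO t z') => //; rewrite h orbT.
    + by rewrite (minj z' t').
  - by move: zE; rewrite !size_cat size_map.
  - move=> z; rewrite mem_cat => /orP[zO|/mapP[t tE ->]]; [exact: DO|exact: mD].
have /mapP[e' eE' ce] : chi x \in map chi E by rewrite (tracks_eq _ wE wB) map_f.
have xm : x = m e'.
  have xk : pk chi B (chi e') = x.
    have [h1 h2] := pkB e' eE'; apply: (wa_chi wB) => //; by rewrite h2.
  rewrite /m xk; case: ifP => // h.
  have Dx := wa_r wB xB.
  have F : e = e' by apply: (wa_anti wE) => //; apply: (rt x) => //; [apply: wa_r wE eE|apply: wa_r wE eE'].
  by apply: ra => //; [apply: wa_r wE eE'|rewrite -F].
exists (map m E); split.
- by rewrite xm map_f.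
- by apply: good_up => // z zE'; apply/hasP; exists (m z); [apply: map_f|apply: rE].
apply: good_up => // _ /mapP[t tE ->]; case: (mm t tE) => h.
  by case: gEY => _ _ [+ _]; apply.
by case: gBY => _ _ [+ _]; apply.
Qed.

End Local.

Definition flip (r : rel nat) : rel nat := fun x y => r y x.

Lemma anti_flip r s : anti r s -> anti (flip r) s.
Proof. by case=> u A; split=> // x y xs ys h; symmetry; apply: A. Qed.

Lemma ord_flip D r : ord D r -> ord D (flip r).
Proof.
case=> rr ra rt; split=> [x|x y Dx Dy h1 h2|y x z Dx Dy Dz h1 h2]; first exact: rr.
  exact: ra.
exact: (rt y).
Qed.

Lemma chain_flip D r w chi : chaincol D r w chi -> chaincol D (flip r) w chi.
Proof. by case=> b c; split=> // x y Dx Dy E; rewrite orbC; apply: c. Qed.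

Lemma good_flip D r w O X Y : good D r w O X Y -> good D (flip r) w O Y X.
Proof.
by case=> -[a1 z1 d1] [a2 z2 d2] [b1 b2]; split; split=> //; apply: anti_flip.
Qed.

Lemma event_dn D r w chi O X Y E B x : ord D r -> chaincol D r w chi ->
  good D r w O X E -> good D r w O E Y -> x \in B ->
  good D r w O X B -> good D r w O B Y -> has (r x) E ->
  exists B', [/\ x \in B', good D r w O X B' & good D r w O B' E].
Proof.
move=> HO HC gXE gEY xB gXB gBY h.
have [B' [xB' g1 g2]] := event_up (ord_flip HO) (chain_flip HC) (good_flip gEY) (good_flip gXE)
  xB (good_flip gBY) (good_flip gXB) h.
by exists B'; split=> //; apply: good_flip.
Qed.

Lemma event_cmp D r w O X E B x : ord D r -> wid D r w -> good D r w O X E -> good D r w O X B ->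
  x \in B -> has (r^~ x) E || has (r x) E.
Proof.
move=> [rr _ _] W [_ wE _] [_ wB _] xB; have [[uE aE] zE DE] := wE; have [[uB aB] zB DB] := wB.
apply: contraT; rewrite negb_or => /andP[/hasPn h1 /hasPn h2].
have Dx : D x by apply: DB; rewrite mem_cat xB orbT.
have xO : x \notin O.
  by move: uB; rewrite cat_uniq => /and3P[_ /hasPn/(_ x xB)].
have xE : x \notin E by apply/negP => /h1; rewrite rr.
have := W (x :: O ++ E); rewrite /= zE ltnn => F; apply: F.
  split; first by rewrite /= uE mem_cat negb_or xO xE.
  have aux y : y \in O ++ E -> (r x y = false) * (r y x = false).
    rewrite mem_cat => /orP[yO|yE]; last by rewrite (negbTE (h1 y yE)) (negbTE (h2 y yE)).
    have i1 : y \in O ++ B by rewrite mem_cat yO.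
    have i2 : x \in O ++ B by rewrite mem_cat xB orbT.
    by split; apply/negP => h; move: xO; [rewrite (aB x y) ?yO|rewrite -(aB y x) ?yO].
  move=> y z; rewrite !in_cons => /orP[/eqP->|yO] /orP[/eqP->|zO] //.
  - by rewrite (aux z zO).
  - by rewrite (aux y yO).
  - exact: aE.
by move=> y; rewrite in_cons => /orP[/eqP->//|/DE].
Qed.

(** * The tree of nodes *)

(* [X k] and [Y k] bound node [k] from below and above. The nodes born at one point are the pieces of
   their common parent below ([up] false) and above ([up] true) an antichain through that point; [hl] and
   [hu] tell whether a lower, resp. upper, sibling has as many edges as the parent. *)
Record data := Data {
  par : nat -> nat; up : nat -> bool; hl : nat -> bool; hu : nat -> bool;
  X : nat -> seq nat; Y : nat -> seq nat; dr : rel nat }.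

Section Attributes.
Variables (b : nat) (cq cup cdeg : colouring) (w : nat).
Variable d : data.

Fixpoint anc_fuel n k := if n is n'.+1 then k :: (if k == 0 then [::] else anc_fuel n' (par d k)) else [::].
Definition ancs k := anc_fuel k.+1 k.

(* [k] and [l] descend from a lower and an upper child of the same node, so that every track common to
   both passes [k] first. *)
Definition vb k l := has (fun g => has (fun h =>
  [&& 0 < g, 0 < h, par d g == par d h, ~~ up d g & up d h]) (ancs l)) (ancs k).

(** This forces all points inside [k] below all points inside [l]. Comparability of the bounds alone
    would also hold between a node with equal one-element bounds and itself; [vb] makes the relation
    strict. *)
Definition tri k l := vb k l && all (fun y => all (fun x => dr d y x) (X d l)) (Y d k).

(* As nodes shrink, their bipartite comparability graphs lose edges; [sr k] is the topmost ancestor with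
   the same graph as [k]. *)
Definition ecount k := sumn [seq count (dr d x) (Y d k) | x <- X d k].

Definition sr k := last k [seq a <- ancs k | ecount a == ecount k].
Definition big k := b <= size (X d k).
Definition gl k := [seq a <- ancs k | sr a == a].
Definition thick k F :=
  all (fun x => ~~ has (dr d x) (X d k) || all (dr d x) (X d k)) (X d F) &&
  all (fun y => ~~ has ((dr d)^~ y) (Y d k) || all ((dr d)^~ y) (Y d k)) (Y d F).
(* Climbing the super roots above [k], [base k] is the first one none of whose bounds splits [k], and
   [Gof k] is the one just before it. *)
Definition gidx k := find (thick k) (behead (gl k)).
Definition Gof k := nth 0 (gl k) (gidx k).
Definition base k := nth 0 (behead (gl k)) (gidx k).
Definition hasbase k := has (thick k) (behead (gl k)).
Definition Uof k := [seq x <- X d (base k) | has (dr d x) (X d k)].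
Definition Vof k := [seq y <- Y d (base k) | has ((dr d)^~ y) (Y d k)].
Definition bsr k := [&& sr k == k, big k & hasbase k].
Definition samet k a := [&& bsr a, ecount a == ecount k, base a == base k, Uof a == Uof k & Vof a == Vof k].
(* The first of the super roots indistinguishable from [k] as seen from their common base. *)
Definition rp k := find (samet k) (iota 0 k.+1).
Definition simt k a := [&& bsr a, rp a == a, base a == base k, ecount a == ecount k,
  size (Uof a) == size (Uof k) & size (Vof a) == size (Vof k)].
Definition tix k := count (simt k) (iota 0 (rp k)).
(* Blocks are ordered by a single comparability between the attached parts of their bases: it implies
   [tri] for all nodes of the two blocks. *)
Definition lnk a c := vb (base a) (base c) && has (fun y => has (dr d y) (Uof c)) (Vof a).
Definition qrel : rel nat := fun a c => (a == c) || lnk a c.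
Definition qpres k : pred nat := fun a => [&& bsr a, rp a == a, ecount a == ecount k,
  ecount (base a) == ecount (base k), size (Uof a) == size (Uof k), size (Vof a) == size (Vof k) &
  tix a == tix k].
Definition chain k := cq qrel (qpres k) (rp k).

Definition spar k := sr (par d k).
Definition kind k := if hu d k then 0 else if hl d k then 1 else 2.
(** Fixing this index leaves at most one child of each parent. *)
Definition sidx k := count (fun i => (0 < i) && (par d i == par d k)) (iota 0 k).
Definition lrel : rel nat := fun a c => (a == c) || tri a c.
Definition lpres k : pred nat :=
  fun a => [&& 0 < a, sr a == a, kind a == kind k, spar a == spar k & sidx a == sidx k].
(** If the upper side has an heir, the new super roots of a family arrive essentially upwards; with
    a lower heir only, downwards. Without heirs the family ends at the parent, and few earlier super
    roots are incomparable to a new one. *)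
Definition lraw k := if kind k == 0 then cup lrel (lpres k) k
  else if kind k == 1 then cup (fun x y => lrel y x) (lpres k) k else cdeg lrel (lpres k) k.
Definition loc k := [:: kind k; sidx k; lraw k].

(** The searches of these super roots went past [Gof k], so each of them is split by a bound of that
    node; this keeps their number polynomial. *)
Definition pset k a := [&& sr a == a, big a, ecount a == ecount k, Gof a == Gof k, hasbase a == hasbase k,
  base a == base k & a != Gof a].
Definition pidx k := count (pset k) (iota 0 k).
(** Without a base the search ends at the root, and the final bit tells the root from all other
    nodes. *)
Definition col k :=
  if hasbase k then [:: 1; ecount k; pidx k; ecount (base k); size (Uof k); size (Vof k); tix k]
     ++ loc (Gof k)
  else [:: 0; ecount k; pidx k; nat_of_bool (Gof k != k)].
Definition chn k := if hasbase k then chain k else 0.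
End Attributes.

(** The orders are compared only on bounds of the first nodes, because a later tree knows more
    points. *)
Definition dagr k (d e : data) : Prop :=
  [/\ forall i, i <= k -> par d i = par e i, forall i, i <= k -> up d i = up e i,
      forall i, i <= k -> X d i = X e i, forall i, i <= k -> Y d i = Y e i &
      forall i j, i <= k -> j <= k -> forall x y, x \in X d i ++ Y d i -> y \in X d j ++ Y d j -> dr d x y = dr e x y] /\
  (forall i, i <= k -> hl d i = hl e i) /\ (forall i, i <= k -> hu d i = hu e i) /\
  (forall i, i <= k -> 0 < i -> par d i < i) /\ par d 0 = 0.

(** * Locality of the node attributes *)

Section Congruence.
Variables (b : nat) (cq cup cdeg : colouring).
Hypotheses (Lq : local cq) (Lup : local cup) (Ldeg : local cdeg).
Variables (k0 : nat) (d e : data).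
Hypothesis A : dagr k0 d e.

Let Hp i : i <= k0 -> par d i = par e i. Proof. by case: A => -[h _ _ _ _] _; apply: h. Qed.
Let Hu i : i <= k0 -> up d i = up e i. Proof. by case: A => -[_ h _ _ _] _; apply: h. Qed.
Let HX i : i <= k0 -> X d i = X e i. Proof. by case: A => -[_ _ h _ _] _; apply: h. Qed.
Let HY i : i <= k0 -> Y d i = Y e i. Proof. by case: A => -[_ _ _ h _] _; apply: h. Qed.
Let Hr i j x y : i <= k0 -> j <= k0 -> x \in X d i ++ Y d i -> y \in X d j ++ Y d j -> dr d x y = dr e x y.
Proof. by case: A => -[_ _ _ _ h] _ ik jk; apply: (h i j). Qed.
Let Hhl i : i <= k0 -> hl d i = hl e i. Proof. by case: A => _ [h _]; apply: h. Qed.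
Let Hhu i : i <= k0 -> hu d i = hu e i. Proof. by case: A => _ [_ [h _]]; apply: h. Qed.
Let Hlt i : i <= k0 -> 0 < i -> par d i < i. Proof. by case: A => _ [_ [_ [h _]]]; apply: h. Qed.
Let Hlt' i : i <= k0 -> par d i <= k0.
Proof. by move=> ik; case: (posnP i) => [->|i0]; [case: A => _ [_ [_ [_ ->]]]|apply: leq_trans (ltnW (Hlt ik i0)) ik]. Qed.

Lemma anc_fuel_cong n k : k <= k0 -> anc_fuel d n k = anc_fuel e n k.
Proof. by elim: n k => //= n IH k kk; rewrite -Hp // IH // Hlt'. Qed.

Lemma ancs_cong k : k <= k0 -> ancs d k = ancs e k.
Proof. exact: anc_fuel_cong. Qed.

Lemma anc_fuel_le n k a : k <= k0 -> a \in anc_fuel d n k -> a <= k.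
Proof.
elim: n k => //= n IH k kk; rewrite inE => /orP[/eqP->//|].
case: (posnP k) => [->//|k0']; rewrite ?(gtn_eqF k0') => /IH h.
by apply: leq_trans (h _) (ltnW (Hlt kk k0')); apply: Hlt'.
Qed.

Lemma ancs_le k a : k <= k0 -> a \in ancs d k -> a <= k.
Proof. exact: anc_fuel_le. Qed.

Lemma ancs_le0 k a : k <= k0 -> a \in ancs d k -> a <= k0.
Proof. by move=> kk /(ancs_le kk) ak; apply: leq_trans ak kk. Qed.

Lemma vb_cong k l : k <= k0 -> l <= k0 -> vb d k l = vb e k l.
Proof.
move=> kk lk; rewrite /vb -!ancs_cong //; apply: eq_in_has => g gk; apply: eq_in_has => h hk.
have gk' := ancs_le0 kk gk; have hk' := ancs_le0 lk hk.
by rewrite !Hp ?Hu.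
Qed.

Lemma Xmem k x : x \in X d k -> x \in X d k ++ Y d k. Proof. by rewrite mem_cat => ->. Qed.
Lemma Ymem k x : x \in Y d k -> x \in X d k ++ Y d k. Proof. by rewrite mem_cat orbC => ->. Qed.

Lemma tri_cong k l : k <= k0 -> l <= k0 -> tri d k l = tri e k l.
Proof.
move=> kk lk; rewrite /tri vb_cong // -HX // -HY //; congr (_ && _).
apply: eq_in_all => y yY; apply: eq_in_all => x xX.
by apply: (Hr kk lk); [apply: Ymem|apply: Xmem].
Qed.

Lemma ecount_cong k : k <= k0 -> ecount d k = ecount e k.
Proof.
move=> kk; rewrite /ecount -HX // -HY //; congr sumn; apply/eq_in_map => x xX.
by apply: eq_in_count => y yY; apply: (Hr kk kk); [apply: Xmem|apply: Ymem].
Qed.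

Lemma sr_cong k : k <= k0 -> sr d k = sr e k.
Proof.
move=> kk; rewrite /sr -ancs_cong //; congr last; apply: eq_in_filter => a ak.
by rewrite !ecount_cong //; apply: ancs_le0 ak.
Qed.

Lemma big_cong k : k <= k0 -> big b d k = big b e k.
Proof. by move=> kk; rewrite /big HX. Qed.

Lemma gl_cong k : k <= k0 -> gl d k = gl e k.
Proof.
move=> kk; rewrite /gl -ancs_cong //; apply: eq_in_filter => a ak.
by rewrite sr_cong //; apply: ancs_le0 ak.
Qed.

Lemma thick_cong k F : k <= k0 -> F <= k0 -> thick d k F = thick e k F.
Proof.
move=> kk Fk; rewrite /thick -!HX // -!HY //; congr (_ && _).
  apply: eq_in_all => x xX; congr (~~ _ || _); [apply: eq_in_has|apply: eq_in_all] => z zX;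
    by apply: (Hr Fk kk); apply: Xmem.
apply: eq_in_all => y yY; congr (~~ _ || _); [apply: eq_in_has|apply: eq_in_all] => z zX;
  by apply: (Hr kk Fk); apply: Ymem.
Qed.

Lemma gl_le k a : k <= k0 -> a \in gl d k -> a <= k0.
Proof. by move=> kk; rewrite mem_filter => /andP[_ /(ancs_le0 kk)]. Qed.

Lemma bgl_le k a : k <= k0 -> a \in behead (gl d k) -> a <= k0.
Proof. by move=> kk /mem_behead; apply: gl_le. Qed.

Lemma gidx_cong k : k <= k0 -> gidx d k = gidx e k.
Proof.
move=> kk; rewrite /gidx -gl_cong //; have : all (leq^~ k0) (behead (gl d k)).
  by apply/allP => a; apply: bgl_le.
by elim: (behead _) => //= a s IH /andP[ak /IH->]; rewrite thick_cong.
Qed.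

Lemma nth_le0 s i : all (leq^~ k0) s -> nth 0 s i <= k0.
Proof. by elim: s i => [|a s IH] [|i] //= /andP[h /IH]. Qed.

Lemma base_le k : k <= k0 -> base d k <= k0.
Proof. by move=> kk; apply: nth_le0; apply/allP => a; apply: bgl_le. Qed.

Lemma Gof_le k : k <= k0 -> Gof d k <= k0.
Proof. by move=> kk; apply: nth_le0; apply/allP => a; apply: gl_le. Qed.

Lemma Gof_cong k : k <= k0 -> Gof d k = Gof e k.
Proof. by move=> kk; rewrite /Gof gidx_cong // gl_cong. Qed.

Lemma base_cong k : k <= k0 -> base d k = base e k.
Proof. by move=> kk; rewrite /base gidx_cong // gl_cong. Qed.

Lemma hasbase_cong k : k <= k0 -> hasbase d k = hasbase e k.
Proof.
move=> kk; rewrite /hasbase -gl_cong //; apply: eq_in_has => a /(bgl_le kk) ak.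
exact: thick_cong.
Qed.

Lemma Uof_cong k : k <= k0 -> Uof d k = Uof e k.
Proof.
move=> kk; rewrite /Uof -base_cong // -!HX ?base_le //; apply: eq_in_filter => x xX.
by apply: eq_in_has => z zX; apply: (Hr (base_le kk) kk); apply: Xmem.
Qed.

Lemma Vof_cong k : k <= k0 -> Vof d k = Vof e k.
Proof.
move=> kk; rewrite /Vof -base_cong // -!HY ?base_le //; apply: eq_in_filter => x xX.
by apply: eq_in_has => z zX; apply: (Hr kk (base_le kk)); apply: Ymem.
Qed.

Lemma bsr_cong k : k <= k0 -> bsr b d k = bsr b e k.
Proof. by move=> kk; rewrite /bsr sr_cong // big_cong // hasbase_cong. Qed.

Lemma samet_cong k a : k <= k0 -> a <= k0 -> samet b d k a = samet b e k a.
Proof.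
by move=> kk ak; rewrite /samet bsr_cong // !ecount_cong // !base_cong // !Uof_cong // !Vof_cong.
Qed.

Lemma rp_cong k : k <= k0 -> rp b d k = rp b e k.
Proof.
move=> kk; rewrite /rp; have : all (leq^~ k0) (iota 0 k.+1).
  by apply/allP => a; rewrite mem_iota => h; lia.
by elim: (iota _ _) => //= a s IH /andP[ak /IH->]; rewrite samet_cong.
Qed.

Lemma simt_cong k a : k <= k0 -> a <= k0 -> simt b d k a = simt b e k a.
Proof.
by move=> kk ak; rewrite /simt bsr_cong // rp_cong // !ecount_cong // !base_cong // !Uof_cong // !Vof_cong.
Qed.

Lemma rp_le k : rp b d k <= k.+1.
Proof. by rewrite /rp; apply: leq_trans (find_size _ _) _; rewrite size_iota. Qed.

Lemma tix_cong k : k <= k0 -> tix b d k = tix b e k.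
Proof.
move=> kk; rewrite /tix -rp_cong //; apply: eq_in_count => a; rewrite mem_iota => ak.
by apply: simt_cong => //; have := rp_le k; lia.
Qed.

Lemma lnk_cong k l : k <= k0 -> l <= k0 -> lnk d k l = lnk e k l.
Proof.
move=> kk lk; rewrite /lnk -!base_cong // vb_cong ?base_le // -Vof_cong // -Uof_cong //.
congr (_ && _); apply: eq_in_has => y; rewrite mem_filter => /andP[_ yY].
apply: eq_in_has => x; rewrite mem_filter => /andP[_ xX].
by apply: (Hr (base_le kk) (base_le lk)); [apply: Ymem|apply: Xmem].
Qed.

Lemma qpres_cong k a : k <= k0 -> a <= k0 -> qpres b d k a = qpres b e k a.
Proof.
move=> kk ak; rewrite /qpres bsr_cong // rp_cong // !tix_cong // -!base_cong //.
by rewrite !ecount_cong ?base_le // !Uof_cong // !Vof_cong.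
Qed.

Lemma rp_self k : bsr b d k -> samet b d k (rp b d k) /\ rp b d k <= k.
Proof.
move=> bk; have hs : has (samet b d k) (iota 0 k.+1).
  by apply/hasP; exists k; [rewrite mem_iota /=; lia|rewrite /samet bk !eqxx].
have := nth_find 0 hs; rewrite has_find size_iota in hs; rewrite nth_iota //.
Qed.

Lemma rp_rp k : bsr b d k -> rp b d (rp b d k) = rp b d k.
Proof.
move=> bk; have [sk rk] := rp_self bk.
have /and5P[b1 /eqP e1 /eqP e2 /eqP e3 /eqP e4] := sk.
have [sk' rk'] := rp_self b1.
apply/eqP; rewrite eqn_leq rk' /=.
have := sk'; rewrite /samet e1 e2 e3 e4 -/(samet b d k _) => s2.
rewrite leqNgt; apply/negP => lt.
have := before_find 0 (lt : rp b d (rp b d k) < find (samet b d k) (iota 0 k.+1)).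
by rewrite nth_iota ?add0n ?s2 //; lia.
Qed.

(** Locality of [cq] speaks only of presented elements, and the element coloured for [k] is its
    representative. *)
Lemma qpres_self k : bsr b d k -> qpres b d k (rp b d k).
Proof.
move=> bk; have [/and5P[b1 /eqP e1 /eqP e2 /eqP e3 /eqP e4] rk] := rp_self bk.
have rr := rp_rp bk.
rewrite /qpres b1 e1 e2 e3 e4 rr !eqxx /= /tix rr; apply/eqP/eq_count => a.
rewrite /simt ?e1 ?e2 ?e3 ?e4 //.
Qed.

Lemma chain_cong k : k <= k0 -> bsr b d k -> chain b cq d k = chain b cq e k.
Proof.
move=> kk bk; rewrite /chain -rp_cong //.
have [_ rk] := rp_self bk; have rk0 := leq_trans rk kk.
apply: Lq; last exact: qpres_self.
split=> [a ak|a c ak ck _ _]; first by apply: qpres_cong => //; lia.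
by rewrite /qrel lnk_cong //; lia.
Qed.

Lemma spar_cong k : k <= k0 -> spar d k = spar e k.
Proof. by move=> kk; rewrite /spar -Hp // sr_cong // Hlt'. Qed.

Lemma kind_cong k : k <= k0 -> kind d k = kind e k.
Proof. by move=> kk; rewrite /kind Hhl // Hhu. Qed.

Lemma sidx_cong k : k <= k0 -> sidx d k = sidx e k.
Proof.
move=> kk; rewrite /sidx; apply: eq_in_count => i; rewrite mem_iota => ik.
by rewrite !Hp //; lia.
Qed.

Lemma lpres_cong k a : k <= k0 -> a <= k0 -> lpres d k a = lpres e k a.
Proof. by move=> kk ak; rewrite /lpres sr_cong // !kind_cong // !spar_cong // !sidx_cong. Qed.

Lemma loc_cong k : k <= k0 -> sr d k = k -> 0 < k -> loc cup cdeg d k = loc cup cdeg e k.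
Proof.
move=> kk sk kp; rewrite /loc kind_cong // sidx_cong //; congr [:: _; _; _].
rewrite /lraw -kind_cong //.
have pk : lpres d k k by rewrite /lpres kp sk !eqxx.
have ag r r' : (forall a c, a <= k -> c <= k -> r a c = r' a c) -> agr k (lpres d k) (lpres e k) r r'.
  by move=> H; split=> [a ak|a c ak ck _ _]; [apply: lpres_cong => //; lia|apply: H].
case: ifP => _; last case: ifP => _.
- by apply: Lup => //; apply: ag => a c ak ck; rewrite /lrel tri_cong //; lia.
- by apply: Lup => //; apply: ag => a c ak ck; rewrite /lrel tri_cong //; lia.
- by apply: Ldeg => //; apply: ag => a c ak ck; rewrite /lrel tri_cong //; lia.
Qed.

Lemma pidx_cong k : k <= k0 -> pidx b d k = pidx b e k.
Proof.
move=> kk; rewrite /pidx; apply: eq_in_count => a; rewrite mem_iota => ak.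
have ak' : a <= k0 by lia.
by rewrite /pset sr_cong // big_cong // !ecount_cong // !Gof_cong // !hasbase_cong // !base_cong.
Qed.

Lemma col_cong k : k <= k0 -> bsr b d k || ~~ hasbase d k -> (hasbase d k -> sr d (Gof d k) = Gof d k /\ 0 < Gof d k) ->
  col b cup cdeg d k = col b cup cdeg e k.
Proof.
move=> kk bk Gk; rewrite /col -hasbase_cong //.
case hb : (hasbase d k) in bk Gk *; last by rewrite ecount_cong // pidx_cong // Gof_cong.
rewrite orbF in bk; have [sG G0] := Gk isT.
rewrite ecount_cong // pidx_cong // -base_cong // ecount_cong ?base_le // Uof_cong // Vof_cong // tix_cong //.
by rewrite -Gof_cong // loc_cong // Gof_le.
Qed.

Lemma chn_cong k : k <= k0 -> bsr b d k || ~~ hasbase d k -> chn b cq d k = chn b cq e k.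
Proof. by move=> kk; rewrite /chn -hasbase_cong //; case: (hasbase d k) => //; rewrite orbF => /chain_cong->. Qed.

End Congruence.

Lemma pigeon (T : eqType) (f : T -> nat) (s : seq T) n B : (forall x, x \in s -> f x < n) ->
  (forall i, i < n -> size [seq x <- s | f x == i] <= B) -> size s <= n * B.
Proof.
elim: n s => [|n IH] s fn H; first by case: s fn H => // a s /(_ a (mem_head _ _)).
rewrite -(count_predC (fun x => f x == n)) mulSn; apply: leq_add; first by rewrite -size_filter H.
rewrite -size_filter; apply: IH => [x|i iN].
  by rewrite mem_filter /= => /andP[ne /fn]; rewrite ltnS leq_eqVlt (negbTE ne).
apply: leq_trans (H i (ltnW iN)); rewrite -filter_predI !size_filter.
by apply: sub_count => x /= /andP[].
Qed.

(* A fixed decomposition of the poset into [w] chains (tracks) names the points of every antichain: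
   [T k] is the set of tracks through node [k], entering it at [px k] and leaving it at [py k]. *)
Section World.
Variables (d : data) (m w : nat) (D : pred nat) (T : nat -> {set 'I_w}) (px py : nat -> 'I_w -> nat).
Variable bn : nat -> nat.
Local Notation r := (dr d).
Definition edges k := [set p : 'I_w * 'I_w | [&& p.1 \in T k, p.2 \in T k & r (px k p.1) (py k p.2)]].

Record world : Prop := World {
  HO : ord D r;
  m0 : 0 < m;
  par0 : par d 0 = 0;
  par_lt : forall k, k < m -> 0 < k -> par d k < k;
  Dx : forall k i, k < m -> i \in T k -> D (px k i);
  Dy : forall k i, k < m -> i \in T k -> D (py k i);
  XP : forall k x, k < m -> x \in X d k <-> exists2 i, i \in T k & x = px k i;
  YP : forall k x, k < m -> x \in Y d k <-> exists2 i, i \in T k & x = py k i;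
  sizeX : forall k, k < m -> size (X d k) = #|T k|;
  sizeY : forall k, k < m -> size (Y d k) = #|T k|;
  T0 : forall k, k < m -> exists i, i \in T k;
  pxy : forall k i, k < m -> i \in T k -> r (px k i) (py k i);
  lowH : forall k, k < m -> 0 < k -> ~~ up d k -> [/\ T k \subset T (par d k),
     forall i, i \in T k -> px k i = px (par d k) i & forall i, i \in T k -> r (py k i) (py (par d k) i)];
  upH : forall k, k < m -> 0 < k -> up d k -> [/\ T k \subset T (par d k),
     forall i, i \in T k -> py k i = py (par d k) i & forall i, i \in T k -> r (px (par d k) i) (px k i)];
  sibH : forall k l i, k < m -> l < m -> 0 < k -> 0 < l -> par d k = par d l -> up d k = up d l ->
     i \in T k -> i \in T l -> k = l;
  crossH : forall k l i, k < m -> l < m -> 0 < k -> 0 < l -> par d k = par d l -> ~~ up d k -> up d l ->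
     i \in T k -> i \in T l -> r (py k i) (px l i);
  connH : forall k (S : {set 'I_w}) i0 j0, k < m -> S \subset T k -> i0 \in S -> j0 \in T k -> j0 \notin S ->
     exists i j, [/\ i \in S, j \in T k, j \notin S & r (px k i) (py k j)];
  bn_sib : forall k l, k < m -> l < m -> 0 < k -> 0 < l -> par d k = par d l -> bn k = bn l;
  bn_mono : forall k l, l < m -> k <= l -> bn k <= bn l;
  bn_par : forall k, k < m -> 0 < k -> bn (par d k) < bn k;
  eH : forall k, k < m -> ecount d k = #|edges k|;
  hlH : forall k, k < m -> 0 < k -> hl d k <-> exists g, [/\ g < m, 0 < g, par d g = par d k, ~~ up d g &
     ecount d g = ecount d (par d k)];
  huH : forall k, k < m -> 0 < k -> hu d k <-> exists g, [/\ g < m, 0 < g, par d g = par d k, up d g &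
     ecount d g = ecount d (par d k)] }.

Hypothesis W : world.
Let rr := let: And3 h _ _ := HO W in h.
Let ra := let: And3 _ h _ := HO W in h.
Let rt := let: And3 _ _ h := HO W in h.

Lemma anc_fuel_ge n n' k : k < m -> k < n -> n <= n' -> anc_fuel d n k = anc_fuel d n' k.
Proof.
elim: n n' k => [|n IH] [|n'] k km kn nn //=.
case: (posnP k) => [->//|kp]; rewrite ?(gtn_eqF kp).
have lt := par_lt W km kp; congr (_ :: _); apply: IH; lia.
Qed.

Lemma ancsE k : k < m -> 0 < k -> ancs d k = k :: ancs d (par d k).
Proof.
move=> km kp; rewrite /ancs [LHS]/= gtn_eqF //; have lt := par_lt W km kp.
by rewrite (@anc_fuel_ge (par d k).+1 k) //; lia.
Qed.

Lemma ancs0 : ancs d 0 = [:: 0]. Proof. by []. Qed.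

Lemma anc_refl k : k \in ancs d k. Proof. by rewrite /ancs /= mem_head. Qed.

Lemma anc_ind (Q : nat -> Prop) : Q 0 ->
  (forall l, l < m -> 0 < l -> Q (par d l) -> Q l) -> forall k, k < m -> Q k.
Proof.
move=> Q0 QS k km; have [n] := ubnP k; elim: n k km => // n IH k km kn.
case: (posnP k) => [->//|kp]; apply: QS => //; have lt := par_lt W km kp; apply: IH; lia.
Qed.

Lemma anc_step a k : k < m -> a \in ancs d k -> a = k \/ 0 < k /\ a \in ancs d (par d k).
Proof.
move=> km; case: (posnP k) => [->|kp]; first by rewrite ancs0 inE => /eqP; left.
by rewrite ancsE // inE => /orP[/eqP|]; [left|right].
Qed.

Lemma anc_le a k : k < m -> a \in ancs d k -> a <= k.
Proof.
move=> km; move: k km a; apply: anc_ind => [a|l lm lp IH a]; first by rewrite ancs0 inE => /eqP->.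
by case/(anc_step lm) => [->//|[_ /IH]]; have := par_lt W lm lp; lia.
Qed.

Lemma anc_m a k : k < m -> a \in ancs d k -> a < m.
Proof. by move=> km /(anc_le km); lia. Qed.

Lemma parm k : k < m -> par d k < m.
Proof. by case: (posnP k) => [->|kp] km; [rewrite (par0 W)|have := par_lt W km kp; lia]. Qed.

Lemma anc_trans c a k : k < m -> a \in ancs d c -> c \in ancs d k -> a \in ancs d k.
Proof.
move=> km; move: k km; apply: anc_ind => [|l lm lp IH] ac; first by rewrite ancs0 inE => /eqP E; rewrite E in ac.
case/(anc_step lm) => [<-//|[_ /(IH ac) h]]; by rewrite ancsE // inE h orbT.
Qed.

Lemma anc_par k : k < m -> par d k \in ancs d k.
Proof.
move=> km; case: (posnP k) => [->|kp]; first by rewrite (par0 W); apply: anc_refl.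
by rewrite ancsE // inE; apply/orP; right; apply: anc_refl.
Qed.

Lemma anc_lin a c k : k < m -> a \in ancs d k -> c \in ancs d k -> a \in ancs d c \/ c \in ancs d a.
Proof.
move=> km; move: k km a c; apply: anc_ind => [a c|l lm lp IH a c].
  by rewrite ancs0 !inE => /eqP-> /eqP->; left.
case/(anc_step lm) => [->|[_ h]]; first by right.
case/(anc_step lm) => [->|[_ h']]; last exact: IH.
by left; apply: (@anc_trans (par d l)) => //; apply: anc_par.
Qed.

Lemma anc_child a k : k < m -> a \in ancs d k -> a != k ->
  exists g, [/\ 0 < g, g < m, par d g = a & g \in ancs d k].
Proof.
move=> km; move: k km; apply: anc_ind => [|l lm lp IH]; first by rewrite ancs0 inE => ->.
case/(anc_step lm) => [->|[_ h]]; first by rewrite eqxx.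
case: (eqVneq a (par d l)) => [->|ne] _; first by exists l; split=> //; apply: anc_refl.
have [g [g0 gm pg ga]] := IH h ne; exists g; split=> //.
by apply: (@anc_trans (par d l)) => //; apply: anc_par.
Qed.

Lemma anc_zero k : k < m -> 0 \in ancs d k.
Proof.
move=> km; move: k km; apply: anc_ind => [|l lm lp IH]; first exact: anc_refl.
by rewrite ancsE // inE IH orbT.
Qed.

Lemma sib_anc g h k : k < m -> 0 < g -> 0 < h -> par d g = par d h -> g \in ancs d k -> h \in ancs d k -> g = h.
Proof.
move=> km g0 h0 E; have aux x y : 0 < x -> 0 < y -> x < m -> y < m -> par d x = par d y -> x \in ancs d y -> x = y.
  move=> x0 y0 xm ym E' /(anc_step ym)[//|[_]]; rewrite -E' => /(anc_le (parm xm)).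
  by have := par_lt W xm x0; lia.
move=> gk hk; have gm := anc_m km gk; have hm := anc_m km hk.
by case: (anc_lin km gk hk) => h'; [|symmetry]; apply: aux.
Qed.

Lemma par_T k : k < m -> T k \subset T (par d k).
Proof.
move=> km; case: (posnP k) => [->|kp]; first by rewrite (par0 W).
by case U : (up d k); [case: (upH W km kp U)|case: (lowH W km kp (negbT U))].
Qed.

Lemma par_px k i : k < m -> i \in T k -> r (px (par d k) i) (px k i).
Proof.
move=> km ik; case: (posnP k) => [E|kp]; first by rewrite E (par0 W); apply/rr/Dx; rewrite -?E.
case U : (up d k); first by have [_ _ H] := upH W km kp U; apply: H.
by have [_ H _] := lowH W km kp (negbT U); rewrite H //; apply/rr/(Dx W (parm km))/(subsetP (par_T km)).
Qed.

Lemma par_py k i : k < m -> i \in T k -> r (py k i) (py (par d k) i).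
Proof.
move=> km ik; case: (posnP k) => [E|kp]; first by rewrite E (par0 W); apply/rr/Dy; rewrite -?E.
case U : (up d k); last by have [_ _ H] := lowH W km kp (negbT U); apply: H.
by have [_ H _] := upH W km kp U; rewrite H //; apply/rr/(Dy W (parm km))/(subsetP (par_T km)).
Qed.

Lemma anc_T a k : k < m -> a \in ancs d k -> T k \subset T a.
Proof.
move=> km; move: k km; apply: anc_ind => [|l lm lp IH]; first by rewrite ancs0 inE => /eqP->.
by case/(anc_step lm) => [->//|[_ /IH]]; apply: subset_trans; apply: par_T.
Qed.

Lemma anc_in a k i : k < m -> a \in ancs d k -> i \in T k -> i \in T a.
Proof. by move=> km /(anc_T km)/subsetP; apply. Qed.

Lemma anc_px a k i : k < m -> a \in ancs d k -> i \in T k -> r (px a i) (px k i).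
Proof.
move=> km; move: k km; apply: anc_ind => [|l lm lp IH].
  by rewrite ancs0 inE => /eqP-> i0; apply/rr/(Dx W (m0 W)).
case/(anc_step lm) => [-> il|[_ al] il]; first by apply/rr/Dx.
have ip := subsetP (par_T lm) i il; apply: (rt _ _ _ (IH al ip)); last exact: par_px.
- exact: (Dx W (anc_m (parm lm) al) (anc_in (parm lm) al ip)).
- exact: (Dx W (parm lm)).
- exact: Dx.
Qed.

Lemma anc_py a k i : k < m -> a \in ancs d k -> i \in T k -> r (py k i) (py a i).
Proof.
move=> km; move: k km; apply: anc_ind => [|l lm lp IH].
  by rewrite ancs0 inE => /eqP-> i0; apply/rr/(Dy W (m0 W)).
case/(anc_step lm) => [-> il|[_ al] il]; first by apply/rr/Dy.
have ip := subsetP (par_T lm) i il; apply: (rt _ _ _ (par_py lm il)); last exact: IH.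
- exact: Dy.
- exact: (Dy W (parm lm)).
- exact: (Dy W (anc_m (parm lm) al) (anc_in (parm lm) al ip)).
Qed.

Lemma anc_E a k : k < m -> a \in ancs d k -> edges k \subset edges a.
Proof.
move=> km ak; apply/subsetP => -[i j]; rewrite !inE /= => /and3P[ik jk rij].
have am := anc_m km ak; have ia := anc_in km ak ik; have ja := anc_in km ak jk.
rewrite ia ja /=; apply: (rt (Dx W am ia) (Dx W km ik) (Dy W am ja) (anc_px km ak ik)).
by apply: (rt (Dx W km ik) (Dy W km jk) (Dy W am ja) rij (anc_py km ak jk)).
Qed.

Lemma anc_e a k : k < m -> a \in ancs d k -> ecount d k <= ecount d a.
Proof. by move=> km ak; rewrite !(eH W) ?subset_leq_card ?anc_E //; apply: anc_m ak. Qed.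

Lemma e_edges a k : k < m -> a \in ancs d k -> ecount d k = ecount d a -> edges k = edges a.
Proof.
move=> km ak E; apply/eqP; rewrite eqEcard anc_E //= -!(eH W) //; first by rewrite E.
exact: anc_m ak.
Qed.

Lemma diag k i : k < m -> ((i, i) \in edges k) = (i \in T k).
Proof. by move=> km; rewrite !inE /=; case ik : (i \in T k) => //=; rewrite (pxy W). Qed.

Lemma edges_T k l : k < m -> l < m -> edges k = edges l -> T k = T l.
Proof. by move=> km lm E; apply/setP => i; rewrite -!diag // E. Qed.

Lemma vbP k l : k < m -> l < m -> reflect (exists g h, [/\ g \in ancs d k, h \in ancs d l, g < m, h < m & 
   [/\ 0 < g, 0 < h, par d g = par d h, ~~ up d g & up d h]]) (vb d k l).
Proof.
move=> km lm; apply: (iffP hasP) => [[g gk /hasP[h hl' /and5P[g0 h0 /eqP E u1 u2]]]|].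
  by exists g, h; split=> //; [apply: anc_m gk|apply: anc_m hl'].
move=> [g [h [gk hl' _ _ [g0 h0 E u1 u2]]]]; exists g => //; apply/hasP; exists h => //.
by rewrite g0 h0 E eqxx u1 u2.
Qed.

Lemma vb_irr k : k < m -> vb d k k = false.
Proof.
move=> km; apply/vbP => // -[g [h [gk hk gm hm [g0 h0 E u1 u2]]]].
by move: u1; rewrite (sib_anc km g0 h0 E gk hk) u2.
Qed.

(** The two branchings give two ancestors of [l], hence nested ones; the branching nearer the root
    also separates [k] from [n]. *)
Lemma vb_trans l k n : k < m -> l < m -> n < m -> vb d k l -> vb d l n -> vb d k n.
Proof.
move=> km lm nm /(vbP km lm)[g [h [gk hl' gm hm [g0 h0 E u1 u2]]]].
move=> /(vbP lm nm)[g' [h' [gl' hn gm' hm' [g0' h0' E' u1' u2']]]].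
have ne : h != g' by apply: contraTneq u2 => ->.
case: (anc_lin lm hl' gl') => H.
  apply/vbP => //; exists g, h; split=> //.
  case: (anc_step gm' H) => [F|[_ H']]; first by rewrite F eqxx in ne.
  by apply: anc_trans hn => //; rewrite ancsE // inE -E' H' orbT.
apply/vbP => //; exists g', h'; split=> //.
case: (anc_step hm H) => [F|[_ H']]; first by rewrite F eqxx in ne.
by apply: anc_trans gk => //; rewrite ancsE // inE E H' orbT.
Qed.

Lemma vb_anc k l k' l' : k' < m -> l' < m -> k \in ancs d k' -> l \in ancs d l' -> vb d k l -> vb d k' l'.
Proof.
move=> km lm kk ll; have km' := anc_m km kk; have lm' := anc_m lm ll.
move=> /(vbP km' lm')[g [h [gk hl' gm hm H]]]; apply/vbP => //; exists g, h; split=> //.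
  exact: anc_trans kk.
exact: anc_trans ll.
Qed.

Lemma vb_le k l i : k < m -> l < m -> vb d k l -> i \in T k -> i \in T l -> r (py k i) (px l i).
Proof.
move=> km lm /(vbP km lm)[g [h [gk hl' gm hm [g0 h0 E u1 u2]]]] ik il.
have ig := anc_in km gk ik; have ih := anc_in lm hl' il.
apply: (rt (Dy W km ik) (Dy W gm ig) (Dx W lm il) (anc_py km gk ik)).
apply: (rt (Dy W gm ig) (Dx W hm ih) (Dx W lm il) _ (anc_px lm hl' il)).
exact: (crossH W).
Qed.

Lemma vb_nanc k l : k < m -> l < m -> vb d k l -> (k \in ancs d l) = false /\ (l \in ancs d k) = false.
Proof.
move=> km lm V; split; apply/negP => H.
  by have := vb_irr lm; rewrite (vb_anc lm lm H (anc_refl l) V).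
by have := vb_irr km; rewrite (vb_anc km km (anc_refl k) H V).
Qed.

Lemma sibs k l : k < m -> l < m -> [\/ k \in ancs d l, l \in ancs d k | exists g h,
  [/\ g \in ancs d k, h \in ancs d l, 0 < g, 0 < h & par d g = par d h] /\ g != h].
Proof.
have [n] := ubnP (k + l); elim: n k l => // n IH k l; rewrite ltnS => kl km lm.
have step a c : a + c <= n -> a < c -> a < m -> c < m -> [\/ a \in ancs d c, c \in ancs d a | exists g h,
  [/\ g \in ancs d a, h \in ancs d c, 0 < g, 0 < h & par d g = par d h] /\ g != h].
  move=> acn ac am cm; have cp : 0 < c by lia.
  have lt := par_lt W cm cp; have pm := parm cm.
  have [||//|H|H|[g [h [[h1 h2 h3 h4 h5] h6]]]] := IH a (par d c); first by lia.
  - exact: am.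
  - by constructor 1; rewrite ancsE // inE H orbT.
  - case: (eqVneq (par d c) a) => [<-|ne]; first by constructor 1; apply: anc_par.
    have [g [g0 gm pg gk]] := anc_child am H ne.
    case: (eqVneq g c) => [<-|gc]; first by constructor 2.
    by constructor 3; exists g, c; split=> //; split=> //; apply: anc_refl.
  - constructor 3; exists g, h; split=> //; split=> //.
    by apply: anc_trans h2 _ => //; apply: anc_par.
have [kl'|lk|->] := ltngtP k l; last by constructor 1; apply: anc_refl.
  exact: step.
have [||||H|H|[g [h [[h1 h2 h3 h4 h5] h6]]]] := step l k; rewrite ?(addnC l) //.
- by constructor 2.
- by constructor 1.
- by constructor 3; exists h, g; split; [split|rewrite eq_sym].
Qed.

(** Distinct siblings on the same side of a split have no common track, so two non-nested nodes
    sharing a track branch off on different sides. *)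
Lemma sep k l i : k < m -> l < m -> i \in T k -> i \in T l ->
  [\/ k \in ancs d l, l \in ancs d k, vb d k l | vb d l k].
Proof.
move=> km lm ik il; case: (sibs km lm) => [H|H|[g [h [[gk hl' g0 h0 E] ne]]]].
- by constructor 1.
- by constructor 2.
have gm := anc_m km gk; have hm := anc_m lm hl'.
have ig := anc_in km gk ik; have ih := anc_in lm hl' il.
case ug : (up d g); case uh : (up d h).
- by rewrite (sibH W gm hm g0 h0 E _ ig ih) ?ug ?uh ?eqxx in ne.
- by constructor 4; apply/vbP => //; exists h, g; split=> //; split=> //; rewrite ?uh ?ug.
- by constructor 3; apply/vbP => //; exists g, h; split=> //; split=> //; rewrite ?uh ?ug.
- by rewrite (sibH W gm hm g0 h0 E _ ig ih) ?ug ?uh ?eqxx in ne.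
Qed.

Lemma srE k : k < m -> 0 < k -> sr d k = if ecount d (par d k) == ecount d k then sr d (par d k) else k.
Proof.
move=> km kp; rewrite /sr (ancsE km kp).
have pL := anc_refl (par d k).
have HL a : a \in ancs d (par d k) -> ecount d a = ecount d k -> ecount d (par d k) = ecount d k.
  by move=> ak E; have := anc_e (parm km) ak; have := anc_e km (anc_par km); lia.
move: (ancs d (par d k)) pL HL => L pL HL; rewrite [filter _ (k :: L)]/= eqxx [last k _]/=.
case: eqP => E.
  rewrite E; have : par d k \in [seq a <- L | ecount d a == ecount d k] by rewrite mem_filter pL E eqxx.
  by case: (filter _ _).
have -> // : [seq a <- L | ecount d a == ecount d k] = [::].
rewrite (eq_in_filter (a2 := pred0)) ?filter_pred0 // => a aL /=.
by apply/eqP => F; apply: E; apply: HL F.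
Qed.

Lemma sr0 : sr d 0 = 0. Proof. by rewrite /sr ancs0 /= eqxx. Qed.

Lemma sr_anc k : k < m -> sr d k \in ancs d k.
Proof.
move=> km; move: k km; apply: anc_ind => [|l lm lp IH]; first by rewrite sr0 anc_refl.
rewrite srE //; case: ifP => _; last exact: anc_refl.
by apply: anc_trans IH _ => //; apply: anc_par.
Qed.

Lemma sr_m k : k < m -> sr d k < m.
Proof. by move=> km; apply: anc_m (sr_anc km). Qed.

Lemma sr_e k : k < m -> ecount d (sr d k) = ecount d k.
Proof.
move=> km; move: k km; apply: anc_ind => [|l lm lp IH]; first by rewrite sr0.
by rewrite srE //; case: ifP => [/eqP <-|].
Qed.

Lemma sr_same a k : k < m -> a \in ancs d k -> ecount d a = ecount d k -> sr d a = sr d k.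
Proof.
move=> km; move: k km; apply: anc_ind => [|l lm lp IH]; first by rewrite ancs0 inE => /eqP->.
case/(anc_step lm) => [->//|[_ al]] E.
have h1 := anc_e (parm lm) al; have h2 := anc_e lm (anc_par lm).
have F : ecount d (par d l) = ecount d l by lia.
by rewrite (srE lm lp) F eqxx; apply: IH => //; rewrite E F.
Qed.

Lemma sr_idem k : k < m -> sr d (sr d k) = sr d k.
Proof. by move=> km; apply: (sr_same km (sr_anc km)); apply: sr_e. Qed.

Lemma sroot_lt k : k < m -> 0 < k -> sr d k = k -> ecount d k < ecount d (par d k).
Proof.
move=> km kp; rewrite srE // ltn_neqAle eq_sym (anc_e km (anc_par km)) andbT; case: eqP => // E F.
have := anc_le (parm km) (sr_anc (parm km)); rewrite F.
by have := par_lt W km kp; lia.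
Qed.

Lemma sroot_nest k l : l < m -> sr d k = k -> sr d l = l -> ecount d k = ecount d l -> k \in ancs d l -> k = l.
Proof. by move=> lm sk sl E kl; have := sr_same lm kl E; rewrite sk sl. Qed.

(** * Bounds for sets of pairwise non-nested nodes *)

Definition nonnest (s : seq nat) := [/\ uniq s, forall k, k \in s -> k < m &
  forall k l, k \in s -> l \in s -> k \in ancs d l -> k = l].

Lemma nonnest_filter p s : nonnest s -> nonnest (filter p s).
Proof.
case=> u b n; split; first exact: filter_uniq.
  by move=> k; rewrite mem_filter => /andP[_ /b].
by move=> k l; rewrite !mem_filter => /andP[_ ks] /andP[_ ls]; apply: n.
Qed.

Lemma nonnest_sep s k l i : nonnest s -> k \in s -> l \in s -> k != l -> i \in T k -> i \in T l -> vb d k l || vb d l k.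
Proof.
move=> [_ b n] ks ls ne ik il; case: (sep (b k ks) (b l ls) ik il) => [H|H|->|->] //; last by rewrite orbT.
  by rewrite (n _ _ ks ls H) eqxx in ne.
by rewrite (n _ _ ls ks H) eqxx in ne.
Qed.

Lemma track_bound (s : seq nat) (Q : nat -> 'I_w -> Prop) :
  uniq s -> (forall k, k \in s -> exists i, Q k i) ->
  (forall k l i, k \in s -> l \in s -> Q k i -> Q l i -> k = l) -> size s <= w.
Proof.
case: s => [|k0 s0] //; set s := k0 :: s0 => us ex inj.
have [i0 _] := ex k0 (mem_head _ _).
pose f k := choice_of i0 (Q k).
have fP k : k \in s -> Q k (f k) by move=> ks; apply: (choice_ofP i0 (ex k ks)).
apply: (@size_inj_bound _ s (fun k => nat_of_ord (f k))); last by move=> y /mapP[k _ ->].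
rewrite map_inj_in_uniq // => k l ks ls /val_inj E.
by apply: (inj k l (f k)) => //; [apply: fP|rewrite E; apply: fP].
Qed.

(** Connectedness yields a track that enters [R] inside the node. Nodes sharing a track follow one
    another on it, and a track enters an up-set only once. *)
Lemma partial_up (s : seq nat) (R : pred nat) : nonnest s ->
  (forall x y, D x -> D y -> R x -> r x y -> R y) ->
  (forall k, k \in s -> has R (X d k) && ~~ all R (X d k)) -> size s <= w.
Proof.
move=> ns Rup pr; have [us b n] := ns.
apply: (@track_bound s (fun k j => [/\ j \in T k, ~~ R (px k j) & R (py k j)])) => // [k ks|k l j ks ls].
  have km := b k ks; have /andP[/hasP[x xX Rx] /allPn[z zX Rz]] := pr k ks.
  have [i ik xE] := (XP W x km).1 xX; have [j jk zE] := (XP W z km).1 zX.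
  have [||||i' [j' [iS jT jS rij]]] := @connH W k [set i in T k | R (px k i)] i j km.
  - by apply/subsetP => t; rewrite inE => /andP[].
  - by rewrite inE ik -xE.
  - exact: jk.
  - by rewrite inE jk -zE.
  move: iS jS; rewrite !inE jT /= => /andP[iT Ri] Rj.
  by exists j'; split=> //; apply: Rup rij => //; [apply: Dx|apply: Dy].
move=> [jk Rk Rk'] [jl Rl Rl']; apply/eqP/contraT => ne.
have km := b k ks; have lm := b l ls.
case/orP: (nonnest_sep ns ks ls ne jk jl) => V.
  by rewrite (Rup _ _ (Dy W km jk) (Dx W lm jl) Rk' (vb_le km lm V jk jl)) in Rl.
by rewrite (Rup _ _ (Dy W lm jl) (Dx W km jk) Rl' (vb_le lm km V jl jk)) in Rk.
Qed.

Lemma partial_dn (s : seq nat) (R : pred nat) : nonnest s ->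
  (forall x y, D x -> D y -> R y -> r x y -> R x) ->
  (forall k, k \in s -> has R (Y d k) && ~~ all R (Y d k)) -> size s <= w.
Proof.
move=> ns Rdn pr; have [us b n] := ns.
apply: (@track_bound s (fun k j => [/\ j \in T k, R (px k j) & ~~ R (py k j)])) => // [k ks|k l j ks ls].
  have km := b k ks; have /andP[/hasP[x xX Rx] /allPn[z zX Rz]] := pr k ks.
  have [i ik xE] := (YP W x km).1 xX; have [j jk zE] := (YP W z km).1 zX.
  have [||||i' [j' [iS jT jS rij]]] := @connH W k [set i in T k | ~~ R (py k i)] j i km.
  - by apply/subsetP => t; rewrite inE => /andP[].
  - by rewrite inE jk -zE.
  - exact: ik.
  - by rewrite inE ik -xE negbK.
  move: iS jS; rewrite !inE jT /= negbK => /andP[iT Ri] Rj.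
  by exists i'; split=> //; apply: Rdn rij => //; [apply: Dx|apply: Dy].
move=> [jk Rk Rk'] [jl Rl Rl']; apply/eqP/contraT => ne.
have km := b k ks; have lm := b l ls.
case/orP: (nonnest_sep ns ks ls ne jk jl) => V.
  by rewrite (Rdn _ _ (Dy W km jk) (Dx W lm jl) Rl (vb_le km lm V jk jl)) in Rk'.
by rewrite (Rdn _ _ (Dy W lm jl) (Dx W km jk) Rk (vb_le lm km V jl jk)) in Rl'.
Qed.

Lemma triP k l : k < m -> l < m ->
  (forall i j, i \in T k -> j \in T l -> r (py k i) (px l j)) -> vb d k l -> tri d k l.
Proof.
move=> km lm H V; rewrite /tri V /=; apply/allP => y /(YP W y km)[i ik ->].
by apply/allP => x /(XP W x lm)[j jl ->]; apply: H.
Qed.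

Lemma tri_le k l i j : k < m -> l < m -> tri d k l -> i \in T k -> j \in T l -> r (py k i) (px l j).
Proof.
move=> km lm /andP[_ /allP H] ik jl.
have hy : py k i \in Y d k by apply/(YP W) => //; exists i.
by apply: (allP (H _ hy)); apply/(XP W) => //; exists j.
Qed.

Lemma tri_anc k l k' l' : k' < m -> l' < m -> k \in ancs d k' -> l \in ancs d l' -> tri d k l -> tri d k' l'.
Proof.
move=> km lm kk ll H; have km' := anc_m km kk; have lm' := anc_m lm ll.
apply: triP => // [i j ik jl|]; last by apply: (vb_anc km lm kk ll); case/andP: H.
have ik' := anc_in km kk ik; have jl' := anc_in lm ll jl.
apply: (rt (Dy W km ik) (Dy W km' ik') (Dx W lm jl) (anc_py km kk ik)).
apply: (rt (Dy W km' ik') (Dx W lm' jl') (Dx W lm jl) _ (anc_px lm ll jl)).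
exact: tri_le.
Qed.

Lemma tri_trans l k n : k < m -> l < m -> n < m -> tri d k l -> tri d l n -> tri d k n.
Proof.
move=> km lm nm h1 h2; apply: triP => // [i j ik jn|].
  have [t tl] := T0 W lm.
  apply: (rt (Dy W km ik) (Dx W lm tl) (Dx W nm jn) (tri_le km lm h1 ik tl)).
  apply: (rt (Dx W lm tl) (Dy W lm tl) (Dx W nm jn) (pxy W lm tl)).
  exact: tri_le.
by case/andP: h1 => h1 _; case/andP: h2 => h2 _; apply: vb_trans h1 h2.
Qed.

(** Nodes on one track are linearly ordered by [vb]. If more than [w] precede [k], one of them lies
    entirely below the lower bound of [k] on the track, since this down-set splits at most [w] of
    them. If more than [w] also follow, one lies entirely above, and these two are completely
    comparable. *)
Lemma tri_track s i : nonnest s -> (forall k, k \in s -> i \in T k) ->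
  (forall k l, k \in s -> l \in s -> ~~ tri d k l) -> size s <= 2 * w.+1.
Proof.
move=> ns it nt; have [us b n] := ns.
pose lo k := [seq l <- s | vb d l k]; pose hi k := [seq l <- s | vb d k l].
have lohi k : k \in s -> (size (lo k) <= w) || (size (hi k) <= w).
  move=> ks; have km := b k ks; have ik := it k ks.
  apply: contraT; rewrite negb_or -!ltnNge => /andP[h1 h2].
  have [a [aS va aa]] : exists a, [/\ a \in s, vb d a k & all (fun y => r y (px k i)) (Y d a)].
    apply: NNPP => F; move: h1; rewrite ltnNge => /negP; apply.
    apply: (@partial_dn (lo k) (fun y => r y (px k i))); first exact: nonnest_filter.
      by move=> x y Dx' Dy' h1 h3; apply: rt h3 h1 => //; apply: (Dx W).
    move=> l; rewrite mem_filter => /andP[vl ls]; apply/andP; split.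
      apply/hasP; exists (py l i); last by apply: vb_le (vl) _ _ => //; [apply: b|apply: it].
      by apply/(YP W); [apply: b|exists i; rewrite ?it].
    by apply/negP => H; apply: F; exists l.
  have [c [cS vc cc]] : exists c, [/\ c \in s, vb d k c & all (r (px k i)) (X d c)].
    apply: NNPP => F; move: h2; rewrite ltnNge => /negP; apply.
    apply: (@partial_up (hi k) (r (px k i))); first exact: nonnest_filter.
      by move=> x y Dx' Dy' h2 h3; apply: rt h2 h3 => //; apply: (Dx W).
    move=> l; rewrite mem_filter => /andP[vl ls]; have lm := b l ls; have il := it l ls; apply/andP; split.
      apply/hasP; exists (px l i); first by apply/(XP W) => //; exists i.
      apply: (rt (Dx W km ik) (Dy W km ik) (Dx W lm il) (pxy W km ik)).
      exact: vb_le.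
    by apply/negP => H; apply: F; exists l.
  have am := b a aS; have cm := b c cS.
  have /negP[] := nt a c aS cS; apply: triP => //; last exact: vb_trans va vc.
  move=> t u ta uc; apply: (rt (Dy W am ta) (Dx W km ik) (Dx W cm uc)).
    by apply: (allP aa); apply/(YP W) => //; exists t.
  by apply: (allP cc); apply/(XP W) => //; exists u.
have tot k l : k \in s -> l \in s -> k != l -> vb d k l || vb d l k.
  by move=> ks ls ne; apply: (nonnest_sep ns ks ls ne (it k ks) (it l ls)).
(* In a linear order at most [w + 1] elements have at most [w] predecessors; applied to [vb] and to
   its reverse. *)
have half (rl : rel nat) : (forall k, k \in s -> rl k k = false) ->
    (forall k l t, k \in s -> l \in s -> t \in s -> rl k l -> rl l t -> rl k t) ->
    (forall k l, k \in s -> l \in s -> k != l -> rl k l || rl l k) ->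
    size [seq k <- s | size [seq l <- s | rl l k] <= w] <= w.+1.
  move=> ir tr to; set A := filter _ s.
  case: (eqVneq A [::]) => [->//|A0].
  have As k : k \in A -> k \in s by rewrite mem_filter => /andP[].
  have [|k kA kmax] := @max_elt A (fun x y => (x == y) || rl x y) _ A0.
    split=> [x _|x y /As xs /As ys|y x z /As xs /As ys /As zs]; first by rewrite eqxx.
      case/orP=> [/eqP//|h1] /orP[/eqP//|h2]; by have := tr _ _ _ xs ys xs h1 h2; rewrite ir.
    case/orP=> [/eqP->//|h1] /orP[/eqP<-|h2]; first by rewrite h1 orbT.
    by rewrite (tr _ _ _ xs ys zs h1 h2) orbT.
  have ks := As k kA.
  apply: (@leq_trans (size (k :: [seq l <- s | rl l k]))); last by rewrite /= ltnS; move: kA; rewrite mem_filter => /andP[].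
  apply: uniq_leq_size; first exact: filter_uniq.
  move=> l lA; rewrite inE mem_filter (As l lA) andbT; case: eqP => //= /eqP ne.
  case/orP: (to _ _ (As l lA) ks ne) => // h.
  by have E := kmax l lA; rewrite E ?eqxx // h orbT in ne.
have h1 := half (vb d) (fun k ks => vb_irr (b k ks))
   (fun k l t ks ls ts => @vb_trans l k t (b k ks) (b l ls) (b t ts)) tot.
have h2 := half (fun k l => vb d l k) (fun k ks => vb_irr (b k ks))
   (fun k l t ks ls ts h1 h2 => @vb_trans l t k (b t ts) (b l ls) (b k ks) h2 h1)
   (fun k l ks ls ne => etrans (orbC _ _) (tot k l ks ls ne)).
apply: (@leq_trans (size [seq k <- s | size (lo k) <= w] + size [seq k <- s | size (hi k) <= w])).
  rewrite -size_cat; apply: uniq_leq_size => // k ks; rewrite mem_cat !mem_filter ks !andbT.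
  exact: lohi.
by rewrite mul2n -addnn; apply: leq_add.
Qed.

(** There are [w] tracks, and [tri_track] bounds the nodes on each of them. *)
Definition Om := w * (2 * w.+1).

Lemma tri_bound s : nonnest s -> (forall k l, k \in s -> l \in s -> ~~ tri d k l) -> size s <= Om.
Proof.
move=> ns nt; have [us b n] := ns.
case: s us b n ns nt => [|k0 s0] //; set s := k0 :: s0 => us b n ns nt.
have [i0 _] := T0 W (b k0 (mem_head _ _)).
pose f k := choice_of i0 (fun i => i \in T k).
have fP k : k \in s -> f k \in T k by move=> ks; apply: (choice_ofP i0 (T0 W (b k ks))).
apply: (@pigeon _ (fun k => nat_of_ord (f k))) => [k ks|i iw]; first by [].
apply: (@tri_track _ (Ordinal iw)).
- exact: nonnest_filter.
- move=> k; rewrite mem_filter => /andP[/eqP E ks]; have <- : f k = Ordinal iw by apply: val_inj.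
  exact: fP.
- by move=> k l; rewrite !mem_filter => /andP[_ ks] /andP[_ ls]; apply: nt.
Qed.

End World.

(** * Colouring the super roots of a family *)

Section Family.
Variables (d : data) (m w : nat) (D : pred nat) (T : nat -> {set 'I_w}) (px py : nat -> 'I_w -> nat).
Variable bn : nat -> nat.
Hypothesis W : world d m D T px py bn.
Local Notation r := (dr d).
Let rr := let: And3 h _ _ := HO W in h.
Let rt := let: And3 _ _ h := HO W in h.

Definition full k := forall i j, i \in T k -> j \in T k -> r (px k i) (py k j).

Lemma sr_T k F : k < m -> sr d k = F -> T k = T F /\ edges d T px py k = edges d T px py F.
Proof.
move=> km <-; have E : edges d T px py k = edges d T px py (sr d k).
  by apply: (e_edges W km (sr_anc W km)); rewrite (sr_e W km).
by split=> //; apply: (edges_T W) E => //; apply: (sr_m W).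
Qed.

Lemma full_edges k l : k < m -> l < m -> edges d T px py k = edges d T px py l -> full k -> full l.
Proof.
move=> km lm E f i j il jl; have TE := edges_T W km lm E.
have : (i, j) \in edges d T px py k by rewrite inE /= TE il jl /=; apply: f; rewrite TE.
by rewrite E inE => /and3P[].
Qed.

(** Edges of [h] compose: one in the lower heir leads from [X h] to the middle antichain, and one in
    the upper heir leads on to [Y h]. A transitive graph that is connected is complete. *)
Lemma full_heirs h a c : h < m -> a < m -> c < m -> 0 < a -> 0 < c -> par d a = h -> par d c = h ->
  ~~ up d a -> up d c -> ecount d a = ecount d h -> ecount d c = ecount d h -> full h.
Proof.
move=> hm am cm a0 c0 pa pc ua uc ea ec i j ih jh.
have Ea : edges d T px py a = edges d T px py h.
  by apply: (e_edges W am); rewrite -?pa ?(anc_par W) // pa.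
have Ec : edges d T px py c = edges d T px py h.
  by apply: (e_edges W cm); rewrite -?pc ?(anc_par W) // pc.
have Ta := edges_T W am hm Ea; have Tc := edges_T W cm hm Ec.
have tr x y z : (x, y) \in edges d T px py h -> (y, z) \in edges d T px py h -> (x, z) \in edges d T px py h.
  rewrite -{1}Ea -{1}Ec !inE /= => /and3P[xa ya r1] /and3P[yc zc r2].
  have xh : x \in T h by rewrite -Ta.
  have zh : z \in T h by rewrite -Tc.
  rewrite xh zh /=.
  have [_ H1 _] := lowH W am a0 ua; have [_ H2 _] := upH W cm c0 uc.
  rewrite -pa -(H1 x xa) pa -[X in py X z]pc -(H2 z zc).
  apply: (rt (Dx W am xa) (Dy W am ya) (Dy W cm zc) r1).
  apply: (rt (Dy W am ya) (Dx W cm yc) (Dy W cm zc) _ r2).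
  by apply: (crossH W) => //; rewrite pa.
apply/negPn/negP => nr.
pose S := [set t in T h | (i, t) \in edges d T px py h].
have [||||u [v [uS vh vS ruv]]] := @connH _ _ _ _ _ _ _ _ W h S i j hm.
- by apply/subsetP => t; rewrite inE => /andP[].
- by rewrite !inE /= ih (pxy W).
- exact: jh.
- by rewrite !inE /= ih jh (negbTE nr).
move: uS vS; rewrite inE => /andP[uh iu]; rewrite inE vh /= => /negP; apply.
by apply: (tr _ _ _ iu); rewrite inE /= uh vh.
Qed.

Variable F : nat.
(** The family of [F]: its members share their tracks and their comparability graph. *)
Definition inF k := k < m /\ sr d k = F.

Lemma inF_e k l : inF k -> inF l -> ecount d k = ecount d l.
Proof. by move=> [km sk] [lm sl]; rewrite -(sr_e W km) -(sr_e W lm) sk sl. Qed.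

Lemma inF_T k l : inF k -> inF l -> T k = T l.
Proof. by move=> [km sk] [lm sl]; rewrite (sr_T km sk).1 (sr_T lm sl).1. Qed.

Lemma inF_edges k l : inF k -> inF l -> edges d T px py k = edges d T px py l.
Proof. by move=> [km sk] [lm sl]; rewrite (sr_T km sk).2 (sr_T lm sl).2. Qed.

Lemma inF_full k l : inF k -> inF l -> full k -> full l.
Proof. by move=> Fk Fl; apply: full_edges (inF_edges Fk Fl); [case: Fk|case: Fl]. Qed.

Lemma inF_between a c k : inF a -> inF k -> a \in ancs d c -> c \in ancs d k -> inF c.
Proof.
move=> Fa Fk ac ck; have km := Fk.1; have cm := anc_m W km ck; split=> //.
have E := inF_e Fa Fk; have h1 := anc_e W cm ac; have h2 := anc_e W km ck.
by rewrite (sr_same W km ck) ?Fk.2 //; lia.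
Qed.

(* the node at which two nodes of the family separate has heirs on both sides *)
Lemma inF_vb k l : inF k -> inF l -> vb d k l -> exists g h, 
  [/\ inF g, inF h, g \in ancs d k & h \in ancs d l] /\
  [/\ 0 < g, 0 < h, par d g = par d h, ~~ up d g & up d h] /\ forall t, inF t -> full t.
Proof.
move=> Fk Fl V; have [km sk] := Fk; have [lm sl] := Fl.
have /(vbP W km lm)[g [h [gk hl' gm hm [g0 h0 E u1 u2]]]] := V.
have FF : F \in ancs d k by rewrite -sk; apply: (sr_anc W).
have FF' : F \in ancs d l by rewrite -sl; apply: (sr_anc W).
have Lk : par d g \in ancs d k by apply: (anc_trans W km (anc_par W gm)).
have FL : F \in ancs d (par d g).
  case: (anc_lin W km FF Lk) => // LF.
  case: (eqVneq (par d g) F) => [->|ne]; first exact: anc_refl.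
  have Fm := anc_m W km FF.
  have [g' [g'0 g'm pg' g'F]] := anc_child W Fm LF ne.
  have e1 : g' = g by apply: (sib_anc W km) => //; apply: (anc_trans W km g'F FF).
  have e2 : g' = h by apply: (sib_anc W lm) => //; [rewrite pg'|apply: (anc_trans W lm g'F FF')].
  by rewrite -e2 e1 (negbTE u1) in u2.
have FFF : inF F.
  by split; [apply: (anc_m W km FF)|rewrite -{1}sk (sr_idem W km)].
have FLg : inF (par d g) by apply: (inF_between FFF Fk FL).
have Fg : inF g by apply: (inF_between FLg Fk _ gk); apply: (anc_par W).
have Fh : inF h by apply: (inF_between FLg Fl _ hl'); rewrite E; apply: (anc_par W).
exists g, h; split=> //; split=> // t Ft; apply: (inF_full FLg Ft).
by apply: (full_heirs FLg.1 gm hm) => //; apply: inF_e.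
Qed.

(** Both separations give comparabilities along single tracks only; the complete graph of the middle
    node [l] connects any track to any other. *)
Lemma inF_sandwich k l n z v : inF k -> inF l -> inF n -> vb d k l -> vb d l n ->
  z < m -> v < m -> k \in ancs d z -> n \in ancs d v -> tri d z v.
Proof.
move=> Fk Fl Fn V1 V2 zm vm kz nv; have [g [h [_ [_ fl]]]] := inF_vb Fk Fl V1.
have [[km lm] nm] := (Fk.1, Fl.1, Fn.1).
apply: (triP W) => // [i j iz jv|]; last by apply: (vb_anc W zm vm kz nv); apply: (vb_trans W _ _ _ V1 V2).
have ik := anc_in W zm kz iz; have jn := anc_in W vm nv jv.
have il : i \in T l by rewrite (inF_T Fl Fk).
have jl : j \in T l by rewrite (inF_T Fl Fn).
apply: (rt (Dy W zm iz) (Dy W km ik) (Dx W vm jv) (anc_py W zm kz iz)).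
apply: (rt (Dy W km ik) (Dx W lm il) (Dx W vm jv) (vb_le W km lm V1 ik il)).
apply: (rt (Dx W lm il) (Dy W lm jl) (Dx W vm jv)); first by apply: fl.
apply: (rt (Dy W lm jl) (Dx W nm jn) (Dx W vm jv) (vb_le W lm nm V2 jl jn)).
exact: (anc_px W vm nv jv).
Qed.

(** The super roots at which edges are lost on leaving the family. *)
Definition elt x := [/\ 0 < x, x < m, sr d x = x & inF (par d x)].

Lemma elt_e x : elt x -> ecount d x < ecount d (par d x).
Proof. by case=> x0 xm sx _; apply: (sroot_lt W). Qed.

Lemma elt_nest x y : elt x -> elt y -> x \in ancs d y -> x = y.
Proof.
move=> ex ey xy; have [x0 xm _ Fx] := ex; have [y0 ym _ Fy] := ey.
case: (anc_step W ym xy) => // -[_ h].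
have := elt_e ex; have := anc_e W (parm W ym) h; rewrite (inF_e Fx Fy); lia.
Qed.

(** All children of a node are born at once, so a proper descendant of [par d x] has no child older
    than [x]. *)
Lemma older_anc x y : elt x -> elt y -> y < x -> par d x != par d y -> (par d x \in ancs d (par d y)) = false.
Proof.
move=> ex ey yx ne; apply/negP => h; have [x0 xm _ Fx] := ex; have [y0 ym _ Fy] := ey.
have [g [g0 gm pg ga]] := anc_child W (parm W ym) h ne.
have := bn_sib W gm xm g0 x0 pg; have := bn_mono W (parm W ym) (anc_le W (parm W ym) ga).
have := bn_par W ym y0; have := bn_mono W xm (ltnW yx); lia.
Qed.

Lemma sep_par x y : elt x -> elt y -> y < x -> par d x != par d y ->
  [\/ par d y \in ancs d (par d x), vb d (par d y) (par d x) | vb d (par d x) (par d y)].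
Proof.
move=> ex ey yx ne; have [x0 xm _ Fx] := ex; have [y0 ym _ Fy] := ey.
have [i ix] := T0 W (parm W xm); have iy : i \in T (par d y) by rewrite (inF_T Fy Fx).
case: (sep W (parm W xm) (parm W ym) ix iy) => H.
- by rewrite (older_anc ex ey yx ne) in H.
- by constructor 1.
- by constructor 3.
- by constructor 2.
Qed.

Definition uheir x u := [/\ 0 < u, u < m, par d u = par d x & up d u] /\ inF u.

Section Low.
Variable P : pred nat.
Hypothesis PE : forall x, P x -> elt x.
Hypothesis PU : forall x, P x -> exists u, uheir x u.
Hypothesis PD : forall x y, P x -> P y -> par d x = par d y -> x = y.

(** The upper heir occupies all tracks of the parent, so an upper sibling of it would be the heir
    itself; but [x] has lost an edge. *)
Lemma low_low x u : P x -> uheir x u -> ~~ up d x.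
Proof.
move=> Px [[u0 um pu uu] Fu]; apply/negP => ux; have ex := PE Px; have [x0 xm sx Fx] := ex.
have [i ix] := T0 W xm.
have iu : i \in T u by rewrite (inF_T Fu Fx); apply: (subsetP (par_T W xm)).
have E : u = x by apply: (sibH W um xm u0 x0 pu _ iu ix); rewrite uu ux.
have := elt_e ex; rewrite -{1}E (inF_e Fu Fx); lia.
Qed.

Lemma low_anc x y u : P x -> P y -> uheir y u -> par d y \in ancs d (par d x) -> par d y != par d x ->
  u \in ancs d (par d x).
Proof.
move=> Px Py Hu yx ne; have ex := PE Px; have ey := PE Py.
have [x0 xm sx Fx] := ex; have [y0 ym sy Fy] := ey; have [[u0 um pu uu] Fu] := Hu.
have [g [g0 gm pg gx]] := anc_child W (parm W xm) yx ne.
have Fg : inF g by apply: (inF_between Fy Fx _ gx); rewrite -pg; apply: (anc_par W).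
case ug : (up d g).
  have [i ig] := T0 W gm; have iu : i \in T u by rewrite (inF_T Fu Fg).
  by rewrite (@sibH _ _ _ _ _ _ _ _ W u g i) ?uu ?ug ?pu.
have ly := low_low Py Hu.
have [i iy] := T0 W ym; have ig : i \in T g by rewrite (inF_T Fg Fy); apply: (subsetP (par_T W ym)).
have E : g = y by apply: (sibH W gm ym g0 y0 pg _ ig iy); rewrite ug (negbTE ly).
have := elt_e ey; rewrite -{1}E (inF_e Fg Fy); lia.
Qed.

Lemma low_vb x y : P x -> P y -> par d y \in ancs d (par d x) -> par d y != par d x -> vb d y (par d x).
Proof.
move=> Px Py yx ne; have [u Hu] := PU Py; have ux := low_anc Px Py Hu yx ne.
have [x0 xm sx Fx] := PE Px; have [y0 ym sy Fy] := PE Py; have [[u0 um pu uu] Fu] := Hu.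
apply/(vbP W ym (parm W xm)); exists y, u; split=> //; first exact: anc_refl.
by split=> //; apply: (low_low Py Hu).
Qed.

(** From [z] one moves along a track to the upper heir, changes to any other track in its complete
    graph, and follows that track up to [c]. *)
Lemma low_tri z c v : P z -> inF c -> vb d (par d z) c -> v < m -> c \in ancs d v -> tri d z v.
Proof.
move=> Pz Fc V vm cv; have [z0 zm sz Fz] := PE Pz; have [u Hu] := PU Pz.
have [[u0 um pu uu] Fu] := Hu; have lz := low_low Pz Hu; have pm := parm W zm.
have [g [h [[Fg Fh gz hc] [[g0 h0 E u1 u2] fl]]]] := inF_vb Fz Fc V.
have [[gm hm] cm] := (Fg.1, Fh.1, Fc.1).
apply: (triP W) => // [i j iz jv|]; last by apply: (vb_anc W zm vm (anc_par W zm) cv).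
have ip := subsetP (par_T W zm) i iz; have jc := anc_in W vm cv jv.
have iu : i \in T u by rewrite (inF_T Fu Fz).
have ju : j \in T u by rewrite (inF_T Fu Fc).
have jp : j \in T (par d z) by rewrite (inF_T Fz Fc).
have jg : j \in T g by rewrite (inF_T Fg Fc).
have jh : j \in T h by rewrite (inF_T Fh Fc).
apply: (rt (Dy W zm iz) (Dx W um iu) (Dx W vm jv)); first by apply: (crossH W).
apply: (rt (Dx W um iu) (Dy W um ju) (Dx W vm jv)); first by apply: fl.
have [_ H _] := upH W um u0 uu; rewrite (H j ju) pu.
apply: (rt (Dy W pm jp) (Dy W gm jg) (Dx W vm jv) (anc_py W pm gz jp)).
apply: (rt (Dy W gm jg) (Dx W hm jh) (Dx W vm jv)); first by apply: (crossH W).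
apply: (rt (Dx W hm jh) (Dx W cm jc) (Dx W vm jv) (anc_px W cm hc jc)).
exact: (anc_px W vm cv jv).
Qed.

Lemma older_tri x t : P x -> P t -> t < x -> tri d x t -> vb d (par d x) (par d t).
Proof.
move=> Px Pt tx /andP[V _]; have [x0 xm sx Fx] := PE Px; have [t0 tm st Ft] := PE Pt.
have ne : par d x != par d t by apply: contraTneq tx => /(PD Px Pt) ->; rewrite ltnn.
case: (sep_par (PE Px) (PE Pt) tx ne) => // H.
  have V' : vb d t x.
    apply: (vb_anc W tm xm (anc_refl d t) (anc_par W xm)).
    by apply: low_vb; rewrite // eq_sym.
  by have := vb_trans W xm tm xm V V'; rewrite (vb_irr W).
have V' : vb d t x by apply: (vb_anc W tm xm (anc_par W tm) (anc_par W xm) H).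
by have := vb_trans W xm tm xm V V'; rewrite (vb_irr W).
Qed.

(** Separated parents make the elements completely comparable ([low_tri]). So by [sep_par], if [x]
    and an older [y] are incomparable, then [par d y] is an ancestor of [par d x], and separation
    from a third parent passes from [y] to [x]. *)
Lemma low_cut : Qcut m P (lrel d).
Proof.
split=> [x u l xm' ux lx Px Pu Pl /orP[/eqP E|xu]|x y xm' yx Px Py].
- by rewrite E ltnn in ux.
- rewrite negb_or => /andP[_ nxl].
  have [x0 xm sx Fx] := PE Px; have [u0 um su Fu] := PE Pu; have [l0 lm sl Fl] := PE Pl.
  have Vxu := older_tri Px Pu ux xu.
  have nlx : par d x != par d l by apply: contraTneq lx => /(PD Px Pl) ->; rewrite ltnn.
  case: (eqVneq l u) => [->|nlu]; first by rewrite /lrel eqxx.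
  rewrite /lrel (negbTE nlu) /=.
  case: (sep_par (PE Px) (PE Pl) lx nlx) => H; last first.
  + by rewrite (low_tri Px Fl H lm (anc_par W lm)) in nxl.
  + apply: (low_tri Pl Fu _ um (anc_par W um)).
    exact: (vb_trans W (parm W lm) (parm W xm) (parm W um) H Vxu).
  have nlu' : par d l != par d u by apply: contraNneq nlu => /(PD Pl Pu) ->.
  have [i il] := T0 W (parm W lm); have iu : i \in T (par d u) by rewrite (inF_T Fu Fl).
  case: (sep W (parm W lm) (parm W um) il iu) => H'; last 1 first.
  + have V' : vb d (par d u) (par d x) by apply: (vb_anc W (parm W um) (parm W xm) (anc_refl d _) H H').
    by have := vb_trans W (parm W xm) (parm W um) (parm W xm) Vxu V'; rewrite (vb_irr W) // (parm W).
  (* Both parents lie under the upper heir [v] of [par d l], hence so does their branching. From [l]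
     one reaches [v] along a track, and the complete graph of [g] leads to all tracks of [u]. *)
  + have [v Hv] := PU Pl; rewrite eq_sym in nlx.
    have vx := low_anc Px Pl Hv H nlx; have vu := low_anc Pu Pl Hv H' nlu'.
    have [[v0 vm pv uv] Fv] := Hv; have lz := low_low Pl Hv.
    have [g [h [[Fg Fh gx hu'] [[g0 h0 E u1 u2] fl]]]] := inF_vb Fx Fu Vxu.
    have [[gm hm] pu] := (Fg.1, Fh.1, parm W um).
    have vg : v \in ancs d g.
      case: (anc_lin W (parm W xm) vx gx) => // gv.
      have gu := anc_trans W pu gv vu.
      by rewrite (sib_anc W pu g0 h0 E gu hu') u2 in u1.
    apply: (triP W) => // [a j al ju|].
      have ap := subsetP (par_T W lm) a al; have jp := subsetP (par_T W um) j ju.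
      have av : a \in T v by rewrite (inF_T Fv Fl).
      have ag : a \in T g by rewrite (inF_T Fg Fl).
      have jg : j \in T g by rewrite (inF_T Fg Fu).
      have jh : j \in T h by rewrite (inF_T Fh Fu).
      apply: (rt (Dy W lm al) (Dx W vm av) (Dx W um ju)); first by apply: (crossH W).
      apply: (rt (Dx W vm av) (Dx W gm ag) (Dx W um ju) (anc_px W gm vg ag)).
      apply: (rt (Dx W gm ag) (Dy W gm jg) (Dx W um ju)); first by apply: fl.
      apply: (rt (Dy W gm jg) (Dx W hm jh) (Dx W um ju)); first by apply: (crossH W).
      apply: (rt (Dx W hm jh) (Dx W pu jp) (Dx W um ju) (anc_px W pu hu' jp)).
      exact: (par_px W um ju).
    apply: (vb_anc W lm um (anc_refl d _) (anc_par W um)).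
    by apply: low_vb.
  + have := anc_trans W (parm W xm) H' H.
    by rewrite (vb_nanc W (parm W xm) (parm W um) Vxu).2.
  + exact: (low_tri Pl Fu H' um (anc_par W um)).
rewrite negb_or => /andP[_ nxy].
have [x0 xm sx Fx] := PE Px; have [y0 ym sy Fy] := PE Py.
have ne : par d x != par d y by apply: contraTneq yx => /(PD Px Py) ->; rewrite ltnn.
case: (sep_par (PE Px) (PE Py) yx ne) => H.
- right=> t ty Pt /orP[/eqP E|yt]; first by rewrite E ltnn in ty.
  have [t0 tm st Ft] := PE Pt; have V := older_tri Py Pt ty yt.
  have V' : vb d (par d x) (par d t) by apply: (vb_anc W (parm W xm) (parm W tm) H (anc_refl d _) V).
  by rewrite /lrel (low_tri Px Ft V' tm (anc_par W tm)) orbT.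
- by left; rewrite /lrel (low_tri Py Fx H xm (anc_par W xm)) orbT.
- by rewrite (low_tri Px Fy H ym (anc_par W ym)) in nxy.
Qed.
End Low.

Section OneShot.
Variable P : pred nat.
Hypothesis PE : forall x, P x -> elt x.
Hypothesis PN : forall x g, P x -> 0 < g -> g < m -> par d g = par d x -> ~ inF g.
Hypothesis PD : forall x y, P x -> P y -> par d x = par d y -> x = y.

(** Without heirs no family member lies properly under [par d x], so distinct parents are not
    nested. *)
Lemma shot_sep x y : P x -> P y -> x != y -> vb d (par d x) (par d y) \/ vb d (par d y) (par d x).
Proof.
move=> Px Py ne; have [x0 xm sx Fx] := PE Px; have [y0 ym sy Fy] := PE Py.
have ne' : par d x != par d y by apply: contraNneq ne => /(PD Px Py) ->.
have aux a c : P a -> P c -> par d a \in ancs d (par d c) -> par d a != par d c -> False.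
  move=> Pa Pc h ne1; have [a0 am sa Fa] := PE Pa; have [c0 cm sc Fc] := PE Pc.
  have [g [g0 gm pg gc]] := anc_child W (parm W cm) h ne1.
  apply: (PN Pa g0 gm pg); apply: (inF_between Fa Fc _ gc); rewrite -pg; exact: (anc_par W).
have [i ix] := T0 W (parm W xm); have iy : i \in T (par d y) by rewrite (inF_T Fy Fx).
case: (sep W (parm W xm) (parm W ym) ix iy) => H.
- by case: (aux x y).
- by case: (aux y x); rewrite // eq_sym.
- by left.
- by right.
Qed.

(** The parents are linearly ordered by [vb]. Of two on the same side of [x], the farther one gives
    an element comparable to [x] by [inF_sandwich]; so at most one incomparable element is left on
    each side. *)
Lemma shot_deg : Qdeg m P (lrel d).
Proof.
move=> x s xm' Px us H.
have [x0 xm sx Fx] := PE Px.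
have sP y : y \in s -> [/\ P y, x != y, ~~ tri d x y & ~~ tri d y x].
  move=> /H /and4P[yx Py]; rewrite !negb_or => /andP[h1 h2] /andP[_ h3]; split=> //.
have one (s' : seq nat) : uniq s' -> {subset s' <= s} ->
    (forall y z, y \in s' -> z \in s' -> vb d (par d y) (par d z) -> False) -> size s' <= 1.
  case: s' => [|y [|z s']] // /andP[]; rewrite inE negb_or => /andP[ne _] _ sub no.
  have yi : y \in [:: y, z & s'] by rewrite inE eqxx.
  have zi : z \in [:: y, z & s'] by rewrite !inE eqxx orbT.
  have [Py _ _ _] := sP y (sub _ yi); have [Pz _ _ _] := sP z (sub _ zi).
  by case: (shot_sep Py Pz ne) => V; [case: (no y z)|case: (no z y)].
rewrite -(count_predC (fun y => vb d (par d y) (par d x)) s) -!size_filter.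
apply: (@leq_add _ _ 1 1); apply: one; rewrite ?filter_uniq //.
- by move=> y; rewrite mem_filter => /andP[].
- move=> y z; rewrite !mem_filter => /andP[V1 /sP[Py _ _ h]] /andP[V2 /sP[Pz _ _ _]] V.
  have [y0 ym sy Fy] := PE Py; have [z0 zm sz Fz] := PE Pz.
  by rewrite (inF_sandwich Fy Fz Fx V V2 ym xm (anc_par W ym) (anc_par W xm)) in h.
- by move=> y; rewrite mem_filter => /andP[].
move=> y z; rewrite !mem_filter /= => /andP[V1 /sP[Py n1 _ _]] /andP[V2 /sP[Pz n2 h _]] V.
have [y0 ym sy Fy] := PE Py; have [z0 zm sz Fz] := PE Pz.
case: (shot_sep Px Py n1) => V1'; last by rewrite V1' in V1.
by rewrite (inF_sandwich Fx Fy Fz V1' V xm zm (anc_par W xm) (anc_par W zm)) in h.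
Qed.
End OneShot.
End Family.

(** * Order duality for trees *)

Definition fdata (d : data) : data :=
  Data (par d) (fun k => ~~ up d k) (hu d) (hl d) (Y d) (X d) (fun x y => dr d y x).

Lemma double_count (r : rel nat) (s t : seq nat) :
  sumn [seq count (r x) t | x <- s] = sumn [seq count (r^~ y) s | y <- t].
Proof.
rewrite !sumnE !big_map; under eq_bigr => x _ do rewrite -sum1_count.
under [RHS]eq_bigr => x _ do rewrite -sum1_count.
under eq_bigr => x _ do rewrite big_mkcond.
by rewrite exchange_big; apply: eq_bigr => y _; rewrite -big_mkcond.
Qed.

Lemma ecount_fd d k : ecount (fdata d) k = ecount d k.
Proof. by rewrite /ecount double_count. Qed.

Lemma sr_fd d k : sr (fdata d) k = sr d k.
Proof. by rewrite /sr; congr last; apply: eq_filter => a; rewrite !ecount_fd. Qed.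

Lemma vb_fd d k l : vb (fdata d) k l = vb d l k.
Proof.
rewrite /vb; apply/hasP/hasP => -[g gk /hasP[h hl' /and5P[g0 h0 E u1 u2]]]; exists h => //;
  by apply/hasP; exists g => //; rewrite g0 h0 eq_sym E //=; move: u1 u2; rewrite /= ?negbK => -> ->.
Qed.

Lemma tri_fd d k l : tri (fdata d) k l = tri d l k.
Proof.
rewrite /tri vb_fd; congr (_ && _); apply/allP/allP => H y yY; apply/allP => x xX.
  exact: (allP (H x xX)).
exact: (allP (H x xX)).
Qed.

Lemma lrel_fd d k l : lrel (fdata d) k l = lrel d l k.
Proof. by rewrite /lrel tri_fd eq_sym. Qed.

Lemma world_fd d m w D (T : nat -> {set 'I_w}) px py bn : world d m D T px py bn -> world (fdata d) m D T py px bn.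
Proof.
move=> W; split; try by case: W.
- exact: ord_flip (HO W).
- by move=> k km kp u; move: u; rewrite negbK => u; have := upH W km kp u.
- move=> k l i km lm kp lp E u; apply: (sibH W) => //.
  by move: u; rewrite /=; case: (up d k); case: (up d l).
- move=> k l i km lm kp lp E u1 u2 ik il; apply: (crossH W) => //.
  by move: u1; rewrite /= negbK.
- move=> k S i0 j0 km sub iS jT jS.
  have [||||i [j [iS' jT' jS' rij]]] := @connH _ _ _ _ _ _ _ _ W k (T k :\: S) j0 i0 km.
  + exact: subsetDl.
  + by rewrite inE jS jT.
  + exact: (subsetP sub).
  + by rewrite inE iS.
  move: iS' jS'; rewrite !inE jT' andbT negbK => /andP[h1 h2] h3.
  by exists j, i.
- move=> k km; rewrite ecount_fd (eH W km).
  rewrite -(@on_card_preimset _ _ (fun p => (p.2, p.1)) (edges (fdata d) T py px k)).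
    by apply: eq_card => -[i j]; rewrite !inE /= andbCA.
  by apply: onW_bij; exists (fun p => (p.2, p.1)) => -[].
- by move=> k km kp; rewrite (huH W km kp); split=> -[g [h1 h2 h3 h4 h5]]; exists g; split=> //;
    rewrite ?ecount_fd //=; move: h4 h5; rewrite /= ?negbK ?ecount_fd.
- by move=> k km kp; rewrite (hlH W km kp); split=> -[g [h1 h2 h3 h4 h5]]; exists g; split=> //;
    rewrite ?ecount_fd //=; move: h4 h5; rewrite /= ?ecount_fd.
Qed.

Lemma Qcut_bl n P r : Qcut n (bl n P) r -> Qcut n P r.
Proof.
have B z : z < n -> P z -> bl n P z by rewrite /bl => -> ->.
case=> H1 H2; split=> [x u l xn ux lx Px Pu Pl|x y xn yx Px Py nxy].
  by apply: (H1 x u l xn ux lx); apply: B => //; lia.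
have yn := ltn_trans yx xn.
case: (H2 x y xn yx (B _ xn Px) (B _ yn Py) nxy) => H; [by left|right] => u uy Pu.
by apply: H => //; apply: B => //; lia.
Qed.

Lemma Qdeg_bl n P r : Qdeg n (bl n P) r -> Qdeg n P r.
Proof.
move=> H x s xn Px us sP; apply: (H x s xn) => //; first by rewrite /bl xn.
by move=> y /sP/and4P[yx Py h1 h2]; rewrite yx /bl Py (ltn_trans yx) //= h1 h2.
Qed.

Section LocProper.
Variables (d : data) (m w : nat) (D : pred nat) (T : nat -> {set 'I_w}) (px py : nat -> 'I_w -> nat).
Variable bn : nat -> nat.
Hypothesis W : world d m D T px py bn.
Variables cup cdeg : colouring.
Local Notation Omw := (Om w).
Hypothesis Cup : forall n P r, ord (bl n P) r -> wid (bl n P) r Omw -> Qcut n P r ->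
  cproper n P r (Omw * Omw) (cup r P).
Hypothesis Cdeg : forall n P r, ord (bl n P) r -> wid (bl n P) r Omw -> Qdeg n P r -> cproper n P r 3 (cdeg r P).

Lemma lrel_ord (P : pred nat) : ord (bl m P) (lrel d).
Proof.
split=> [x _|x y /andP[xm _] /andP[ym _]|y x z /andP[xm _] /andP[ym _] /andP[zm _]].
- by rewrite /lrel eqxx.
- case/orP=> [/eqP//|/andP[h1 _]] /orP[/eqP//|/andP[h2 _]].
  by have := vb_trans W xm ym xm h1 h2; rewrite (vb_irr W).
- case/orP=> [/eqP->//|h1] /orP[/eqP<-|h2]; first by rewrite /lrel h1 orbT.
  by rewrite /lrel (tri_trans W xm ym zm h1 h2) orbT.
Qed.

Lemma sidx_lt x y : 0 < x -> x < y -> par d x = par d y -> sidx d x < sidx d y.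
Proof.
move=> x0 xy E; rewrite /sidx E.
have -> : iota 0 y = iota 0 x ++ iota x (y - x) by rewrite -{1}(subnKC (ltnW xy)) iotaD.
rewrite count_cat -{1}[count _ _]addn0 ltn_add2l.
rewrite -has_count; apply/hasP; exists x; last by rewrite x0 E eqxx.
by rewrite mem_iota; lia.
Qed.

(** Siblings on the same side occupy disjoint tracks, which gives at most [w] per side. *)
Lemma sidx_bound k : k < m -> sidx d k <= 2 * w.
Proof.
move=> km; rewrite /sidx -size_filter; move Es : (filter _ _) => s.
have sP i : i \in s -> [/\ 0 < i, i < m & par d i = par d k].
  by rewrite -Es mem_filter mem_iota => /andP[/andP[i0 /eqP E] ik]; split=> //; lia.
have us : uniq s by rewrite -Es; apply: filter_uniq; apply: iota_uniq.
have side u : size [seq i <- s | up d i == u] <= w.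
  apply: (@track_bound _ [seq i <- s | up d i == u] (fun i t => t \in T i)).
  - exact: filter_uniq.
  - by move=> i; rewrite mem_filter => /andP[_ /sP[_ im _]]; apply: (T0 W).
  move=> i j t; rewrite mem_filter => /andP[/eqP ui /sP[i0 im pi]].
  rewrite mem_filter => /andP[/eqP uj /sP[j0 jm pj]].
  by apply: (sibH W) => //; rewrite ?pi ?ui.
rewrite -(count_predC (fun i => up d i == true) s) mul2n -addnn -!size_filter; apply: leq_add => //.
by rewrite (@eq_filter _ _ (fun i => up d i == false)) // => i /=; case: (up d i).
Qed.

Lemma kind_lt k : kind d k < 3.
Proof. by rewrite /kind; case: ifP => // _; case: ifP. Qed.

Lemma elt_lpres k x : bl m (lpres d k) x -> elt d m (spar d k) x.
Proof. by case/andP=> xm /and5P[x0 /eqP sx _ /eqP px' _]; split=> //; split=> //; apply: (parm W). Qed.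

Lemma lpres_inj k x y : bl m (lpres d k) x -> bl m (lpres d k) y -> par d x = par d y -> x = y.
Proof.
move=> /andP[xm /and5P[x0 _ _ _ /eqP sx]] /andP[ym /and5P[y0 _ _ _ /eqP sy]] E.
have [xy|yx|//] := ltngtP x y; first by have := sidx_lt x0 xy E; rewrite sx sy ltnn.
by have := sidx_lt y0 yx (esym E); rewrite sx sy ltnn.
Qed.

Lemma child_inF F x g : inF d m F (par d x) -> g < m -> par d g = par d x -> ecount d g = ecount d (par d x) ->
  inF d m F g.
Proof.
move=> [pm sp] gm pg E; split=> //; rewrite -sp -pg; symmetry; apply: (sr_same W gm).
  exact: (anc_par W).
by rewrite pg E.
Qed.

Lemma lpres_wid k : wid (bl m (lpres d k)) (lrel d) Omw.
Proof.
move=> s [us A] sP; apply: (tri_bound W).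
  split=> // [x /sP/andP[]//|x y xs ys xy].
  by apply: (elt_nest W (elt_lpres (sP x xs)) (elt_lpres (sP y ys)) xy).
move=> x y xs ys; apply/negP => t.
have E : x = y by apply: A => //; rewrite /lrel t orbT.
by move: t; rewrite E /tri (vb_irr W) //; case/andP: (sP y ys).
Qed.

Lemma lcut0 k : hu d k -> Qcut m (lpres d k) (lrel d).
Proof.
move=> huk; apply: Qcut_bl; apply: (low_cut W (F := spar d k)).
- exact: elt_lpres.
- move=> x Px; have [x0 xm sx Fx] := elt_lpres Px.
  have hx : hu d x.
    by case/andP: Px => _ /and5P[_ _ + _ _]; rewrite /kind huk; case: (hu d x) => //; case: (hl d x).
  have [g [gm g0 pg ug eg]] := (huH W xm x0).1 hx.
  by exists g; split; [|apply: (child_inF Fx gm pg eg)].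
- exact: lpres_inj.
Qed.

(** [low_cut] in the dual tree, where lower heirs become upper ones. *)
Lemma lcut1 k : hu d k = false -> hl d k -> Qcut m (lpres d k) (fun x y => lrel d y x).
Proof.
move=> huk hlk; apply: Qcut_bl.
suff : Qcut m (bl m (lpres d k)) (lrel (fdata d)).
  rewrite /Qcut => -[H1 H2]; split=> [x u l xm ux lx Px Pu Pl|x y xm yx Px Py].
    by have := H1 x u l xm ux lx Px Pu Pl; rewrite !lrel_fd.
  have := H2 x y xm yx Px Py; rewrite !lrel_fd => H /H[->|h]; [by left|right] => u uy Pu.
  by have := h u uy Pu; rewrite !lrel_fd.
have W' := world_fd W.
have Fd F x : inF d m F x -> inF (fdata d) m F x by case=> xm sx; split=> //; rewrite sr_fd.
apply: (low_cut W' (F := spar d k)).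
- move=> x /elt_lpres[x0 xm sx Fx]; split=> //; first by rewrite sr_fd.
  exact: Fd.
- move=> x Px; have [x0 xm sx Fx] := elt_lpres Px.
  have hx : hl d x.
    by case/andP: Px => _ /and5P[_ _ + _ _]; rewrite /kind huk hlk; case: (hu d x) => //; case: (hl d x).
  have [g [gm g0 pg ug eg]] := (hlH W xm x0).1 hx.
  by exists g; split; [split|apply: Fd; apply: (child_inF Fx gm pg eg)].
- exact: lpres_inj.
Qed.

Lemma ldeg k : hu d k = false -> hl d k = false -> Qdeg m (lpres d k) (lrel d).
Proof.
move=> huk hlk; apply: Qdeg_bl; apply: (shot_deg W (F := spar d k)).
- exact: elt_lpres.
- move=> x g Px g0 gm pg Fg; have [x0 xm sx Fx] := elt_lpres Px.
  have E := inF_e W Fg Fx.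
  case/andP: Px => _ /and5P[_ _ + _ _]; rewrite /kind huk hlk.
  case ug : (up d g).
    have -> // : hu d x by apply/(huH W xm x0); exists g.
  case: (hu d x) => //; have -> // : hl d x by apply/(hlH W xm x0); exists g; rewrite ug.
- exact: lpres_inj.
Qed.

Lemma wid_flip' (P : pred nat) r n : wid P r n -> wid P (fun x y => r y x) n.
Proof. by move=> H s /anti_flip A; apply: H. Qed.

Lemma lraw_bound k : k < m -> 0 < k -> sr d k = k -> lraw cup cdeg d k < Omw * Omw + 3.
Proof.
move=> km k0 sk; have pk : lpres d k k by rewrite /lpres k0 sk !eqxx.
have O := lrel_ord (lpres d k); have Wd := lpres_wid (k := k).
rewrite /lraw /kind; case hk : (hu d k) => /=.
  by have [b _] := Cup O Wd (lcut0 hk); apply: leq_trans (b k km pk) _; lia.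
case h1 : (hl d k) => /=.
  have [b _] := Cup (ord_flip O) (wid_flip' Wd) (lcut1 hk h1).
  by apply: leq_trans (b k km pk) _; lia.
by have [b _] := Cdeg O Wd (ldeg hk h1); apply: leq_trans (b k km pk) _; lia.
Qed.

Lemma loc_proper k l : k < m -> l < m -> 0 < k -> 0 < l -> sr d k = k -> sr d l = l ->
  spar d k = spar d l -> loc cup cdeg d k = loc cup cdeg d l -> k != l -> tri d k l || tri d l k.
Proof.
move=> km lm k0 l0 sk sl sp [ek es er] ne.
have pk : lpres d k k by rewrite /lpres k0 sk !eqxx.
have pl : lpres d k l by rewrite /lpres l0 sl ek sp es !eqxx.
have pE : lpres d l = lpres d k by rewrite /lpres ek sp es.
have O := lrel_ord (lpres d k); have Wd := lpres_wid (k := k).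
have fin : lrel d k l || lrel d l k -> tri d k l || tri d l k.
  by rewrite /lrel (negbTE ne) eq_sym (negbTE ne).
apply: fin; move: er; rewrite /lraw -ek pE /kind; case hk : (hu d k) => /=.
  by have [_ p] := Cup O Wd (lcut0 hk); apply: p.
case h1 : (hl d k) => /=.
  have [_ p] := Cup (ord_flip O) (wid_flip' Wd) (lcut1 hk h1).
  by move=> E; rewrite orbC; apply: p.
by have [_ p] := Cdeg O Wd (ldeg hk h1); apply: p.
Qed.

End LocProper.

(** * Colouring big nodes *)

Lemma filter_sub_eq (T : eqType) (p q : pred T) s : (forall x, x \in s -> p x -> q x) ->
  size (filter p s) = size (filter q s) -> filter p s = filter q s.
Proof.
rewrite !size_filter; elim: s => //= a s IH H.
have H' x : x \in s -> p x -> q x by move=> xs; apply: H; rewrite in_cons xs orbT.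
have le := count_subin H'; have := H a (mem_head _ _).
case: (p a); case: (q a) => // h; rewrite /= ?add0n ?add1n.
- by case=> /(IH H') ->.
- by have := h isT.
- by move=> E; rewrite E ltnn in le.
- exact: IH.
Qed.

Lemma count_uniq1 (T : eqType) (p : pred T) s : uniq s ->
  (forall x y, x \in s -> y \in s -> p x -> p y -> x = y) -> count p s <= 1.
Proof.
move=> us H; rewrite -size_filter; have := filter_uniq p us; move Es : (filter p s) => t.
have tP x : x \in t -> p x && (x \in s) by rewrite -Es mem_filter.
case: t Es tP => [|x [|y t]] // _ tP /=; rewrite inE negb_or => /andP[/andP[ne _] _].
have /andP[px xs] := tP x (mem_head _ _).
have /andP[py ys] : p y && (y \in s) by apply: tP; rewrite !inE eqxx orbT.
by rewrite (H x y) ?eqxx in ne.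
Qed.

Section ColProper.
Variables (d : data) (m w : nat) (D : pred nat) (T : nat -> {set 'I_w}) (px py : nat -> 'I_w -> nat).
Variable bn : nat -> nat.
Hypothesis W : world d m D T px py bn.
Variables (b q k1 : nat) (cq cup cdeg : colouring).
Local Notation r := (dr d).
Let rr := let: And3 h _ _ := HO W in h.
Let rt := let: And3 _ _ h := HO W in h.
Hypothesis Cup : forall n P r, ord (bl n P) r -> wid (bl n P) r (Om w) -> Qcut n P r ->
  cproper n P r (Om w * Om w) (cup r P).
Hypothesis Cdeg : forall n P r, ord (bl n P) r -> wid (bl n P) r (Om w) -> Qdeg n P r -> cproper n P r 3 (cdeg r P).
Hypothesis Cq : forall n P r, ord (bl n P) r -> wid (bl n P) r q -> cproper n P r k1 (cq r P).
Hypothesis b0 : 0 < b.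
Hypothesis bq : w <= b * q.

Lemma sizeT k : #|T k| <= w.
Proof. by rewrite -[X in _ <= X]card_ord max_card. Qed.

Lemma gl_skip k : k < m -> gl d k = gl d (sr d k).
Proof.
move=> km; move: k km; apply: (anc_ind W) => [|l lm lp IH]; first by rewrite (sr0 d).
case: (eqVneq (sr d l) l) => [->//|ne].
have -> : gl d l = gl d (par d l) by rewrite /gl (ancsE W lm lp) /= (negbTE ne).
by rewrite IH; move: ne; rewrite (srE W lm lp); case: ifP => //; rewrite eqxx.
Qed.

Lemma glE k : k < m -> 0 < k -> sr d k = k -> gl d k = k :: gl d (spar d k).
Proof.
move=> km kp sk; rewrite /gl (ancsE W km kp) /= sk eqxx; congr (_ :: _).
exact: (gl_skip (parm W km)).
Qed.

Lemma gl0 : gl d 0 = [:: 0].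
Proof. by rewrite /gl ancs0 /= (sr0 d). Qed.

Lemma spar_lt k : k < m -> 0 < k -> spar d k < k.
Proof.
move=> km kp; rewrite /spar; have := anc_le W (parm W km) (sr_anc W (parm W km)).
by have := par_lt W km kp; lia.
Qed.

Lemma spar_sr k : k < m -> sr d (spar d k) = spar d k.
Proof. by move=> km; apply: (sr_idem W (parm W km)). Qed.

Lemma spar_anc k : k < m -> spar d k \in ancs d k.
Proof. by move=> km; apply: (anc_trans W km (sr_anc W (parm W km)) (anc_par W km)). Qed.

(* a super root together with the place where the search for a thick ancestor stops *)
Definition found k G F := [/\ G < m, sr d G = G, 0 < G, G \in ancs d k & F = spar d G] /\
  [/\ thick d k F & G != k -> ~~ thick d k G].
Definition notfound k := [/\ Gof d k = 0, base d k = 0 & k != 0 -> ~~ thick d k 0].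

Lemma search_spec k : k < m -> sr d k = k ->
  if hasbase d k then found k (Gof d k) (base d k) else notfound k.
Proof.
move=> km sk; rewrite /hasbase /Gof /base /gidx /notfound /Gof /base /gidx.
have gen g : g < m -> sr d g = g -> g \in ancs d k -> (g != k -> ~~ thick d k g) ->
  if has (thick d k) (behead (gl d g))
  then found k (nth 0 (gl d g) (find (thick d k) (behead (gl d g))))
               (nth 0 (behead (gl d g)) (find (thick d k) (behead (gl d g))))
  else [/\ nth 0 (gl d g) (find (thick d k) (behead (gl d g))) = 0,
           nth 0 (behead (gl d g)) (find (thick d k) (behead (gl d g))) = 0 & k != 0 -> ~~ thick d k 0].
  have [n] := ubnP g; elim: n g => // n IH g gn gm sg gk ng.
  case: (posnP g) => [g0|gp].
    by rewrite g0 gl0 /=; split=> // k0; rewrite -g0; apply: ng; rewrite g0 eq_sym.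
  have sm : spar d g < m by apply: leq_trans (spar_lt gm gp) (ltnW gm).
  have E := glE gm gp sg; rewrite E /=.
  have hd : gl d (spar d g) = spar d g :: behead (gl d (spar d g)).
    case: (posnP (spar d g)) => [->|sp]; first by rewrite gl0.
    by rewrite (glE sm sp (spar_sr gm)).
  rewrite hd /=; case t : (thick d k (spar d g)) => /=.
    by split; split.
  rewrite -hd; apply: IH => //.
  - by have := spar_lt gm gp; lia.
  - exact: spar_sr.
  - by apply: (anc_trans W km (spar_anc gm) gk).
  - by rewrite t.
by apply: gen => //; [apply: (anc_refl d k)|rewrite eqxx].
Qed.

Lemma base_m k : k < m -> sr d k = k -> base d k < m /\ sr d (base d k) = base d k.
Proof.
move=> km sk; have := search_spec km sk; case: ifP => _.
  case=> -[Gm _ Gp _ ->] _; split; last exact: spar_sr.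
  by apply: leq_trans (spar_lt Gm Gp) (ltnW Gm).
by case=> _ -> _; rewrite (m0 W) (sr0 d).
Qed.

Lemma base_anc k : k < m -> sr d k = k -> base d k \in ancs d k.
Proof.
move=> km sk; have := search_spec km sk; case: ifP => _.
  by case=> -[Gm _ _ Gk ->] _; apply: (anc_trans W km (spar_anc Gm) Gk).
by case=> _ -> _; apply: (anc_zero W).
Qed.

Lemma U_track k i : k < m -> sr d k = k -> i \in T k -> px (base d k) i \in Uof d k.
Proof.
move=> km sk ik; have [bm sb] := base_m km sk; have ba := base_anc km sk.
rewrite mem_filter; apply/andP; split; last by apply/(XP W) => //; exists i => //; apply: (anc_in W km ba).
apply/hasP; exists (px k i); last exact: (anc_px W km ba).
by apply/(XP W) => //; exists i.
Qed.

Lemma V_track k i : k < m -> sr d k = k -> i \in T k -> py (base d k) i \in Vof d k.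
Proof.
move=> km sk ik; have [bm sb] := base_m km sk; have ba := base_anc km sk.
rewrite mem_filter; apply/andP; split; last by apply/(YP W) => //; exists i => //; apply: (anc_in W km ba).
apply/hasP; exists (py k i); last exact: (anc_py W km ba).
by apply/(YP W) => //; exists i.
Qed.

Lemma U_le k x i : k < m -> sr d k = k -> hasbase d k -> x \in Uof d k -> i \in T k -> r x (px k i) /\ D x.
Proof.
move=> km sk hb; have := search_spec km sk; rewrite hb => -[_ [/andP[/allP th _] _]].
have [bm sb] := base_m km sk.
rewrite mem_filter => /andP[hx xF] ik; split.
  have := th x xF; rewrite hx /= => /allP; apply.
  by apply/(XP W) => //; exists i.
by have [j jF ->] := (XP W x bm).1 xF; apply: (Dx W).
Qed.

Lemma V_ge k y i : k < m -> sr d k = k -> hasbase d k -> y \in Vof d k -> i \in T k -> r (py k i) y /\ D y.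
Proof.
move=> km sk hb; have := search_spec km sk; rewrite hb => -[_ [/andP[_ /allP th] _]].
have [bm sb] := base_m km sk.
rewrite mem_filter => /andP[hx xF] ik; split.
  have := th y xF; rewrite hx /= => /allP; apply.
  by apply/(YP W) => //; exists i.
by have [j jF ->] := (YP W y bm).1 xF; apply: (Dy W).
Qed.

Lemma lnk_tri k l x y : k < m -> l < m -> sr d k = k -> sr d l = l -> hasbase d k -> hasbase d l ->
  vb d (base d k) (base d l) -> y \in Vof d k -> x \in Uof d l -> r y x -> tri d k l.
Proof.
move=> km lm sk sl hk hl' V yV xU ryx; apply: (triP W) => // [i j ik jl|].
  have [r1 Dy'] := V_ge km sk hk yV ik; have [r2 Dx'] := U_le lm sl hl' xU jl.
  apply: (rt (Dy W km ik) Dy' (Dx W lm jl) r1).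
  exact: (rt Dy' Dx' (Dx W lm jl) ryx r2).
by apply: (vb_anc W km lm (base_anc km sk) (base_anc lm sl)).
Qed.

Definition qb k := [/\ k < m, sr d k = k, big b d k & hasbase d k].

Lemma qbP k : k < m -> bsr b d k -> qb k.
Proof. by move=> km /and3P[/eqP]. Qed.

Lemma sroots_nonnest s e : uniq s -> (forall k, k \in s -> [/\ k < m, sr d k = k & ecount d k = e]) -> nonnest d m s.
Proof.
move=> us sP; split=> // [k /sP[]//|k l /sP[km sk ek] /sP[lm sl el]].
by apply: (sroot_nest W) => //; rewrite ek el.
Qed.

(** What lies below [a] lies below [c], so [Uof d a] is contained in [Uof d c], and equal sizes give
    equality; dually for [Vof]. *)
Lemma tri_UV a c : qb a -> qb c -> base d a = base d c -> tri d a c ->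
  size (Uof d a) = size (Uof d c) -> size (Vof d a) = size (Vof d c) ->
  Uof d a = Uof d c /\ Vof d a = Vof d c.
Proof.
move=> [am sa ba ha] [cm sc bc hc] E t zU zV.
have [i ia] := T0 W am; have [j jc] := T0 W cm; have [bm sb] := base_m am sa.
split.
  rewrite /Uof -E in zU *; apply: filter_sub_eq zU => x xF hx.
  have xU : x \in Uof d a by rewrite mem_filter hx.
  have [r1 Dx'] := U_le am sa ha xU ia; apply/hasP; exists (px c j); first by apply/(XP W) => //; exists j.
  apply: (rt Dx' (Dx W am ia) (Dx W cm jc) r1).
  apply: (rt (Dx W am ia) (Dy W am ia) (Dx W cm jc) (pxy W am ia)).
  exact: (tri_le W am cm t).
symmetry; rewrite /Vof -E in zV *; apply: filter_sub_eq (esym zV) => y yF hy.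
have yV : y \in Vof d c by rewrite mem_filter hy -E.
have [r1 Dy'] := V_ge cm sc hc yV jc; apply/hasP; exists (py a i); first by apply/(YP W) => //; exists i.
apply: (rt (Dy W am ia) (Dy W cm jc) Dy' _ r1).
apply: (rt (Dy W am ia) (Dx W cm jc) (Dy W cm jc) _ (pxy W cm jc)).
exact: (tri_le W am cm t).
Qed.

Lemma rp_same a c : bsr b d a -> bsr b d c -> ecount d a = ecount d c -> base d a = base d c ->
  Uof d a = Uof d c -> Vof d a = Vof d c -> rp b d a = a -> rp b d c = c -> a = c.
Proof.
move=> ba bc e1 e2 e3 e4 ra rc.
have E : samet b d a =1 samet b d c by move=> x; rewrite /samet e1 e2 e3 e4.
have aux x y : bsr b d y -> samet b d x =1 samet b d y -> rp b d x = x -> y <= x -> x <= y.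
  move=> by' Exy rx yx; rewrite leqNgt; apply/negP => lt.
  have := before_find 0 (_ : y < find (samet b d x) (iota 0 x.+1)).
  rewrite -/(rp b d x) rx => /(_ lt); rewrite nth_iota ?add0n; last by lia.
  by rewrite Exy /samet by' !eqxx.
by have [ac|ca] := leqP a c; apply/eqP; rewrite eqn_leq; [rewrite ac (aux c a)|rewrite (ltnW ca) (aux a c) // ltnW].
Qed.

(** Completely comparable candidates would have the same attached bounds by [tri_UV], hence the same
    representative. So [tri_bound] applies. *)
Lemma tix_bound k : k < m -> bsr b d k -> tix b d k <= Om w.
Proof.
move=> km bk; have [_ rk] := rp_self bk.
rewrite /tix -size_filter; apply: (tri_bound W).
  apply: (@sroots_nonnest _ (ecount d k)); first by apply: filter_uniq; apply: iota_uniq.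
  move=> a; rewrite mem_filter mem_iota => /andP[/and5P[/and3P[/eqP sa _ _] _ _ /eqP ea _] ak].
  by split=> //; lia.
move=> a c; rewrite !mem_filter !mem_iota.
move=> /andP[/and5P[ba /eqP ra /eqP e1 /eqP e2 /andP[/eqP e3 /eqP e4]] ak].
move=> /andP[/and5P[bc /eqP rc /eqP f1 /eqP f2 /andP[/eqP f3 /eqP f4]] ck].
have am : a < m by lia.
have cm : c < m by lia.
apply/negP => t; have [|||E1 E2] := tri_UV (qbP am ba) (qbP cm bc) _ t; rewrite ?e1 ?e3 ?e4 //.
have E : a = c by apply: rp_same => //; rewrite ?e1 ?e2.
by move: t; rewrite E /tri (vb_irr W).
Qed.

Lemma tix_lt k a c : simt b d k a -> simt b d k c -> a < c -> tix b d a < tix b d c.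
Proof.
move=> sa sc ac; have := sa; have := sc.
move=> /and5P[bc /eqP rc /eqP f1 /eqP f2 /andP[/eqP f3 /eqP f4]].
move=> /and5P[ba /eqP ra /eqP e1 /eqP e2 /andP[/eqP e3 /eqP e4]].
have Ea : simt b d a =1 simt b d k by move=> x; rewrite /simt e1 e2 e3 e4.
have Ec : simt b d c =1 simt b d k by move=> x; rewrite /simt f1 f2 f3 f4.
rewrite /tix ra rc (eq_count Ea) (eq_count Ec).
have -> : iota 0 c = iota 0 a ++ iota a (c - a) by rewrite -{1}(subnKC (ltnW ac)) iotaD.
rewrite count_cat -{1}[count _ _]addn0 ltn_add2l -has_count; apply/hasP; exists a => //.
by rewrite mem_iota; lia.
Qed.

Lemma qrel_ord k : ord (bl m (qpres b d k)) (qrel d).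
Proof.
have Pq a : bl m (qpres b d k) a -> qb a by case/andP=> am /and3P[ba _ _]; apply: qbP.
split=> [x _|x y /Pq[xm sx bx hx] /Pq[ym sy by' hy]|y x z /Pq[xm sx bx hx] /Pq[ym sy by' hy] /Pq[zm sz bz hz]].
- by rewrite /qrel eqxx.
- case/orP=> [/eqP//|/andP[h1 _]] /orP[/eqP//|/andP[h2 _]].
  have [b1 _] := base_m xm sx; have [b2 _] := base_m ym sy.
  by have := vb_trans W b1 b2 b1 h1 h2; rewrite (vb_irr W).
- case/orP=> [/eqP->//|h1] /orP[/eqP<-|h2]; first by rewrite /qrel h1 orbT.
  apply/orP; right; case/andP: h1 => v1 /hasP[y1 y1V /hasP[x2 x2U r12]].
  case/andP: h2 => v2 /hasP[y2 y2V /hasP[x3 x3U r23]].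
  have [b1 _] := base_m xm sx; have [b2 _] := base_m ym sy; have [b3 _] := base_m zm sz.
  rewrite /lnk (vb_trans W b1 b2 b3 v1 v2) /=.
  have [i iy] := T0 W ym; have [j jx] := T0 W xm; have [t tz] := T0 W zm.
  have [p1 D1] := U_le ym sy hy x2U iy; have [p2 D2] := V_ge ym sy hy y2V iy.
  have [_ D3] := V_ge xm sx hx y1V jx; have [_ D4] := U_le zm sz hz x3U tz.
  apply/hasP; exists y1 => //; apply/hasP; exists x3 => //.
  apply: (rt D3 D1 D4 r12); apply: (rt D1 (Dx W ym iy) D4 p1).
  apply: (rt (Dx W ym iy) (Dy W ym iy) D4 (pxy W ym iy)).
  exact: (rt (Dy W ym iy) D2 D4 p2 r23).
Qed.

(** Two blocks with a common track are linked: equal bases are told apart by [tix], different bases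
    with equally many edges are not nested, and separated bases are comparable on the track. So the
    blocks of an antichain occupy disjoint sets of at least [b] tracks each. *)
Lemma qrel_wid k : wid (bl m (qpres b d k)) (qrel d) q.
Proof.
move=> s [us A] sP.
have sq a : a \in s -> qb a by move=> /sP/andP[am /and3P[ba _ _]]; apply: qbP.
have disj i x y : x \in s -> y \in s -> i \in T x -> i \in T y -> x = y.
  move=> xs ys ix iy; apply/eqP/contraT => ne.
  have [xm sx bx hx] := sq x xs; have [ym sy by' hy] := sq y ys.
  have [b1 s1] := base_m xm sx; have [b2 s2] := base_m ym sy.
  have /andP[_ qx] := sP x xs; have /andP[_ qy] := sP y ys.
  have /and5P[Bx /eqP rx /eqP e1 /eqP e2 /and3P[/eqP e3 /eqP e4 /eqP e5]] := qx.
  have /and5P[By /eqP ry /eqP f1 /eqP f2 /and3P[/eqP f3 /eqP f4 /eqP f5]] := qy.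
  have bne : base d x != base d y.
    apply: contraNneq ne => E; apply/eqP.
    have sy' : simt b d y y by rewrite /simt By ry !eqxx.
    have sx' : simt b d y x by rewrite /simt Bx rx E e1 f1 e3 e4 f3 f4 !eqxx.
    have [xy|yx|//] := ltngtP x y.
      by have := tix_lt sx' sy' xy; rewrite e5 f5 ltnn.
    by have := tix_lt sy' sx' yx; rewrite e5 f5 ltnn.
  have ix' := anc_in W xm (base_anc xm sx) ix; have iy' := anc_in W ym (base_anc ym sy) iy.
  have eb : ecount d (base d x) = ecount d (base d y) by rewrite e2 f2.
  have mk a c : a \in s -> c \in s -> i \in T a -> i \in T c -> vb d (base d a) (base d c) -> a = c.
    move=> as' cs ia ic V; have [am sa ba ha] := sq a as'; have [cm sc bc hc] := sq c cs.
    apply: A => //; apply/orP; right; rewrite /lnk V /=; apply/hasP.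
    exists (py (base d a) i); first exact: V_track.
    apply/hasP; exists (px (base d c) i); first exact: U_track.
    apply: (vb_le W _ _ V); [exact: (base_m am sa).1|exact: (base_m cm sc).1|exact: (anc_in W am (base_anc am sa) ia)|exact: (anc_in W cm (base_anc cm sc) ic)].
  case: (sep W b1 b2 ix' iy') => H.
  - by rewrite (sroot_nest W b2 s1 s2 eb H) eqxx in bne.
  - by rewrite (sroot_nest W b1 s2 s1 (esym eb) H) eqxx in bne.
  - by rewrite (mk x y) ?eqxx in ne.
  - by rewrite (mk y x) ?eqxx in ne.
have : \sum_(a <- s) #|T a| <= w.
  have -> : \sum_(a <- s) #|T a| = \sum_(i : 'I_w) count (fun a => i \in T a) s.
    under eq_bigr => a _ do rewrite -sum1_card big_mkcond /=.
    by rewrite exchange_big; apply: eq_bigr => i _; rewrite -sum1_count -big_mkcond.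
  rewrite -[X in _ <= X]card_ord -sum1_card; apply: leq_sum => i _.
  by apply: count_uniq1 => // x y; apply: disj.
have : size s * b <= \sum_(a <- s) #|T a|.
  rewrite -sum1_size big_distrl /= big_seq [X in _ <= X]big_seq; apply: leq_sum => a /sq[am _ ba _].
  by rewrite mul1n -(sizeX W am).
move=> h1 h2; have := leq_trans (leq_trans h1 h2) bq.
by rewrite mulnC leq_pmul2l.
Qed.

Lemma rp_qb k : k < m -> bsr b d k -> [/\ qb (rp b d k), base d (rp b d k) = base d k,
  Uof d (rp b d k) = Uof d k & Vof d (rp b d k) = Vof d k].
Proof.
move=> km bk; have [/and5P[b1 _ /eqP e1 /eqP e2 /eqP e3] rk] := rp_self bk.
by split=> //; apply: qbP => //; lia.
Qed.

Lemma chain_bound k : k < m -> bsr b d k -> chain b cq d k < k1.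
Proof.
move=> km bk; have [_ rk] := rp_self bk.
have [B _] := Cq (qrel_ord k) (qrel_wid (k := k)); apply: B; first by lia.
exact: qpres_self.
Qed.

(** A node that is not thick for [G] is split by one of its at most [2 * w] bounds, and each bound
    splits at most [w] non-nested nodes. *)
Lemma thick_bound s G : G < m -> nonnest d m s -> (forall a, a \in s -> ~~ thick d a G) -> size s <= 2 * (w * w).
Proof.
move=> Gm ns nt; pose p a := has (fun x => has (r x) (X d a) && ~~ all (r x) (X d a)) (X d G).
pose p' a := has (fun y => has (r^~ y) (Y d a) && ~~ all (r^~ y) (Y d a)) (Y d G).
have pp a : a \in s -> p a || p' a.
  move=> /nt; rewrite /thick negb_and -!has_predC => /orP[] /hasP[x xX]; rewrite /= negb_or negbK => h.
    by apply/orP; left; apply/hasP; exists x.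
  by apply/orP; right; apply/hasP; exists x.
have [us sm _] := ns.
rewrite -(count_predC p s) mul2n -addnn -!size_filter; apply: leq_add.
  apply: (@pigeon _ (fun a => find (fun x => has (r x) (X d a) && ~~ all (r x) (X d a)) (X d G))) => [a|i iw].
    rewrite mem_filter => /andP[pa _]; move: pa; rewrite /p has_find => h.
    by apply: leq_trans h _; rewrite (sizeX W Gm) sizeT.
  set x := nth 0 (X d G) i; case: (ltnP i (size (X d G))) => iG; last first.
    apply: (@leq_trans 0) => //; rewrite leqn0 size_eq0; apply/eqP/eqP; rewrite -(negbK (_ == _)) -has_filter.
    apply/hasPn => a; rewrite mem_filter => /andP[pa _]; apply/eqP => E.
    by move: pa; rewrite /p has_find E ltnNge iG.
  have xX : x \in X d G by apply: mem_nth.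
  have [j jG xE] := (XP W x Gm).1 xX; have Dx' : D x by rewrite xE; apply: (Dx W).
  apply: (@partial_up _ _ _ _ _ _ _ _ W _ (r x)); first by do 2!apply: nonnest_filter.
    by move=> y z Dy' Dz' h1 h2; apply: (rt Dx' Dy' Dz' h1 h2).
  move=> a; rewrite !mem_filter => /and3P[/eqP fa pa _].
  by have := nth_find 0 pa; rewrite fa.
apply: (@pigeon _ (fun a => find (fun y => has (r^~ y) (Y d a) && ~~ all (r^~ y) (Y d a)) (Y d G))) => [a|i iw].
  rewrite mem_filter => /andP[npa as']; have := pp a as'; rewrite (negbTE npa) /= /p' has_find => h.
  by apply: leq_trans h _; rewrite (sizeY W Gm) sizeT.
set x := nth 0 (Y d G) i; case: (ltnP i (size (Y d G))) => iG; last first.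
  apply: (@leq_trans 0) => //; rewrite leqn0 size_eq0; apply/eqP/eqP; rewrite -(negbK (_ == _)) -has_filter.
  apply/hasPn => a; rewrite mem_filter => /andP[npa as']; have := pp a as'; rewrite (negbTE npa) /= => pa; apply/eqP => E.
  by move: pa; rewrite /p' has_find E ltnNge iG.
have xX : x \in Y d G by apply: mem_nth.
have [j jG xE] := (YP W x Gm).1 xX; have Dx' : D x by rewrite xE; apply: (Dy W).
apply: (@partial_dn _ _ _ _ _ _ _ _ W _ (r^~ x)); first by do 2!apply: nonnest_filter.
  by move=> y z Dy' Dz' h1 h2; apply: (rt Dy' Dz' Dx' h2 h1).
move=> a; rewrite !mem_filter => /and3P[/eqP fa npa as'].
have := pp a as'; rewrite (negbTE npa) /= => pa.
by have := nth_find 0 pa; rewrite fa.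
Qed.

Lemma G_spec k : k < m -> sr d k = k -> [/\ Gof d k < m, sr d (Gof d k) = Gof d k, Gof d k \in ancs d k &
  k != Gof d k -> ~~ thick d k (Gof d k)].
Proof.
move=> km sk; have := search_spec km sk; case: ifP => _.
  by case=> -[h1 h2 _ h3 _] [_ h4]; split=> // ne; apply: h4; rewrite eq_sym.
by case=> -> _ h; split=> //; [exact: (m0 W)|exact: (sr0 d)|exact: (anc_zero W)].
Qed.

Lemma pidx_bound k : k < m -> sr d k = k -> pidx b d k <= 2 * (w * w).
Proof.
move=> km sk; have [Gm _ _ _] := G_spec km sk; rewrite /pidx -size_filter; apply: (thick_bound Gm).
  apply: (@sroots_nonnest _ (ecount d k)); first by apply: filter_uniq; apply: iota_uniq.
  move=> a; rewrite mem_filter mem_iota => /andP[/and5P[/eqP sa _ /eqP ea _ _] ak].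
  by split=> //; lia.
move=> a; rewrite mem_filter mem_iota => /andP[/and5P[/eqP sa _ _ /eqP E /and3P[_ _ ne]] ak].
have am : a < m by lia.
by have [_ _ _ H] := G_spec am sa; rewrite -E; apply: H.
Qed.

Lemma pidx_lt k l : sr d k = k -> big b d k -> ecount d k = ecount d l -> Gof d k = Gof d l ->
  hasbase d k = hasbase d l -> base d k = base d l -> k != Gof d k -> k < l -> pidx b d k < pidx b d l.
Proof.
move=> sk bk e1 e2 e3 e4 ne kl.
have Ea : pset b d k =1 pset b d l by move=> x; rewrite /pset e1 e2 e3 e4.
rewrite /pidx (eq_count Ea).
have -> : iota 0 l = iota 0 k ++ iota k (l - k) by rewrite -{1}(subnKC (ltnW kl)) iotaD.
rewrite count_cat -{1}[count _ _]addn0 ltn_add2l -has_count; apply/hasP; exists k.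
  by rewrite mem_iota; lia.
by rewrite /pset sk bk e1 e2 e3 e4 !eqxx /= -e2.
Qed.

(** Common bound for all entries of a label: [lraw] needs [Om w * Om w + 3], while all others are at
    most [Om w] or quadratic in [w]. *)
Definition Bd := Om w * Om w + 4 * (w * w) + 4.

Lemma ecount_bound k : k < m -> ecount d k <= w * w.
Proof.
by move=> km; rewrite (eH W km); apply: leq_trans (max_card _) _; rewrite card_prod card_ord.
Qed.

Lemma col_bound k : k < m -> sr d k = k -> big b d k ->
  (size (col b cup cdeg d k) <= 11) /\ all (fun x => x < Bd) (col b cup cdeg d k).
Proof.
move=> km sk bk; rewrite /col; have e1 := ecount_bound km; have p1 := pidx_bound km sk.
have ww : w <= w * w by case: (w) => // n; rewrite leq_pmulr.
have S := search_spec km sk; have [bm _] := base_m km sk.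
case: ifP => hb; last first.
  split=> //=; rewrite /Bd; have := leq_b1 (Gof d k != k); move: (nat_of_bool _) => z z1.
  by apply/and5P; split=> //; lia.
rewrite hb in S; have [[Gm sG G0 _ EF] _] := S.
have Bk : bsr b d k by rewrite /bsr sk eqxx bk hb.
have t1 := tix_bound km Bk; have e2 := ecount_bound bm.
have OO : Om w <= Om w * Om w by case: (Om w) => // n; rewrite leq_pmulr.
have u1 : size (Uof d k) <= w.
  by apply: leq_trans (_ : size (X d (base d k)) <= w); [rewrite size_filter count_size|rewrite (sizeX W bm) sizeT].
have v1 : size (Vof d k) <= w.
  by apply: leq_trans (_ : size (Y d (base d k)) <= w); [rewrite size_filter count_size|rewrite (sizeY W bm) sizeT].
have l1 := lraw_bound W Cup Cdeg Gm G0 sG; have s1 := sidx_bound W Gm; have k1' := kind_lt d (Gof d k).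
split=> //=; rewrite /Bd; do !(apply/andP; split) => //; lia.
Qed.

Lemma chn_bound k : k < m -> sr d k = k -> big b d k -> 0 < k1 -> chn b cq d k < k1.
Proof.
move=> km sk bk k10; rewrite /chn; case: ifP => hb //; apply: chain_bound => //.
by rewrite /bsr sk eqxx bk hb.
Qed.

(** Equal chain colours make the representatives linked or equal. If they are equal, the bases
    coincide and [Gof d k], [Gof d l] leave the same family: when different, [loc] makes them
    comparable, and [tri] passes to [k] and [l]; when equal, [pidx] tells [k] from [l]. *)
Lemma col_proper k l : k < m -> l < m -> sr d k = k -> sr d l = l -> big b d k -> big b d l ->
  col b cup cdeg d k = col b cup cdeg d l -> chn b cq d k = chn b cq d l -> k != l ->
  tri d k l || tri d l k.
Proof.
move=> km lm sk sl bk bl' + + ne; have Sk := search_spec km sk; have Sl := search_spec lm sl.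
have [Gm sG aG nG] := G_spec km sk; have [Gm' sG' aG' nG'] := G_spec lm sl.
have pid : ecount d k = ecount d l -> Gof d k = Gof d l -> hasbase d k = hasbase d l -> base d k = base d l ->
    pidx b d k = pidx b d l -> k != Gof d k -> l != Gof d l -> False.
  move=> e1 e2 e3 e4 e5 n1 n2; have [kl|lk|E] := ltngtP k l; last by rewrite E eqxx in ne.
    by have := pidx_lt sk bk e1 e2 e3 e4 n1 kl; rewrite e5 ltnn.
  by have := pidx_lt sl bl' (esym e1) (esym e2) (esym e3) (esym e4) n2 lk; rewrite e5 ltnn.
rewrite /col /chn; case hk : (hasbase d k); case hl' : (hasbase d l) => //; last first.
  rewrite hk in Sk; rewrite hl' in Sl; have [g1 b1 _] := Sk; have [g2 b2 _] := Sl.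
  rewrite g1 g2 => -[e1 e2 e3] _.
  case: (eqVneq k 0) e3 => k0 /=; case: (eqVneq l 0) => l0 //=; rewrite ?k0 ?l0 ?eqxx //= => e3.
  - by rewrite k0 l0 eqxx in ne.
  - by case: pid; rewrite ?g1 ?g2 ?b1 ?b2 ?hk ?hl'.
rewrite hk in Sk; rewrite hl' in Sl.
have [[_ _ G0 _ F1] _] := Sk; have [[_ _ G0' _ F2] _] := Sl.
move=> E; have Eloc : loc cup cdeg d (Gof d k) = loc cup cdeg d (Gof d l) by move: E; rewrite /loc => -[_ _ _ _ _ _ -> -> ->].
move: E => [e1 e2 e3 e4 e5 e6 _ _ _] ch.
have Bk : bsr b d k by rewrite /bsr sk eqxx bk hk.
have Bl : bsr b d l by rewrite /bsr sl eqxx bl' hl'.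
have pE : qpres b d l = qpres b d k.
  by apply: functional_extensionality => x; rewrite /qpres e1 e3 e4 e5 e6.
have [_ rk] := rp_self Bk; have [_ rl] := rp_self Bl.
have [_ C] := Cq (qrel_ord k) (qrel_wid (k := k)).
have := C (rp b d k) (rp b d l) (leq_ltn_trans rk km) (leq_ltn_trans rl lm) (qpres_self Bk).
rewrite -{1}pE => /(_ (qpres_self Bl)); rewrite /chain pE in ch => /(_ ch).
have [[q1 q2 q3 q4] u1 u2 u3] := rp_qb km Bk; have [[q1' q2' q3' q4'] u1' u2' u3'] := rp_qb lm Bl.
have lt k' l' : lnk d (rp b d k') (rp b d l') -> k' < m -> l' < m -> bsr b d k' -> bsr b d l' -> tri d k' l'.
  move=> h km' lm' Bk' Bl'; have [_ v1 v2 v3] := rp_qb km' Bk'; have [_ v1' v2' v3'] := rp_qb lm' Bl'.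
  have [_ s1 _ h1] := qbP km' Bk'; have [_ s2 _ h2] := qbP lm' Bl'.
  move: h; rewrite /lnk v1 v1' v3 v2' => /andP[V /hasP[y yV /hasP[x xU ryx]]].
  exact: lnk_tri V yV xU ryx.
case: (eqVneq (rp b d k) (rp b d l)) => [rE _|rne]; last first.
  rewrite /qrel (negbTE rne) eq_sym (negbTE rne) /= => /orP[/lt->//|/lt->//]; by rewrite ?orbT.
have bE : base d k = base d l by rewrite -u1 -u1' rE.
case: (eqVneq (Gof d k) (Gof d l)) => [GE|Gne].
  case: (eqVneq k (Gof d k)) => [kG|kG].
    by move: ne; rewrite (sroot_nest W lm sk sl e1) ?eqxx // {1}kG GE.
  case: (eqVneq l (Gof d l)) => [lG|lG].
    by move: ne; rewrite (sroot_nest W km sl sk (esym e1)) ?eqxx // {1}lG -GE.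
  by case: pid; rewrite ?hk ?hl'.
have sp : spar d (Gof d k) = spar d (Gof d l) by rewrite -F1 -F2.
case/orP: (loc_proper W Cup Cdeg Gm Gm' G0 G0' sG sG' sp Eloc Gne) => t.
  by rewrite (tri_anc W km lm aG aG' t).
by rewrite (tri_anc W lm km aG' aG t) orbT.
Qed.

End ColProper.

(** * The strategy *)

Record node := Node { npar : nat; nup : bool; nbn : nat; nhl : bool; nhu : bool;
  nO : seq nat; nX : seq nat; nY : seq nat }.

Definition eb (r : rel nat) (X Y : seq nat) := sumn [seq count (r x) Y | x <- X].
Definition b0 : blk := ([::], [::], [::]).

Section Tree.
Variable w : nat.
Definition root := Node 0 false 0 false false [::] (iota 0 w) (iota w w).
Definition nd st k := nth root st k.
Definition kid h x (fl fu u : bool) (b : blk) := Node h u x fl fu b.1.1 b.1.2 b.2.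
Definition heir r (a : node) (bs : seq blk) := has (fun b : blk => eb r b.1.2 b.2 == eb r (nX a) (nY a)) bs.
Definition kids (r : rel nat) st h x (lb ub : seq blk) :=
  let k := kid h x (heir r (nd st h) lb) (heir r (nd st h) ub) in map (k false) lb ++ map (k true) ub.
Definition leafn st h := forall k, 0 < k -> k < size st -> npar (nd st k) != h.

Definition event (D : pred nat) r st x h B lb ub := [/\ h < size st, leafn st h, x \in B & 
  [/\ good D r w (nO (nd st h)) (nX (nd st h)) B, good D r w (nO (nd st h)) B (nY (nd st h)),
      decomp r (nO (nd st h)) (nX (nd st h)) B lb & decomp r (nO (nd st h)) B (nY (nd st h)) ub]].

Inductive reach (D : pred nat) (r : rel nat) : seq node -> Prop :=
| reach0 : reach D r [:: root]
| reachS st x h B lb ub : reach D r st -> (forall k, k < size st -> nbn (nd st k) < x) ->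
    event D r st x h B lb ub -> reach D r (st ++ kids r st h x lb ub).

(** All children of a node come from a single event and occupy consecutive indices from [s] on, the
    lower ones first. *)
Record batch (D : pred nat) r st s x h B lb ub : Prop := Batch {
  b_s : 0 < s; b_h : h < s; b_end : s + (size lb + size ub) <= size st;
  b_x : x \in B;
  b_g1 : good D r w (nO (nd st h)) (nX (nd st h)) B;
  b_g2 : good D r w (nO (nd st h)) B (nY (nd st h));
  b_d1 : decomp r (nO (nd st h)) (nX (nd st h)) B lb;
  b_d2 : decomp r (nO (nd st h)) B (nY (nd st h)) ub;
  b_low : forall i, i < size lb -> nd st (s + i) =
    kid h x (heir r (nd st h) lb) (heir r (nd st h) ub) false (nth b0 lb i);
  b_up : forall i, i < size ub -> nd st (s + (size lb + i)) =
    kid h x (heir r (nd st h) lb) (heir r (nd st h) ub) true (nth b0 ub i);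
  b_par : forall l, 0 < l -> l < size st -> npar (nd st l) = h -> s <= l < s + (size lb + size ub);
  b_old : forall l, l < s -> nbn (nd st l) < x;
  b_new : forall l, s + (size lb + size ub) <= l -> l < size st -> x < nbn (nd st l) }.

Lemma decomp_nil r O X Y bs : decomp r O X Y bs -> 0 < size bs.
Proof. by elim=> // *; rewrite size_cat; lia. Qed.

Lemma size_kids r st h x lb ub : size (kids r st h x lb ub) = size lb + size ub.
Proof. by rewrite size_cat !size_map. Qed.

Lemma nd_old st new k : k < size st -> nd (st ++ new) k = nd st k.
Proof. by move=> km; rewrite /nd nth_cat km. Qed.

Lemma nd_new st new k : nd (st ++ new) (size st + k) = nth root new k.
Proof. by rewrite /nd nth_cat ltnNge leq_addr /= addKn. Qed.

Lemma nd_low r st h x lb ub i : i < size lb -> nd (st ++ kids r st h x lb ub) (size st + i) =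
  kid h x (heir r (nd st h) lb) (heir r (nd st h) ub) false (nth b0 lb i).
Proof. by move=> il; rewrite nd_new nth_cat size_map il (nth_map b0). Qed.

Lemma nd_up r st h x lb ub i : i < size ub -> nd (st ++ kids r st h x lb ub) (size st + (size lb + i)) =
  kid h x (heir r (nd st h) lb) (heir r (nd st h) ub) true (nth b0 ub i).
Proof. by move=> il; rewrite nd_new nth_cat size_map ltnNge leq_addr /= addKn (nth_map b0). Qed.

Section Reach.
Variables (D : pred nat) (r : rel nat).

Lemma reach_size st : reach D r st -> 0 < size st /\ nd st 0 = root.
Proof. by elim=> // {}st x h B lb ub _ [s0 E] _ _; rewrite size_cat nd_old // E; split=> //; lia. Qed.

Lemma kid_case st h x lb ub l : size st <= l -> l < size st + (size lb + size ub) ->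
  (exists2 i, i < size lb & l = size st + i /\ nd (st ++ kids r st h x lb ub) l =
     kid h x (heir r (nd st h) lb) (heir r (nd st h) ub) false (nth b0 lb i)) \/
  (exists2 i, i < size ub & l = size st + (size lb + i) /\ nd (st ++ kids r st h x lb ub) l =
     kid h x (heir r (nd st h) lb) (heir r (nd st h) ub) true (nth b0 ub i)).
Proof.
move=> sl ls; have [h1|h1] := ltnP (l - size st) (size lb); [left|right].
  by exists (l - size st) => //; split; first lia; rewrite -(nd_low _ _ _ _ _ h1); congr nd; lia.
have h2 : l - size st - size lb < size ub by lia.
exists (l - size st - size lb) => //; split; first lia; by rewrite -(nd_up _ _ _ _ _ h2); congr nd; lia.
Qed.

Lemma kid_facts st h x lb ub l : size st <= l -> l < size st + (size lb + size ub) ->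
  npar (nd (st ++ kids r st h x lb ub) l) = h /\ nbn (nd (st ++ kids r st h x lb ub) l) = x.
Proof. by move=> h1 h2; case: (kid_case h x h1 h2) => -[i _ [_ ->]]. Qed.

Lemma reach_batch st k : reach D r st -> 0 < k -> k < size st ->
  exists s x h B lb ub, batch D r st s x h B lb ub /\ s <= k < s + (size lb + size ub).
Proof.
move=> R; elim: R k => [|{}st x h B lb ub R IH old [hs lf xB [g1 g2 d1 d2]]] k k0; first by rewrite /= ltnS leqNgt k0.
have [s0 _] := reach_size R; have l1 := decomp_nil d1; have l2 := decomp_nil d2.
rewrite size_cat size_kids => ks; have [kst|stk] := ltnP k (size st); last first.
  exists (size st), x, h, B, lb, ub; split; last by rewrite stk ks.
  have Ez : size (st ++ kids r st h x lb ub) = size st + (size lb + size ub) by rewrite size_cat size_kids.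
  split; rewrite ?Ez ?(nd_old _ hs) //.
  - by move=> i; apply: nd_low.
  - by move=> i; apply: nd_up.
  - move=> l lp ll E; rewrite ll andbT leqNgt; apply/negP => lst.
    by have := lf l lp lst; rewrite -(nd_old (kids r st h x lb ub) lst) E eqxx.
  - by move=> l lst; rewrite nd_old // old.
  - by move=> l h1 h2; lia.
have [s [x' [h' [B' [lb' [ub' [[a1 a2 a3 a4 a5 a6 a7 a8 a9 a10 a11 a12 a13] ks']]]]]]] := IH k k0 kst.
exists s, x', h', B', lb', ub'; split=> //.
have h's : h' < size st by lia.
split; rewrite ?(nd_old _ h's) //.
- by rewrite size_cat; lia.
- by move=> i il; rewrite nd_old ?a9 //; lia.
- by move=> i il; rewrite nd_old ?a10 //; lia.
- move=> l lp; have [lst _|stl] := ltnP l (size st); first by rewrite nd_old //; apply: a11.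
  rewrite size_cat size_kids => ll; have [-> _] := kid_facts h x stl ll => E.
  have l1' := decomp_nil a7.
  have ss : s < size st by lia.
  have := lf s a1 ss; have := a9 0 l1'; rewrite addn0 => -> /=; by rewrite E eqxx.
- by move=> l lst; rewrite nd_old ?a12 //; lia.
- move=> l sl; rewrite size_cat size_kids => ll; have [lst|stl] := ltnP l (size st).
    by rewrite nd_old //; apply: a13.
  have [_ ->] := kid_facts h x stl ll.
  have l1' := decomp_nil a7; have ss : s + 0 < size st by lia.
  by have := old _ ss; rewrite a9.
Qed.

End Reach.

(** * Transfer between the relation known on arrival and the final one *)

Section Ext.
Variables (D D' : pred nat) (r r' : rel nat).
Hypothesis DD : forall x, D x -> D' x.
Hypothesis rr' : forall x y, D x -> D y -> r x y = r' x y.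

Lemma wa_ext S : wa D r w S -> wa D' r' w S.
Proof.
case=> A z H; split=> // [|x xS]; last by apply: DD; apply: H.
by apply: anti_ext A => x y xS yS; apply: rr'; apply: H.
Qed.

Lemma good_ext O X Y : good D r w O X Y -> good D' r' w O X Y.
Proof.
move=> [w1 w2 [h1 h2]]; split; try exact: wa_ext.
have HX x : x \in X -> D x by apply: wa_r w1.
have HY x : x \in Y -> D x by apply: wa_r w2.
split=> x xX.
  by have [y yY rxy] := hasP (h1 x xX); apply/hasP; exists y; rewrite // -rr' //; auto.
by have [y yY rxy] := hasP (h2 x xX); apply/hasP; exists y; rewrite // -rr' //; auto.
Qed.

Lemma nbr_ext p (X Y : seq nat) : (forall x, x \in X -> D x) -> (forall y, y \in Y -> D y) ->
  {in Y, nbr r p X =1 nbr r' p X}.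
Proof. by move=> HX HY y yY; apply: eq_in_has => x xX; rewrite rr' //; auto. Qed.

Lemma conn_ext (X Y : seq nat) : (forall x, x \in X -> D x) -> (forall y, y \in Y -> D y) -> conn r X Y -> conn r' X Y.
Proof. by move=> HX HY C p h1 h2; rewrite -(eq_in_count (nbr_ext p HX HY)); apply: C. Qed.

Lemma decomp_ext O (X Y : seq nat) bs : (forall x, x \in X -> D x) -> (forall y, y \in Y -> D y) ->
  decomp r O X Y bs -> decomp r' O X Y bs.
Proof.
move=> + + H; elim: H => {O X Y bs} [O X Y c|O X Y p b1 b2 hp ap tp _ IH1 _ IH2] HX HY.
  by apply: Dleaf; apply: conn_ext c.
have E := nbr_ext p HX HY.
have E' : {in Y, predC (nbr r p X) =1 predC (nbr r' p X)} by move=> y yY; rewrite /= E.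
apply: (Dsplit (p := p)) => //; first by rewrite -(eq_in_count E).
  rewrite -(eq_in_filter E) -(eq_in_filter E'); apply: IH1 => x.
    by rewrite mem_filter => /andP[_]; apply: HX.
  by rewrite mem_filter => /andP[_]; apply: HY.
rewrite -(eq_in_filter E'); apply: IH2 => x.
  by rewrite mem_filter => /andP[_]; apply: HX.
by rewrite mem_filter => /andP[_]; apply: HY.
Qed.

Lemma eb_ext (X Y : seq nat) : (forall x, x \in X -> D x) -> (forall y, y \in Y -> D y) -> eb r X Y = eb r' X Y.
Proof.
move=> HX HY; rewrite /eb; congr sumn; apply/eq_in_map => x xX.
by apply: eq_in_count => y yY; rewrite rr' //; auto.
Qed.

Lemma decomp_sub O X Y bs b : decomp r O X Y bs -> b \in bs -> {subset b.1.2 <= X} /\ {subset b.2 <= Y}.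
Proof.
move=> H; elim: H b => {O X Y bs} [O X Y _|O X Y p b1 b2 _ _ _ _ IH1 _ IH2] b.
  by rewrite inE => /eqP->; split.
rewrite mem_cat => /orP[/IH1|/IH2] [h1 h2]; split=> x.
- by move/h1; rewrite mem_filter => /andP[].
- by move/h2; rewrite mem_filter => /andP[].
- by move/h1; rewrite mem_filter => /andP[].
- by move/h2; rewrite mem_filter => /andP[].
Qed.

Lemma heir_ext O (X Y : seq nat) bs a : (forall x, x \in nX a -> D x) -> (forall y, y \in nY a -> D y) ->
  (forall x, x \in X -> D x) -> (forall y, y \in Y -> D y) ->
  decomp r O X Y bs -> heir r a bs = heir r' a bs.
Proof.
move=> H1 H2 HX HY d; apply: eq_in_has => b bb; have [s1 s2] := decomp_sub d bb.
rewrite (eb_ext H1 H2) (@eb_ext b.1.2 b.2) // => x xb; [apply: HX; exact: s1|apply: HY; exact: s2].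
Qed.

Lemma event_ext st x h B lb ub : event D r st x h B lb ub ->
  event D' r' st x h B lb ub /\ kids r st h x lb ub = kids r' st h x lb ub.
Proof.
case=> hs lf xB [g1 g2 d1 d2].
have HX y : y \in nX (nd st h) -> D y by case: g1 => wX _ _; apply: wa_r wX.
have HY y : y \in nY (nd st h) -> D y by case: g2 => _ wY _; apply: wa_r wY.
have HB y : y \in B -> D y by case: g1 => _ wB _; apply: wa_r wB.
split; last by rewrite /kids (heir_ext HX HY HX HB d1) (heir_ext HX HY HB HY d2).
by split=> //; split; try exact: good_ext; apply: decomp_ext; eassumption.
Qed.

Lemma reach_ext st : reach D r st -> reach D' r' st.
Proof.
elim=> [|{}st x h B lb ub R IH old E]; first exact: reach0.
by have [E' ->] := event_ext E; apply: reachS E'.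
Qed.

End Ext.

Section Inv.
Variables (D : pred nat) (r : rel nat) (chi : nat -> nat).
Hypotheses (HO : ord D r) (HC : chaincol D r w chi) (HW : wid D r w).
Hypothesis RG : good D r w [::] (iota 0 w) (iota w w).
Hypothesis RC : conn r (iota 0 w) (iota w w).
Hypothesis w0 : 0 < w.

Lemma reach_node st k : reach D r st -> k < size st ->
  [/\ good D r w (nO (nd st k)) (nX (nd st k)) (nY (nd st k)), conn r (nX (nd st k)) (nY (nd st k)) & nX (nd st k) != [::]].
Proof.
move=> R; elim: R k => [|{}st x h B lb ub R IH old [hs lf xB [g1 g2 d1 d2]]] k.
  by rewrite ltnS leqn0 => /eqP->; split=> //; rewrite /nd /= -size_eq0 size_iota -lt0n.
rewrite size_cat size_kids => ks; have [kst|stk] := ltnP k (size st).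
  by rewrite nd_old //; apply: IH.
have [_ _ n0] := IH h hs.
have B0 : B != [::] by case: (B) xB.
case: (kid_case r h x stk ks) => -[i il [_ ->]] /=.
  by have [H _ _ _] := decompP HO HC d1 g1 n0; have [] := H _ (mem_nth b0 il).
by have [H _ _ _] := decompP HO HC d2 g2 B0; have [] := H _ (mem_nth b0 il).
Qed.

(** At an inner node the point is comparable to the antichain of its event; [event_up] or [event_dn]
    moves [B] to one side of it and [decompP] into one child. Children have larger indices, so the
    descent ends. *)
Lemma descent_leaf st x : reach D r st -> forall k B, k < size st -> x \in B ->
  good D r w (nO (nd st k)) (nX (nd st k)) B -> good D r w (nO (nd st k)) B (nY (nd st k)) ->
  exists h B, [/\ h < size st, leafn st h, x \in B,
  good D r w (nO (nd st h)) (nX (nd st h)) B & good D r w (nO (nd st h)) B (nY (nd st h))].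
Proof.
move=> R k; have [n] := ubnP (size st - k); elim: n k => // n IH k kn B ks xB g1 g2.
case: (asbP (leafn st k)) => [lf|nl]; first by exists k, B.
have [l [l0 ls E]] : exists l, [/\ 0 < l, l < size st & npar (nd st l) = k].
  apply: NNPP => F; apply: nl => l l0 ls; apply/eqP => E; by apply: F; exists l.
have [s [y [h [C [lb [ub [[a1 a2 a3 a4 a5 a6 a7 a8 a9 a10 a11 a12 a13] ks']]]]]]] := reach_batch R l0 ls.
have hk : h = k.
  rewrite -E; case: (ltnP (l - s) (size lb)) => h1.
    by have := a9 _ h1; rewrite subnKC; [move=> ->|lia].
  have h2 : l - s - size lb < size ub by lia.
  by have := a10 _ h2; rewrite (_ : s + _ = l); [move=> ->|lia].
rewrite {}hk in a2 a5 a6 a7 a8 a9 a10 a11.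
have [_ _ n0] := reach_node R ks.
have C0 : C != [::] by case: (C) a4.
have goto bs u t O X Y : decomp r O X Y bs -> good D r w O X Y -> X != [::] ->
    (forall i, i < size bs -> k < t + i /\ t + i < size st /\ exists fl fu, nd st (t + i) = kid k y fl fu u (nth b0 bs i)) ->
    forall B', x \in B' -> good D r w O X B' -> good D r w O B' Y ->
    exists h B, [/\ h < size st, leafn st h, x \in B,
  good D r w (nO (nd st h)) (nX (nd st h)) B & good D r w (nO (nd st h)) B (nY (nd st h))].
  move=> dd gg nn H B' xB' gX gY; have [_ _ _ De] := decompP HO HC dd gg nn.
  have [b [B'' [bb xB'' h1 h2]]] := De x B' xB' gX gY.
  have il : index b bs < size bs by rewrite index_mem.
  have [kt [ts [fl [fu Et]]]] := H _ il; rewrite nth_index // in Et.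
  by apply: (IH _ _ B'' ts xB''); rewrite ?Et //; lia.
case/orP: (event_cmp HO HW a5 g1 xB) => hc.
  have [B' [xB' h1 h2]] := event_up HO HC a5 a6 xB g1 g2 hc.
  apply: (goto ub true (s + size lb) _ _ _ a8 a6 C0 _ B') => // i il; split; first lia; split; first lia.
  by rewrite -addnA; do 2!eexists; apply: a10.
have [B' [xB' h1 h2]] := event_dn HO HC a5 a6 xB g1 g2 hc.
apply: (goto lb false s _ _ _ a7 a5 n0 _ B') => // i il; split; first lia; split; first lia.
by do 2!eexists; apply: a9.
Qed.

Lemma event_ex st x S : reach D r st -> wa D r w S -> x \in S ->
  (forall y, D y -> has (r^~ y) (iota 0 w)) -> (forall y, D y -> has (r y) (iota w w)) ->
  exists h B lb ub, event D r st x h B lb ub.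
Proof.
move=> R wS xS Hb Ht; have [s0 E0] := reach_size R; have [w1 w2 _] := RG.
have [_ _ SD] := wS.
have [h [B [hs lf xB g1 g2]]] : exists h B, [/\ h < size st, leafn st h, x \in B,
  good D r w (nO (nd st h)) (nX (nd st h)) B & good D r w (nO (nd st h)) B (nY (nd st h))].
  apply: (descent_leaf R s0 xS); rewrite E0 /=.
    by apply: (good_dn HO HC) => // y /SD; apply: Hb.
  by apply: (good_up HO HC) => // y /SD; apply: Ht.
have [lb d1] := decomp_ex HO HC g1; have [ub d2] := decomp_ex HO HC g2.
by exists h, B, lb, ub.
Qed.

End Inv.
End Tree.

(** * The constructed tree as a [world] *)

Definition dat w st (r : rel nat) : data :=
  Data (fun k => npar (nd w st k)) (fun k => nup (nd w st k)) (fun k => nhl (nd w st k)) (fun k => nhu (nd w st k))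
    (fun k => nX (nd w st k)) (fun k => nY (nd w st k)) r.

Section World.
Variables (w : nat) (D : pred nat) (r : rel nat) (chi : nat -> nat).
Hypotheses (HO : ord D r) (HC : chaincol D r w chi) (HW : wid D r w).
Hypothesis RG : good D r w [::] (iota 0 w) (iota w w).
Hypothesis RC : conn r (iota 0 w) (iota w w).
Hypothesis w0 : 0 < w.
Variable st : seq node.
Hypothesis R : reach w D r st.
Local Notation m := (size st).
Local Notation d := (dat w st r).

Definition TT k : {set 'I_w} := [set i : 'I_w | val i \in map chi (nX (nd w st k))].
Definition qx k (i : 'I_w) := pk chi (nX (nd w st k)) i.
Definition qy k (i : 'I_w) := pk chi (nY (nd w st k)) i.

Let ng k (km : k < m) : good D r w (nO (nd w st k)) (nX (nd w st k)) (nY (nd w st k)).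
Proof. by have [] := reach_node HO HC RG RC w0 R km. Qed.

Lemma qxP k i : i \in TT k -> qx k i \in nX (nd w st k) /\ chi (qx k i) = i.
Proof. by rewrite inE => h; apply: pkP. Qed.

Lemma TTy k (i : 'I_w) : k < m -> (i \in TT k) = (val i \in map chi (nY (nd w st k))).
Proof. by move=> km; have [wX wY _] := ng km; rewrite inE (tracks_eq HC _ wX wY). Qed.

Lemma qyP k i : k < m -> i \in TT k -> qy k i \in nY (nd w st k) /\ chi (qy k i) = i.
Proof. by move=> km; rewrite TTy // => h; apply: pkP. Qed.

Lemma chi_lt x : D x -> chi x < w. Proof. exact: HC.1. Qed.

Lemma nXD k x : k < m -> x \in nX (nd w st k) -> D x.
Proof. by move=> km; have [wX _ _] := ng km; apply: wa_r wX. Qed.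

Lemma nYD k x : k < m -> x \in nY (nd w st k) -> D x.
Proof. by move=> km; have [_ wY _] := ng km; apply: wa_r wY. Qed.

Lemma qx_eq k (i : 'I_w) x : k < m -> x \in nX (nd w st k) -> chi x = i -> i \in TT k /\ qx k i = x.
Proof.
move=> km xX E; have iT : i \in TT k by rewrite inE; apply/mapP; exists x; rewrite // E.
split=> //; have [h1 h2] := qxP iT; have [wX _ _] := ng km.
by apply: (wa_chi HC wX) => //; rewrite h2.
Qed.

Lemma qy_eq k (i : 'I_w) x : k < m -> x \in nY (nd w st k) -> chi x = i -> i \in TT k /\ qy k i = x.
Proof.
move=> km xY E; have iT : i \in TT k by rewrite TTy //; apply/mapP; exists x; rewrite // E.
split=> //; have [h1 h2] := qyP km iT; have [_ wY _] := ng km.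
by apply: (wa_chi HC wY) => //; rewrite h2.
Qed.

Lemma qXP k x : k < m -> x \in nX (nd w st k) <-> exists2 i, i \in TT k & x = qx k i.
Proof.
move=> km; split=> [xX|[i iT ->]]; last by case: (qxP iT).
by have [iT E] := @qx_eq k (Ordinal (chi_lt (nXD km xX))) x km xX erefl; exists (Ordinal (chi_lt (nXD km xX))).
Qed.

Lemma qYP k x : k < m -> x \in nY (nd w st k) <-> exists2 i, i \in TT k & x = qy k i.
Proof.
move=> km; split=> [xX|[i iT ->]]; last by case: (qyP km iT).
by have [iT E] := @qy_eq k (Ordinal (chi_lt (nYD km xX))) x km xX erefl; exists (Ordinal (chi_lt (nYD km xX))).
Qed.

Lemma permX k : k < m -> perm_eq (nX (nd w st k)) [seq qx k i | i <- enum (TT k)].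
Proof.
move=> km; have [wX _ _] := ng km; apply: uniq_perm; first exact: wa_uniq wX.
  rewrite map_inj_in_uniq ?enum_uniq // => i j; rewrite !mem_enum => iT jT E.
  by apply: val_inj; have [_ Ei] := qxP iT; have [_ Ej] := qxP jT; rewrite E in Ei; apply: etrans (esym Ei) Ej.
move=> x; apply/idP/mapP => [/(qXP _ km)[i iT ->]|[i iT ->]]; first by exists i; rewrite ?mem_enum.
by apply/(qXP _ km); exists i; rewrite // mem_enum in iT.
Qed.

Lemma permY k : k < m -> perm_eq (nY (nd w st k)) [seq qy k i | i <- enum (TT k)].
Proof.
move=> km; have [_ wX _] := ng km; apply: uniq_perm; first exact: wa_uniq wX.
  rewrite map_inj_in_uniq ?enum_uniq // => i j; rewrite !mem_enum => iT jT E.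
  by apply: val_inj; have [_ Ei] := qyP km iT; have [_ Ej] := qyP km jT; rewrite E in Ei; apply: etrans (esym Ei) Ej.
move=> x; apply/idP/mapP => [/(qYP _ km)[i iT ->]|[i iT ->]]; first by exists i; rewrite ?mem_enum.
by apply/(qYP _ km); exists i; rewrite // mem_enum in iT.
Qed.

Record place s x h B lb ub k (u : bool) b : Prop := Place {
  p_b : batch w D r st s x h B lb ub; p_h : npar (nd w st k) = h; p_u : nup (nd w st k) = u;
  p_bn : nbn (nd w st k) = x; p_hl : nhl (nd w st k) = heir r (nd w st h) lb;
  p_hu : nhu (nd w st k) = heir r (nd w st h) ub;
  p_X : nX (nd w st k) = b.1.2; p_Y : nY (nd w st k) = b.2;
  p_i : exists2 i, i < size (if u then ub else lb) & b = nth b0 (if u then ub else lb) i /\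
        k = s + (if u then size lb + i else i);
  p_sX : {subset nX (nd w st k) <= if u then B else nX (nd w st h)};
  p_sY : {subset nY (nd w st k) <= if u then nY (nd w st h) else B} }.

Lemma batch_place s x h B lb ub k : batch w D r st s x h B lb ub -> s <= k < s + (size lb + size ub) ->
  exists u b, place s x h B lb ub k u b.
Proof.
move=> bt /andP[sk ks]; have [a1 a2 a3 a4 a5 a6 a7 a8 a9 a10 a11 a12 a13] := bt.
have hm : h < m by have := decomp_nil a7; lia.
have [_ _ n0] := reach_node HO HC RG RC w0 R hm.
have C0 : B != [::] by case: (B) a4.
have [i1|i1] := ltnP (k - s) (size lb).
  exists false, (nth b0 lb (k - s)).
  have E := a9 _ i1; rewrite subnKC // in E.
  have [_ _ _ s1 s2] := let: And4 H _ _ _ := decompP HO HC a7 a5 n0 in H _ (mem_nth b0 i1).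
  split; rewrite ?E //; by exists (k - s) => //; split=> //; lia.
have i2 : k - s - size lb < size ub by lia.
exists true, (nth b0 ub (k - s - size lb)).
have E := a10 _ i2; rewrite (_ : s + _ = k) in E; last by lia.
have [_ _ _ s1 s2] := let: And4 H _ _ _ := decompP HO HC a8 a6 C0 in H _ (mem_nth b0 i2).
split; rewrite ?E //; by exists (k - s - size lb) => //; split=> //; lia.
Qed.

Lemma placeP k : k < m -> 0 < k -> exists s x h B lb ub u b, place s x h B lb ub k u b.
Proof.
move=> km k0; have [s [x [h [B [lb [ub [bt sk]]]]]]] := reach_batch R k0 km.
by exists s, x, h, B, lb, ub; apply: batch_place.
Qed.

Lemma place_h s x h B lb ub k u b : place s x h B lb ub k u b -> h < m /\ h < k.
Proof.
case=> [[a1 a2 a3 a4 a5 a6 a7 a8 _ _ _ _ _]] _ _ _ _ _ _ _ [i _ [_ ->]] _ _.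
have := decomp_nil a7; lia.
Qed.

Lemma place_bdisj s x h B lb ub k u b : place s x h B lb ub k u b -> pairwise bdisj (if u then ub else lb).
Proof.
move=> p; have [hm _] := place_h p.
case: p => [[a1 a2 a3 a4 a5 a6 a7 a8 _ _ _ _ _]] _ _ _ _ _ _ _ _ _ _.
have [_ _ n0] := reach_node HO HC RG RC w0 R hm.
have C0 : B != [::] by case: (B) a4.
by case: u; [case: (decompP HO HC a8 a6 C0)|case: (decompP HO HC a7 a5 n0)].
Qed.

Lemma bdisj_nth (bs : seq blk) a c x : pairwise bdisj bs -> a < size bs -> c < size bs ->
  x \in (nth b0 bs a).1.2 -> x \in (nth b0 bs c).1.2 -> a = c.
Proof.
move=> /(pairwiseP b0) H al cl xa xc.
have aux i j : i < j -> j < size bs -> x \in (nth b0 bs i).1.2 -> x \in (nth b0 bs j).1.2 -> False.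
  move=> ij jl xi xj; have il := ltn_trans ij jl.
  by case/andP: (H i j il jl ij) => /hasP[]; exists x.
by have [ac|ca|//] := ltngtP a c; [case: (aux a c)|case: (aux c a)].
Qed.

Lemma place_sib s x h B lb ub k l u b : place s x h B lb ub k u b -> l < m -> 0 < l ->
  npar (nd w st l) = h -> exists v c, place s x h B lb ub l v c.
Proof. by move=> p lm l0 E; apply: batch_place (p_b p) _; apply: (b_par (p_b p)). Qed.

Lemma placeBD s x h B lb ub k u b : place s x h B lb ub k u b -> forall i y z, y \in B -> z \in B ->
  chi y = i -> chi z = i -> y = z /\ D y.
Proof.
move=> p i y z yB zB Ey Ez; have [_ wB _] := b_g1 (p_b p).
by split; [apply: (wa_chi HC wB) => //; rewrite Ey Ez|apply: wa_r wB yB].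
Qed.

Lemma eb_card k : k < m -> ecount d k = #|edges d TT qx qy k|.
Proof.
move=> km; rewrite /ecount sumnE big_map (perm_big _ (permX km)) /= big_map big_enum /=.
transitivity (\sum_(i in TT k) \sum_(j in TT k) nat_of_bool (r (qx k i) (qy k j))).
  apply: eq_bigr => i _; have /seq.permP -> := permY km.
  rewrite count_map -sum1_count big_mkcond /= big_enum /=.
  by apply: eq_bigr => j _; case: (r _ _).
rewrite -sum1_card pair_big_dep /= big_mkcond [RHS]big_mkcond /=.
by apply: eq_bigr => -[i j] _; rewrite !inE /=; do 2!case: (_ \in _) => //=; case: (r _ _).
Qed.

Lemma reach_world : world d m D TT qx qy (fun k => nbn (nd w st k)).
Proof.
have [s0 E0] := reach_size R; have [rr ra rt] := HO.
split=> //.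
- by have := congr1 npar E0.
- move=> k km kp; have [s [x [h [B [lb [ub [u [b p]]]]]]]] := placeP km kp.
  by have [_] := place_h p; rewrite /= (p_h p).
- by move=> k i km iT; have [h _] := qxP iT; apply: nXD h.
- by move=> k i km iT; have [h _] := qyP km iT; apply: nYD h.
- by move=> k x km; apply: qXP.
- by move=> k x km; apply: qYP.
- by move=> k km; rewrite /= (perm_size (permX km)) size_map cardE.
- by move=> k km; rewrite /= (perm_size (permY km)) size_map cardE.
- move=> k km; have [_ _ n0] := reach_node HO HC RG RC w0 R km.
  have xX : head 0 (nX (nd w st k)) \in nX (nd w st k) by case: (nX _) n0 => // a t; rewrite mem_head.
  by have [i iT _] := (qXP _ km).1 xX; exists i.
- move=> k i km iT; have [h1 h2] := qxP iT; have [h3 h4] := qyP km iT.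
  by apply: (good_le HO HC (ng km)) => //; rewrite h2 h4.
- move=> k km kp uk; have [s [x [h [B [lb [ub [u [b p]]]]]]]] := placeP km kp.
  have [hm hk] := place_h p; rewrite /= (p_h p).
  have u0 : u = false by rewrite -(p_u p); apply: negbTE.
  have sX := p_sX p; have sY := p_sY p; rewrite u0 in sX sY.
  have X1 i : i \in TT k -> i \in TT h /\ qx h i = qx k i.
    by move=> iT; have [h1 h2] := qxP iT; apply: qx_eq => //; apply: sX.
  split; first by apply/subsetP => i /X1[].
    by move=> i /X1[].
  move=> i iT; have [h1 h2] := qyP km iT; have [iT' _] := X1 i iT; have [h3 h4] := qyP hm iT'.
  by apply: (good_le HO HC (b_g2 (p_b p))); rewrite ?h2 ?h4 //; apply: sY.
- move=> k km kp uk; have [s [x [h [B [lb [ub [u [b p]]]]]]]] := placeP km kp.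
  have [hm hk] := place_h p; rewrite /= (p_h p).
  have u0 : u = true by rewrite -(p_u p).
  have sX := p_sX p; have sY := p_sY p; rewrite u0 in sX sY.
  have X1 i : i \in TT k -> i \in TT h /\ qy h i = qy k i.
    by move=> iT; have [h1 h2] := qyP km iT; apply: qy_eq => //; apply: sY.
  split; first by apply/subsetP => i /X1[].
    by move=> i /X1[].
  move=> i iT; have [h1 h2] := qxP iT; have [iT' _] := X1 i iT; have [h3 h4] := qxP iT'.
  by apply: (good_le HO HC (b_g1 (p_b p))); rewrite ?h2 ?h4 //; apply: sX.
- move=> k l i km lm kp lp E uE ik il.
  have [s [x [h [B [lb [ub [u [b p]]]]]]]] := placeP km kp.
  have [v [c p']] : exists v c, place s x h B lb ub l v c by apply: (place_sib p) => //; rewrite -(p_h p).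
  have vu : v = u by rewrite -(p_u p) -(p_u p').
  rewrite {}vu in p'.
  have [h1 h2] := qxP ik; have [h3 h4] := qxP il; have [hm _] := place_h p.
  have Exy : qx k i = qx l i.
    have sX := p_sX p h1; have sX' := p_sX p' h3; case: (u) sX sX' => sX sX'.
      by case: (placeBD p sX sX' h2 h4).
    by have [wX _ _] := ng hm; apply: (wa_chi HC wX) => //; rewrite h2 h4.
  have [a al [Ea ->]] := p_i p; have [a' al' [Ea' ->]] := p_i p'.
  have -> // : a = a'.
  apply: (bdisj_nth (place_bdisj p) al al' (x := qx k i)); first by rewrite -Ea -(p_X p).
  by rewrite Exy -Ea' -(p_X p').
- move=> k l i km lm kp lp E uk ul ik il.
  have [s [x [h [B [lb [ub [u [b p]]]]]]]] := placeP km kp.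
  have [v [c p']] : exists v c, place s x h B lb ub l v c by apply: (place_sib p) => //; rewrite -(p_h p).
  have u0 : u = false by rewrite -(p_u p); apply: negbTE.
  have v1 : v = true by rewrite -(p_u p').
  have [h1 h2] := qyP km ik; have [h3 h4] := qxP il.
  have sY := p_sY p h1; have sX := p_sX p' h3; rewrite u0 in sY; rewrite v1 in sX.
  by have [-> Dq] := placeBD p sY sX h2 h4; apply: rr; have [<-] := placeBD p sY sX h2 h4.
(* If no edge left [S], all neighbours of its tracks would lie on [S] itself, against the strict
   surplus in [conn]. *)
- move=> k S i0 j0 km /subsetP ST iS jT jS.
  have [_ C _] := reach_node HO HC RG RC w0 R km.
  pose q i := i \in [seq val t | t <- enum S]; pose p x := q (chi x).
  have qE (i : 'I_w) : q i = (i \in S).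
    by rewrite /q mem_map ?mem_enum //; apply: val_inj.
  have [h1 h2] := qxP (ST _ iS); have [h3 h4] := qxP jT.
  have hp : has p (nX (nd w st k)) by apply/hasP; exists (qx k i0); rewrite // /p h2 qE.
  have ap : ~~ all p (nX (nd w st k)) by apply/allPn; exists (qx k j0); rewrite // /p h4 qE.
  have lt := C p hp ap; have [wX wY _] := ng km.
  have cE : count p (nX (nd w st k)) = count p (nY (nd w st k)).
    have /seq.permP -> := permX km; have /seq.permP -> := permY km; rewrite !count_map; apply: eq_in_count => i; rewrite mem_enum => iT.
    by rewrite /= /p; have [_ ->] := qxP iT; have [_ ->] := qyP km iT.
  apply: NNPP => F; move: lt; rewrite ltnNge => /negP; apply; rewrite cE; apply: count_subin => y yY.
  case/hasP=> x xX /andP[px rxy]; apply/negPn/negP => np.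
  have [i iT Ei] := (qXP _ km).1 xX; have [j jT' Ej] := (qYP _ km).1 yY.
  apply: F; exists i, j; split=> //; last by rewrite -Ei -Ej.
    by move: px; rewrite /p Ei; have [_ ->] := qxP iT; rewrite qE.
  by move: np; rewrite /p Ej; have [_ ->] := qyP km jT'; rewrite qE.
- move=> k l km lm kp lp E; have [s [x [h [B [lb [ub [u [b p]]]]]]]] := placeP km kp.
  have [v [c p']] : exists v c, place s x h B lb ub l v c by apply: (place_sib p) => //; rewrite -(p_h p).
  by rewrite (p_bn p) (p_bn p').
- move=> k l lm kl; have [k0|l0] := posnP l; first by move: kl; rewrite k0 leqn0 => /eqP->.
  have [s [x [h [B [lb [ub [bt /andP[sk ks]]]]]]]] := reach_batch R l0 lm.
  have [u [b p]] := batch_place bt (introT andP (conj sk ks)); rewrite (p_bn p).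
  have [lt|ge] := ltnP k s; first by apply: ltnW; apply: (b_old bt).
  by have [|v [c p']] := @batch_place _ _ _ _ _ _ k bt; [lia|rewrite (p_bn p')].
- move=> k km kp; have [s [x [h [B [lb [ub [u [b p]]]]]]]] := placeP km kp.
  by rewrite /= (p_h p) (p_bn p); apply: (b_old (p_b p)); apply: (b_h (p_b p)).
- exact: eb_card.
- move=> k km kp; have [s [x [h [B [lb [ub [u [b p]]]]]]]] := placeP km kp.
  have bt := p_b p; rewrite /= (p_h p) (p_hl p); split.
    case/(has_nthP b0)=> i il /eqP E; exists (s + i); have := b_low bt il => Ei.
    have := b_end bt; have := b_s bt; rewrite /ecount /= Ei /= => h1 h2; split=> //; lia.
  case=> g [gm g0 pg ug eg]; have [v [c p']] := place_sib p gm g0 pg.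
  have v0 : v = false by rewrite -(p_u p'); apply: negbTE.
  have [i il [Ec _]] := p_i p'; rewrite v0 in il Ec.
  apply/(has_nthP b0); exists i => //; apply/eqP.
  by move: eg; rewrite /ecount /= (p_X p') (p_Y p') Ec.
- move=> k km kp; have [s [x [h [B [lb [ub [u [b p]]]]]]]] := placeP km kp.
  have bt := p_b p; rewrite /= (p_h p) (p_hu p); split.
    case/(has_nthP b0)=> i il /eqP E; exists (s + (size lb + i)); have := b_up bt il => Ei.
    have := b_end bt; have := b_s bt; rewrite /ecount /= Ei /= => h1 h2; split=> //; lia.
  case=> g [gm g0 pg ug eg]; have [v [c p']] := place_sib p gm g0 pg.
  have v0 : v = true by rewrite -(p_u p').
  have [i il [Ec _]] := p_i p'; rewrite v0 in il Ec.
  apply/(has_nthP b0); exists i => //; apply/eqP.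
  by move: eg; rewrite /ecount /= (p_X p') (p_Y p') Ec.
Qed.

End World.

Section Strategy.
Variable w : nat.

Definition step (r : rel nat) (D : pred nat) st x : seq node :=
  choice_of st (fun st' => exists h B lb ub, event w D r st x h B lb ub /\ st' = st ++ kids w r st h x lb ub).

Fixpoint tree (r : rel nat) (P M : pred nat) n : seq node :=
  if n is x.+1 then
    if M x then step (rst x P r) (rsp x P) (tree r P M x) x else tree r P M x
  else [:: root w].

Lemma tree_agr x (P P' M M' : pred nat) r r' n : agr x P P' r r' -> (forall y, y <= x -> M y = M' y) -> n <= x.+1 ->
  tree r P M n = tree r' P' M' n.
Proof.
move=> A E; elim: n => //= n IH nx; rewrite IH ?(ltnW nx) // E //.
by rewrite (agr_rst (agrW (ltnSE nx) A)) (agr_rsp (agrW (ltnSE nx) A)).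
Qed.

(* The identifiers below [w] form a bottom antichain, the next [w] ones a top antichain. *)
Record dummied n (P M : pred nat) (r : rel nat) : Prop := Dummied {
  du_P : forall i, i < 2 * w -> P i;
  du_M : forall i, i < 2 * w -> ~~ M i;
  du_b : forall i j, i < w -> j < w -> r i j = (i == j);
  du_t : forall i j, w <= i < 2 * w -> w <= j < 2 * w -> r i j = (i == j);
  du_lo : forall i y, i < w -> w <= y < n -> P y -> r i y;
  du_hi : forall i y, w <= i < 2 * w -> y < n -> (y < w) || (2 * w <= y) -> P y -> r y i;
  du_mark : forall x, x < n -> M x -> P x /\ exists s, [/\ anti r s, x \in s, size s = w &
       forall y, y \in s -> y <= x /\ P y] }.

(** Bottom and top are completely comparable, so any nonempty part of the bottom has the whole top
    as neighbours. *)
Lemma root_good (D : pred nat) (r : rel nat) : 0 < w -> (forall x, D x -> r x x) -> (forall i, i < 2 * w -> D i) ->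
  (forall i j, i < w -> j < w -> r i j = (i == j)) ->
  (forall i j, w <= i < 2 * w -> w <= j < 2 * w -> r i j = (i == j)) ->
  (forall i j, i < w -> w <= j < 2 * w -> r i j) ->
  good D r w [::] (iota 0 w) (iota w w) /\ conn r (iota 0 w) (iota w w).
Proof.
move=> w0 rr HD Hb Ht Hbt.
have i0 i : i \in iota 0 w = (i < w) by rewrite mem_iota.
have i1 i : i \in iota w w = (w <= i < 2 * w) by rewrite mem_iota mul2n addnn.
split.
  split.
  - split; last by move=> x; rewrite /= i0 => h; apply: HD; lia.
      split; first exact: iota_uniq.
      by move=> x y; rewrite /= !i0 => xw yw; rewrite Hb // => /eqP.
    by rewrite size_iota.
  - split; last by move=> x; rewrite /= i1 => h; apply: HD; lia.
      split; first exact: iota_uniq.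
      by move=> x y; rewrite /= !i1 => xw yw; rewrite Ht // => /eqP.
    by rewrite size_iota.
  split=> x; rewrite ?i0 ?i1 => xw; apply/hasP.
    by exists w; rewrite ?i1 ?Hbt //; lia.
  by exists 0; rewrite ?i0 ?Hbt.
move=> p /hasP[x xw px]; rewrite all_count size_iota neq_ltn => /orP[] lt; last first.
  by have := count_size p (iota 0 w); rewrite size_iota; lia.
have -> // : count (nbr r p (iota 0 w)) (iota w w) = w.
apply/eqP; rewrite -[X in _ == X](size_iota w w) -all_count; apply/allP => y; rewrite i1 => yw.
by apply/hasP; exists x => //; rewrite px Hbt //; rewrite i0 in xw.
Qed.

Section Run.
Variables (n : nat) (P M : pred nat) (r : rel nat).
Hypotheses (HO : ord (bl n P) r) (HW : wid (bl n P) r w) (DU : dummied n P M r) (w0 : 0 < w).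
Local Notation D := (bl n P).

Lemma mark_ge x : x < n -> M x -> 2 * w <= x.
Proof. by move=> xn Mx; rewrite leqNgt; apply/negP => /(du_M DU); rewrite Mx. Qed.

Definition sits (D' : pred nat) (r' : rel nat) n' := 
  (forall y, y < n' -> P y -> D' y) /\ (forall y z, y < n' -> z < n' -> P y -> P z -> r y z = r' y z).

Lemma rsp_ord x : x < n -> ord (rsp x P) (rst x P r).
Proof.
move=> xn; have [rr ra rt] := HO.
have B y : rsp x P y -> bl n P y by case/andP=> yx Py; rewrite /bl Py (leq_ltn_trans yx xn).
have E y z : rsp x P y -> rsp x P z -> rst x P r y z = r y z.
  by case/andP=> yx Py /andP[zx Pz]; apply: rst_in.
split=> [y Dy|y z Dy Dz|z y t Dz Dy Dt]; rewrite !E //; first exact/rr/B.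
  by apply: ra; apply: B.
by apply: rt; apply: B.
Qed.

Lemma rsp_wid x : x < n -> wid (rsp x P) (rst x P r) w.
Proof.
move=> xn; have B y : rsp x P y -> bl n P y by case/andP=> yx Py; rewrite /bl Py (leq_ltn_trans yx xn).
apply: (@wid_ext _ r) => [y z /andP[yx Py] /andP[zx Pz]|]; first by rewrite rst_in.
exact: wid_sub HW.
Qed.

Lemma rsp_root x : x < n -> M x ->
  good (rsp x P) (rst x P r) w [::] (iota 0 w) (iota w w) /\ conn (rst x P r) (iota 0 w) (iota w w).
Proof.
move=> xn Mx; have wx := mark_ge xn Mx; have [rr _ _] := rsp_ord xn.
have PD i : i < 2 * w -> rsp x P i by move=> iw; rewrite /rsp (du_P DU) // andbT; lia.
have rE y z : rsp x P y -> rsp x P z -> rst x P r y z = r y z by case/andP=> yx Py /andP[zx Pz]; apply: rst_in.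
apply: (root_good w0 rr PD).
- by move=> i j iw jw; rewrite rE; [apply: (du_b DU)|apply: PD; lia|apply: PD; lia].
- by move=> i j iw jw; rewrite rE; [apply: (du_t DU)|apply: PD; lia|apply: PD; lia].
- move=> i j iw jw; rewrite rE; [apply: (du_lo DU) => //|apply: PD; lia|apply: PD; lia].
    by lia.
  by apply: (du_P DU); lia.
Qed.

Lemma amb_root x : x < n -> M x ->
  good D r w [::] (iota 0 w) (iota w w) /\ conn r (iota 0 w) (iota w w).
Proof.
move=> xn Mx; have [g c] := rsp_root xn Mx; have wx := mark_ge xn Mx.
have sub y : rsp x P y -> D y by case/andP=> yx Py; rewrite /bl Py (leq_ltn_trans yx xn).
have rE y z : rsp x P y -> rsp x P z -> rst x P r y z = r y z by case/andP=> yx Py /andP[zx Pz]; apply: rst_in.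
split; first exact: good_ext g.
have [w1 w2 _] := g.
by apply: (conn_ext rE) c => y; [apply: wa_r w1|apply: wa_r w2].
Qed.

Lemma step_event x : x < n -> M x -> reach w (rsp x P) (rst x P r) (tree r P M x) -> 
  exists h B lb ub, event w (rsp x P) (rst x P r) (tree r P M x) x h B lb ub /\
    tree r P M x.+1 = tree r P M x ++ kids w (rst x P r) (tree r P M x) h x lb ub.
Proof.
move=> xn Mx R; have wx := mark_ge xn Mx; have [Px [s [A xs sz sP]]] := du_mark DU xn Mx.
have E y z : y <= x -> z <= x -> P y -> P z -> rst x P r y z = r y z by apply: rst_in.
have O := rsp_ord xn; have W := rsp_wid xn; have [rr _ _] := O.
have [chi C] := @dilworth_bl x.+1 P _ _ O W.
have PD i : i < 2 * w -> rsp x P i by move=> iw; rewrite /rsp (du_P DU) // andbT; lia.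
have rE y z : rsp x P y -> rsp x P z -> rst x P r y z = r y z by case/andP=> yx Py /andP[zx Pz]; apply: E.
have [RG RC] := rsp_root xn Mx.
have [||||h [B [lb [ub Ev]]]] := event_ex O C W RG RC w0 R (S := s) (x := x).
- split=> // [|y /sP[yx Py]]; last by rewrite /rsp yx.
  by apply: anti_ext A => y z /sP[yx Py] /sP[zx Pz]; rewrite E.
- by [].
- move=> y Dy; apply/hasP; case: (ltnP y w) => yw.
    by exists y; rewrite ?mem_iota //; apply: rr.
  have D0 : rsp x P 0 by apply: PD; lia.
  exists 0; rewrite ?mem_iota //; have /andP[yx Py] := Dy; rewrite rE //; apply: (du_lo DU) => //.
  by rewrite yw (leq_ltn_trans yx xn).
- move=> y Dy; apply/hasP; have /andP[yx Py] := Dy.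
  case yw : ((y < w) || (2 * w <= y)).
    exists w; first by rewrite mem_iota; lia.
    rewrite rE //; last by apply: PD; lia.
    by apply: (du_hi DU) => //; lia.
  exists y; first by rewrite mem_iota; lia.
  exact: rr.
rewrite /= Mx; apply: (@choice_ofP _ (tree r P M x) (fun st' => exists h B lb ub,
  event w (rsp x P) (rst x P r) (tree r P M x) x h B lb ub /\ st' = tree r P M x ++ kids w (rst x P r) (tree r P M x) h x lb ub)).
by eexists; exists h, B, lb, ub.
Qed.

(** Stated for every relation that agrees on the prefix, so that it serves both the view on arrival
    and the final order. The maximum with [1] accounts for the root, born at time [0] before any
    arrival. *)
Lemma tree_reach n' : n' <= n -> (forall D' r', sits D' r' n' -> reach w D' r' (tree r P M n')) /\
  (forall k, k < size (tree r P M n') -> nbn (nd w (tree r P M n') k) < maxn 1 n').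
Proof.
elim: n' => [|x IH] xn.
  split; first by move=> *; apply: reach0.
  by move=> k; rewrite ltnS leqn0 => /eqP->.
have [IH1 IH2] := IH (ltnW xn).
case Mx : (M x); last first.
  rewrite /= Mx; split; first by move=> D' r' [h1 h2]; apply: IH1; split=> *; [apply: h1|apply: h2] => //; exact: ltnW.
  by move=> k /IH2; lia.
have R : reach w (rsp x P) (rst x P r) (tree r P M x).
  apply: IH1; split=> [y yx Py|y z yx zx Py Pz]; first by rewrite /rsp Py (ltnW yx).
  by rewrite rst_in // ltnW.
have [h [B [lb [ub [Ev ->]]]]] := step_event xn Mx R.
have wx := mark_ge xn Mx.
split=> [D' r' [h1 h2]|k].
  apply: (@reach_ext _ (rsp x P) _ (rst x P r)) => [y /andP[yx Py]|y z /andP[yx Py] /andP[zx Pz]|].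
  - exact: h1.
  - by rewrite rst_in // h2.
  - by apply: reachS Ev => // k /IH2; lia.
rewrite size_cat size_kids => ks; have [kx|xk] := ltnP k (size (tree r P M x)).
  by rewrite nd_old //; have := IH2 k kx; lia.
by have [_ ->] := kid_facts w (rst x P r) h x xk ks; lia.
Qed.

Lemma tree_amb n' : n' <= n -> reach w D r (tree r P M n').
Proof.
move=> nn; apply: (tree_reach nn).1; split=> // y yn Py.
by rewrite /bl Py (leq_trans yn nn).
Qed.

Lemma tree_pre n' n'' : n' <= n'' -> n'' <= n -> exists s, tree r P M n'' = tree r P M n' ++ s.
Proof.
elim: n'' => [|x IH].
  by rewrite leqn0 => /eqP-> _; exists [::]; rewrite cats0.
rewrite leq_eqVlt => /orP[/eqP-> _|nx xn]; first by exists [::]; rewrite cats0.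
have [s E] := IH nx (ltnW xn).
case Mx : (M x); last by rewrite /= Mx; exists s.
have R : reach w (rsp x P) (rst x P r) (tree r P M x).
  apply: (tree_reach (ltnW xn)).1; split=> [y yx Py|y z yx zx Py Pz]; first by rewrite /rsp Py (ltnW yx).
  by rewrite rst_in // ltnW.
have [h [B [lb [ub [Ev ->]]]]] := step_event xn Mx R.
by rewrite E -catA; eexists.
Qed.

(* the index of the last node of the batch created when the point x arrives *)
Definition lastn x := (size (tree r P M x.+1)).-1.

Lemma point_facts x (st := tree r P M x.+1) (k := lastn x) (h := npar (nd w st k)) : x < n -> M x ->
  [/\ 0 < k, k < size st, nbn (nd w st k) = x, h < k & (exists B, [/\ x \in B, 
    good D r w (nO (nd w st h)) (nX (nd w st h)) B & good D r w (nO (nd w st h)) B (nY (nd w st h))]) /\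
    forall u : bool, exists l, [/\ 0 < l, l < size st, nbn (nd w st l) = x, npar (nd w st l) = h &
      nup (nd w st l) = u /\ x \in (if u then nX (nd w st l) else nY (nd w st l))]].
Proof.
move=> xn Mx; have R : reach w (rsp x P) (rst x P r) (tree r P M x).
  apply: (tree_reach (ltnW xn)).1; split=> [y yx Py|y z yx zx Py Pz]; first by rewrite /rsp Py (ltnW yx).
  by rewrite rst_in // ltnW.
have [h' [B [lb [ub [Ev]]]]] := step_event xn Mx R.
have [Ev' ->] : event w D r (tree r P M x) x h' B lb ub /\
    kids w (rst x P r) (tree r P M x) h' x lb ub = kids w r (tree r P M x) h' x lb ub.
  apply: event_ext Ev => [y /andP[yx Py]|y z /andP[yx Py] /andP[zx Pz]]; last exact: rst_in.
  by rewrite /bl Py (leq_ltn_trans yx xn).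
case: Ev' => hs lf xB [g1 g2 d1 d2] Est.
have [chi C] := dilworth_bl HO HW; have [rr _ _] := HO.
have l1 := decomp_nil d1; have l2 := decomp_nil d2.
have Rx := tree_amb (ltnW xn).
have Ez : size st = size (tree r P M x) + (size lb + size ub) by rewrite /st Est size_cat size_kids.
have Ek : k = size (tree r P M x) + (size lb + (size ub).-1) by rewrite /k /lastn -/st Ez; lia.
have lu : (size ub).-1 < size ub by lia.
have Nk : nd w st k = kid h' x (heir r (nd w (tree r P M x) h') lb) (heir r (nd w (tree r P M x) h') ub) true (nth b0 ub (size ub).-1).
  by rewrite Ek /st Est nd_up.
have Eh : h = h' by rewrite /h Nk.
have Nh : nd w st h' = nd w (tree r P M x) h' by rewrite /st Est nd_old.
have [s0 _] := reach_size Rx.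
have RGC := amb_root xn Mx.
have [_ _ n0] := reach_node HO C RGC.1 RGC.2 w0 Rx hs.
have C0 : B != [::] by case: (B) xB.
split.
- by lia.
- by lia.
- by rewrite Nk.
- by rewrite Eh; lia.
split; first by exists B; rewrite Eh Nh.
case.
  have [_ [c1 _] _ _] := decompP HO C d2 g2 C0; have [b bb xb] := c1 x xB.
  have il : index b ub < size ub by rewrite index_mem.
  exists (size (tree r P M x) + (size lb + index b ub)); rewrite /st Est size_cat size_kids nd_up //= nth_index //.
  by rewrite Eh; split=> //; lia.
have [_ [_ c1] _ _] := decompP HO C d1 g1 n0; have [b bb xb] := c1 x xB.
have il : index b lb < size lb by rewrite index_mem.
exists (size (tree r P M x) + index b lb); rewrite /st Est size_cat size_kids nd_low //= nth_index //.
by rewrite Eh; split=> //; lia.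
Qed.

End Run.
End Strategy.

(** * Colouring the points *)

Section Colour.
Variables (w b : nat) (cq cup cdeg cb : colouring).
Variables (r : rel nat) (P M : pred nat).

Definition top d k := last k [seq a <- ancs d k | ~~ big b d a].
Definition pst x := tree w r P M x.+1.
Definition pd x := dat w (pst x) (rst x P r).
Definition pl x := (size (pst x)).-1.
Definition ph x := par (pd x) (pl x).
Definition isG x (u : bool) l := [&& 0 < l, nbn (nd w (pst x) l) == x, nup (nd w (pst x) l) == u,
  npar (nd w (pst x) l) == ph x & x \in if u then nX (nd w (pst x) l) else nY (nd w (pst x) l)].
Definition gch x u := find (isG x u) (iota 0 (size (pst x))).
(** The side is chosen to have no heir: the upper one if a lower heir exists, the lower one
    otherwise. The node is used only when not both heirs exist. *)
Definition pG x := gch x (hl (pd x) (pl x)).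
Definition heirs x := hl (pd x) (pl x) && hu (pd x) (pl x).
(* Kind 0: the point is coloured inside the topmost small node containing it. Kind 1: its host is big and
   both sides inherit all edges, which forces the host to be complete. Kind 2: it lies in a big child which
   is a super root. *)
Definition pkind x := if ~~ big b (pd x) (ph x) then 0 else if heirs x then 1 else if big b (pd x) (pG x) then 2 else 0.
Definition pnode x := if ~~ big b (pd x) (ph x) then top (pd x) (ph x) else if heirs x then ph x
  else if big b (pd x) (pG x) then pG x else top (pd x) (pG x).
Definition asg I x := [&& M x, P x, pkind x == 0 & pnode x == I].
Definition anchor x := sr (pd x) (if pkind x == 0 then par (pd x) (pnode x) else pnode x).
(** This fails only when the root itself is small; then the inner colouring alone does the work. *)
Definition anchored x := (pkind x != 0) || (pnode x != 0).
Definition pcol x := if anchored x then [:: pkind x; 1] ++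
    (if pkind x == 0 then loc cup cdeg (pd x) (pnode x) else [::]) ++ col b cup cdeg (pd x) (anchor x)
  else [:: 0; 0].
Definition pchn x := if anchored x then chn b cq (pd x) (anchor x) else 0.
Definition psml x := if P x && (pkind x == 0) then cb r (asg (pnode x)) x else 0.
End Colour.

(** * Locality of the point labels *)

Section Locality.
Variables (w b : nat) (cq cup cdeg cb : colouring).
Hypothesis Lb : local cb.
Variables (r r' : rel nat) (P P' M M' : pred nat) (x : nat).
Hypotheses (A : agr x P P' r r') (E : forall y, y <= x -> M y = M' y) (Mx : M x).

Lemma pst_agr y : y <= x -> pst w r P M y = pst w r' P' M' y.
Proof. by move=> yx; apply: (tree_agr w A E). Qed.

Lemma pd_agr y : y <= x -> pd w r P M y = pd w r' P' M' y.
Proof. by move=> yx; rewrite /pd pst_agr // (agr_rst (agrW yx A)). Qed.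

Lemma pG_agr y : y <= x -> pG w r P M y = pG w r' P' M' y /\ ph w r P M y = ph w r' P' M' y.
Proof.
move=> yx; have Eh : ph w r P M y = ph w r' P' M' y by rewrite /ph /pl pd_agr // pst_agr.
by split=> //; rewrite /pG /gch /isG /pl pd_agr // pst_agr // Eh.
Qed.

Lemma pkind_agr y : y <= x -> pkind w b r P M y = pkind w b r' P' M' y /\ pnode w b r P M y = pnode w b r' P' M' y.
Proof.
move=> yx; have [EG Eh] := pG_agr yx.
by rewrite /pkind /pnode /heirs /pl EG Eh pd_agr // pst_agr.
Qed.

Lemma pcol_agr : [/\ pcol w b cup cdeg r P M x = pcol w b cup cdeg r' P' M' x,
  pchn w b cq r P M x = pchn w b cq r' P' M' x & psml w b cb r P M x = psml w b cb r' P' M' x].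
Proof.
have [Ek En] := pkind_agr (leqnn x).
split.
- by rewrite /pcol /anchored /anchor Ek En pd_agr.
- by rewrite /pchn /anchored /anchor Ek En pd_agr.
rewrite /psml Ek En -A.1 //; case: ifP => // /andP[Px k0]; apply: Lb.
  split=> [y yx|y z yx zx /and4P[_ Py _ _] /and4P[_ Pz _ _]]; last exact: A.2.
  by rewrite /asg E // A.1 //; have [-> ->] := pkind_agr yx.
by rewrite /asg Mx Px Ek En k0 eqxx.
Qed.
End Locality.

Section Proper.
Variables (w b q k1 k2 : nat) (cq cup cdeg cb : colouring).
Hypotheses (Lq : local cq) (Lup : local cup) (Ldeg : local cdeg).
Hypothesis Cup : forall n P r, ord (bl n P) r -> wid (bl n P) r (Om w) -> Qcut n P r ->
  cproper n P r (Om w * Om w) (cup r P).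
Hypothesis Cdeg : forall n P r, ord (bl n P) r -> wid (bl n P) r (Om w) -> Qdeg n P r -> cproper n P r 3 (cdeg r P).
Hypothesis Cq : forall n P r, ord (bl n P) r -> wid (bl n P) r q -> cproper n P r k1 (cq r P).
Hypothesis Cb : forall n P r, ord (bl n P) r -> wid (bl n P) r b.-1 -> cproper n P r k2 (cb r P).
Hypotheses (bp : 0 < b) (bq : w <= b * q) (w0 : 0 < w).
Variables (n : nat) (P M : pred nat) (r : rel nat).
Hypotheses (HO : ord (bl n P) r) (HW : wid (bl n P) r w) (DU : dummied w n P M r).
Local Notation D := (bl n P).
Local Notation node_of := (pnode w b r P M).
Local Notation kind_of := (pkind w b r P M).
Local Notation host := (ph w r P M).
Local Notation born := (pl w r P M).
Local Notation stage := (pst w r P M).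
Local Notation view := (pd w r P M).
Local Notation is_anchored := (anchored w b r P M).
Local Notation label := (pcol w b cup cdeg r P M).
Local Notation link := (pchn w b cq r P M).
Local Notation inner := (psml w b cb r P M).
Local Notation chosen := (pG w r P M).
Local Notation child := (gch w r P M).
Variable chi : nat -> nat.
Hypothesis HC : chaincol D r w chi.
Hypothesis RG : good D r w [::] (iota 0 w) (iota w w).
Hypothesis RC : conn r (iota 0 w) (iota w w).
Let rr := let: And3 h _ _ := HO in h.
Let ra := let: And3 _ h _ := HO in h.
Let rt := let: And3 _ _ h := HO in h.

Let st := tree w r P M n.
Local Notation m := (size st).
Local Notation d := (dat w st r).
Let T k := TT w chi st k.
Let px k (i : 'I_w) := qx chi st k i.
Let py k (i : 'I_w) := qy chi st k i.
Let bn k := nbn (nd w st k).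

Let R : reach w D r st. Proof. exact: (tree_amb HO HW DU w0 (leqnn n)). Qed.
Let W : world d m D T px py bn. Proof. exact: (reach_world HO HC RG RC w0 R). Qed.

Definition lies k x := [/\ k < m, D x & exists i, [/\ i \in T k, chi x = val i, r (px k i) x & r x (py k i)]].

Lemma lies_anc a k x : a \in ancs d k -> lies k x -> lies a x.
Proof.
move=> ak [km Dx' [i [iT ci r1 r2]]]; have am := anc_m W km ak; have ia := anc_in W km ak iT.
split=> //; exists i; split=> //.
  by apply: (rt (Dx W am ia) (Dx W km iT) Dx' _ r1); apply: (anc_px W).
by apply: (rt Dx' (Dy W km iT) (Dy W am ia) r2); apply: (anc_py W).
Qed.

Lemma lies_tri k l x y : lies k x -> lies l y -> tri d k l -> r x y.
Proof.
move=> [km Dx' [i [iT _ _ r2]]] [lm Dy' [j [jT _ r3 _]]] t.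
apply: (rt Dx' (Dy W km iT) Dy' r2); apply: (rt (Dy W km iT) (Dx W lm jT) Dy' _ r3).
exact: (tri_le W km lm t).
Qed.

Lemma lies_tri2 k l x y : lies k x -> lies l y -> tri d k l || tri d l k -> r x y || r y x.
Proof. by move=> lx ly /orP[/(lies_tri lx ly)->|/(lies_tri ly lx)->]; rewrite ?orbT. Qed.

Lemma pst_pre x : x < n -> size (stage x) <= m /\
  forall k, k < size (stage x) -> nd w st k = nd w (stage x) k.
Proof.
move=> xn; have [s E] := tree_pre HO HW DU w0 xn (leqnn n); rewrite /st E /pst size_cat.
by split=> [|k kx]; [apply: leq_addr|apply: nd_old].
Qed.

Section Point.
Variable x : nat.
Hypotheses (xn : x < n) (Mx : M x).
Local Notation h := (host x).
Local Notation K := (born x).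
Local Notation dx := (view x).
Local Notation sx := (size (stage x)).

(** The tree seen at time [x] is a prefix of the final one, and the restricted order is faithful on
    the bounds of its nodes. This lets the final values replace those computed on arrival. *)
Lemma pst_dagr : dagr sx.-1 d dx.
Proof.
have [sm E] := pst_pre xn; have [K0 Ks _ _ _] := point_facts HO HW DU w0 xn Mx.
have lt i : i <= sx.-1 -> i < sx by move: Ks; rewrite /lastn -/(stage x); lia.
have Rx : reach w (rsp x P) (rst x P r) (stage x).
  apply: (tree_reach HO HW DU w0 xn).1; split=> [y yx Py|y z yx zx Py Pz]; first by rewrite /rsp Py -ltnS yx.
  by rewrite rst_in.
have Ox := rsp_ord HO xn; have [c Hc] := @dilworth_bl x.+1 P _ _ Ox (rsp_wid HW xn).
have [g0 c0] := rsp_root HO DU w0 xn Mx.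
have sub i y : i < sx -> y \in nX (nd w (stage x) i) ++ nY (nd w (stage x) i) -> rsp x P y.
  move=> il; have [[wX wY _] _ _] := reach_node Ox Hc g0 c0 w0 Rx il.
  by rewrite mem_cat => /orP[]; [apply: wa_r wX|apply: wa_r wY].
split; [split|split; [|split; [|split]]] => [i /lt il|i /lt il|i /lt il|i /lt il|i j /lt il /lt jl y z|i /lt il|i /lt il|i /lt il i0|].
- by rewrite /= E.
- by rewrite /= E.
- by rewrite /= E.
- by rewrite /= E.
- rewrite /= !E // => /(sub i y il) /andP[yx Py] /(sub j z jl) /andP[zx Pz].
  by rewrite rst_in.
- by rewrite /= E.
- by rewrite /= E.
- by apply: (par_lt W) => //; apply: leq_trans sm.
- exact: (par0 W).
Qed.

Lemma pt_host : [/\ h < K, 0 < K, K < sx, K < m & [/\ par d K = h, bn K = x,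
  hl dx K = hl d K, hu dx K = hu d K & lies h x]].
Proof.
have [sm E] := pst_pre xn; have [K0 Ks bK hK [[B [xB g1 g2]] _]] := point_facts HO HW DU w0 xn Mx.
have hs : h < sx by apply: ltn_trans hK Ks.
split=> //; first by apply: leq_trans Ks sm.
have [_ wB _] := g1; have Dx' : D x by apply: wa_r wB xB.
have hm : h < m by apply: leq_trans hs sm.
split; rewrite /bn /= ?E //; split=> //.
have [wX _ _] := g1; have cx : chi x \in map chi (nX (nd w (stage x) h)).
  by rewrite (tracks_eq HC _ wX wB) map_f.
have iT : Ordinal (HC.1 x Dx') \in T h by rewrite inE E.
exists (Ordinal (HC.1 x Dx')); split=> //.
  have [h1 h2] := qxP iT; rewrite E // in h1.
  by apply: (good_le HO HC g1) => //; rewrite h2.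
have [h1 h2] := qyP HO HC RG RC w0 R hm iT; rewrite E // in h1.
by apply: (good_le HO HC g2) => //; rewrite h2.
Qed.

Lemma pt_child u (g := child x u) : [/\ 0 < g, g < sx, g < m, par d g = h & [/\ up d g = u, bn g = x &
  exists i, [/\ i \in T g, chi x = val i, (if u then px else py) g i = x & D x]]].
Proof.
have [sm E] := pst_pre xn; have [_ _ _ _ [_ H]] := point_facts HO HW DU w0 xn Mx.
have [l [l0 ls lb lp [lu lx]]] := H u.
have hG : has (isG w r P M x u) (iota 0 sx).
  apply/hasP; exists l; first by rewrite mem_iota.
  by rewrite /isG l0 lb lp lu !eqxx.
have gs : g < sx by move: hG; rewrite has_find size_iota.
have G5 : isG w r P M x u g by have := nth_find 0 hG; rewrite nth_iota.
move: g gs G5 => g gs /and5P[g0 /eqP gb /eqP gu /eqP gp gx].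
have gm : g < m by apply: leq_trans sm.
split=> //; first by rewrite /= E.
have [g1 _ _] := reach_node HO HC RG RC w0 R gm.
have Dx' : D x.
  by have [w1 w2 _] := g1; rewrite E // in w1 w2; case: (u) gx => gx; [exact: wa_r w1 gx|exact: wa_r w2 gx].
split; rewrite /bn /= ?E //; exists (Ordinal (HC.1 x Dx')).
case: (u) gx => gx.
  by rewrite -E // in gx; have [h1 h2] := qx_eq HO HC RG RC w0 R (i := Ordinal (HC.1 x Dx')) gm gx erefl.
by rewrite -E // in gx; have [h1 h2] := qy_eq HO HC RG RC w0 R (i := Ordinal (HC.1 x Dx')) gm gx erefl.
Qed.

Lemma pt_child_lies u : lies (child x u) x.
Proof.
have [g0 gs gm gp [gu gb [i [iT ci E Dx']]]] := pt_child u.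
split=> //; exists i; split=> //; case: (u) E iT gm => E iT gm.
- by rewrite -[X in r _ X]E; apply: rr; apply: (Dx W gm iT).
- by rewrite -[X in r _ X]E; apply: (pxy W).
- by rewrite -[X in r X _]E; apply: (pxy W).
- by rewrite -[X in r X _]E; apply: rr; apply: (Dy W gm iT).
Qed.

End Point.

Lemma big_T k : k < m -> big b d k = (b <= #|T k|).
Proof. by move=> km; rewrite /big (sizeX W km). Qed.

Lemma big_anc a k : k < m -> a \in ancs d k -> big b d k -> big b d a.
Proof.
move=> km ak; rewrite (big_T km) (big_T (anc_m W km ak)) => h; apply: leq_trans h (subset_leq_card _).
exact: (anc_T W km ak).
Qed.

Lemma small_sr k : k < m -> 0 < k -> ~~ big b d k -> big b d (par d k) -> sr d k = k.
Proof.
move=> km k0 nb bp'; rewrite (srE W km k0); case: eqP => // E.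
have e := e_edges W km (anc_par W km) (esym E).
move: bp'; rewrite big_T; last exact: (parm W km).
by rewrite -(edges_T W km (parm W km) e) -big_T // (negbTE nb).
Qed.

Lemma top_spec k (I := top b d k) : k < m -> ~~ big b d k ->
  [/\ I < m, I \in ancs d k, ~~ big b d I & I = 0 \/ [/\ 0 < I, big b d (par d I) & sr d I = I]].
Proof.
rewrite {}/I => km; move: k km; apply: (anc_ind W) => [|l lm l0 IH] nb.
  by rewrite /top ancs0 /= nb /=; split=> //; [apply: (m0 W)|left].
have pm := parm W lm.
have -> : top b d l = last l [seq a <- ancs d (par d l) | ~~ big b d a] by rewrite /top (ancsE W lm l0) /= nb.
rewrite (ancsE W lm l0).
case bl' : (big b d (par d l)).
  have -> : [seq a <- ancs d (par d l) | ~~ big b d a] = [::].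
    rewrite (eq_in_filter (a2 := pred0)) ?filter_pred0 // => a ap /=.
    by rewrite (big_anc pm ap bl').
  by split=> //=; [rewrite mem_head|right; split=> //; apply: small_sr].
have [|h1 h2 h3 h4] := IH; first by rewrite bl'.
have -> : last l [seq a <- ancs d (par d l) | ~~ big b d a] = top b d (par d l).
  rewrite /top; have : par d l \in [seq a <- ancs d (par d l) | ~~ big b d a].
    by rewrite mem_filter bl' (anc_refl d).
  by case: (filter _ _).
by split=> //; rewrite inE h2 orbT.
Qed.

Lemma top_cong e k0 k : dagr k0 d e -> k <= k0 -> top b d k = top b e k.
Proof.
move=> A kk; rewrite /top -(ancs_cong A kk); congr last; apply: eq_in_filter => a ak.
by rewrite (big_cong b A) //; apply: (ancs_le0 A kk ak).
Qed.

Lemma pnode_spec x (I := node_of x) (kd := kind_of x) : x < n -> M x ->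
  [/\ I < size (stage x), lies I x, kd < 3,
    kd = 0 -> ~~ big b d I /\ (I = 0 \/ [/\ 0 < I, big b d (par d I) & sr d I = I]) &
    (kd = 1 -> I = host x /\ [/\ big b d I, hl d (born x) & hu d (born x)]) /\
    (kd = 2 -> [/\ 0 < I, big b d I, sr d I = I & bn I = x])].
Proof.
move=> xn Mx; have A := pst_dagr xn Mx; have [sm E] := pst_pre xn.
have [hK K0 Ks Km [pK bK hlK huK lh]] := pt_host xn Mx.
have hs : host x < size (stage x) by lia.
have hm : host x < m by lia.
have [g0 gs gm gp [gu gb _]] := pt_child xn Mx (hl (view x) (born x)).
have lg := pt_child_lies xn Mx (hl (view x) (born x)).
rewrite {}/I {}/kd /pnode /pkind /heirs -(big_cong b A); last by lia.
rewrite -/(chosen x) in g0 gs gm gp gu gb lg.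
rewrite -(big_cong b A) ?(top_cong A); try by lia.
case bh : (big b d (host x)) => /=; last first.
  have [h1 h2 h3 h4] := top_spec hm (negbT bh).
  have le := anc_le W hm h2; have le2 := lies_anc h2 lh.
  rewrite -(top_cong A) //; last by lia.
  by split=> //; lia.
case hh : (_ && _).
  have hh' : hl (view x) (born x) && hu (view x) (born x) := hh.
  by rewrite hlK huK in hh'; case/andP: hh' => h1 h2.
have {}hh : hl (view x) (born x) && hu (view x) (born x) = false := hh.
case bg : (big b d (chosen x)).
  split=> //; split=> // _; split=> //.
  (* Had the chosen child kept all edges, it would be an heir on the side that has none. *)
  rewrite (srE W gm g0); case: eqP => // e; exfalso.
  rewrite gp in e.
  case hlv : (hl d (born x)); rewrite hlK hlv in gu hh.
    rewrite andTb huK in hh; have /negP[] := negbT hh; apply/(huH W Km K0).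
    by exists (chosen x); split; rewrite ?gu ?gp ?pK ?e.
  have /negP[] := negbT hlv; apply/(hlH W Km K0).
  by exists (chosen x); split; rewrite ?gu ?gp ?pK ?e.
have [h1 h2 h3 h4] := top_spec gm (negbT bg).
have le := anc_le W gm h2; have le2 := lies_anc h2 lg.
rewrite -(top_cong A) //; last by lia.
by split=> //; lia.
Qed.


Lemma pcol_final x (I := node_of x) (kd := kind_of x) (S := sr d (if kd == 0 then par d I else I)) :
  x < n -> M x -> is_anchored x ->
  [/\ S < m, sr d S = S, big b d S & lies S x] /\
  label x = [:: kd; 1] ++ (if kd == 0 then loc cup cdeg d I else [::]) ++ col b cup cdeg d S /\
  link x = chn b cq d S.
Proof.
move=> xn Mx an; have A := pst_dagr xn Mx; have [sm _] := pst_pre xn.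
have [Is lI kd3 kd0 [kd1 kd2]] := pnode_spec xn Mx.
rewrite -/I -/kd in Is lI kd3 kd0 kd1 kd2.
have Ik : I <= (size (stage x)).-1 by lia.
have Im : I < m by apply: leq_trans Is sm.
have pI : par d I = par (view x) I by have [[h _ _ _ _] _] := A; apply: h.
have k0I : kd = 0 -> [/\ 0 < I, big b d (par d I) & sr d I = I].
  by move=> k0; have [_ []] := kd0 k0 => // I0; move: an; rewrite /anchored -/kd -/I k0 I0.
pose A0 := if kd == 0 then par d I else I.
have [A1 A2 A3 A4] : [/\ A0 \in ancs d I, A0 <= (size (stage x)).-1, A0 < m & big b d A0].
  rewrite /A0; case: eqP => k0; last first.
    split=> //; first exact: anc_refl.
    have [e1|e1] := eqVneq kd 1; first by have [_ []] := kd1 e1.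
    by have [|] := kd2; first by lia.
  have [I0 h1 h2] := k0I k0; split=> //; first exact: (anc_par W).
    by have := par_lt W Im I0; lia.
  exact: (parm W).
have ES : S = sr d A0 by [].
have Sm : S < m by apply: (sr_m W).
have Sa := sr_anc W A3.
have sS : sr d S = S by apply: (sr_idem W).
have bS : big b d S by apply: big_anc A4.
have Sk : S <= (size (stage x)).-1 by have := anc_le W A3 Sa; rewrite -ES; lia.
have Eanc : anchor w b r P M x = S.
  by rewrite /anchor -/kd -/I -pI -/A0 -(sr_cong A).
have hbs : bsr b d S || ~~ hasbase d S by rewrite /bsr sS eqxx bS /=; case: (hasbase d S).
split.
  by split=> //; apply: lies_anc Sa _; apply: lies_anc A1 _.
rewrite /pcol /pchn an Eanc -/kd -/I -(chn_cong Lq A Sk hbs) -(col_cong Lup Ldeg A Sk hbs).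
  split=> //; congr (_ ++ (_ ++ _)); case: eqP => // k0; have [I0 h1 h2] := k0I k0.
  by rewrite (loc_cong Lup Ldeg A Ik h2 I0).
move=> hb; have := search_spec W bp bq Sm sS; rewrite hb => -[[_ h1 h2 _ _] _]; by split.
Qed.

(** Points assigned to [I] lie on its fewer than [b] tracks, so they form a poset of width at most
    [b - 1]. *)
Lemma asg_proper I x y : asg w b r P M I x -> asg w b r P M I y -> x < n -> y < n -> 
  cb r (asg w b r P M I) x < k2 /\ (cb r (asg w b r P M I) x = cb r (asg w b r P M I) y -> r x y || r y x).
Proof.
move=> ax ay xn yn.
have aP z : z < n -> asg w b r P M I z -> [/\ D z, lies I z & ~~ big b d I].
  move=> zn /and4P[Mz Pz /eqP kz /eqP nz]; have [_ lI _ kd0 _] := pnode_spec zn Mz.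
  by rewrite nz in lI kd0; have [h _] := kd0 kz; split=> //; rewrite /bl zn.
have [_ lx nbI] := aP x xn ax; have Im : I < m by case: lx.
have sub z : bl n (asg w b r P M I) z -> D z by case/andP=> zn /(aP z zn)[].
have Wb : wid (bl n (asg w b r P M I)) r b.-1.
  move=> s As sP; have u := anti_chi_uniq HC As (fun z zs => sub z (sP z zs)).
  have lt : #|T I| <= b.-1 by move: nbI; rewrite (big_T Im); lia.
  apply: leq_trans lt; rewrite cardE -(size_map val) -(size_map chi); apply: uniq_leq_size => // i /mapP[z /sP/andP[zn /(aP z zn)[_ [_ _ [j [jT -> _ _]]] _]] ->].
  by apply: map_f; rewrite mem_enum.
have [h1 h2] := Cb (ord_sub sub HO) Wb; split; first exact: h1.
exact: h2.
Qed.

(** Both heirs occupy all tracks of the host, so [x] is an upper bound of the lower heir and a lower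
    bound of the upper heir, and both heirs inherit the complete graph. *)
Lemma kk_complete x (h := host x) : x < n -> M x -> kind_of x = 1 ->
  forall i, i \in T h -> r (px h i) x /\ r x (py h i).
Proof.
move=> xn Mx e1; have [hK K0 Ks Km [pK bK hlK huK lh]] := pt_host xn Mx.
have [_ _ _ _ [/(_ e1)[_ [_ hlv huv]] _]] := pnode_spec xn Mx.
have [g [gm g0 pg ug eg]] := (hlH W Km K0).1 hlv.
have [g' [gm' g0' pg' ug' eg']] := (huH W Km K0).1 huv.
rewrite pK -/h in pg eg pg' eg'.
have hm : h < m by lia.
have F : full d T px py h by apply: (full_heirs W hm gm gm' g0 g0' pg pg' ug ug').
have Eg : edges d T px py g = edges d T px py h by apply: (e_edges W gm) => //; rewrite -pg; apply: (anc_par W).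
have Eg' : edges d T px py g' = edges d T px py h by apply: (e_edges W gm') => //; rewrite -pg'; apply: (anc_par W).
have Fg := full_edges W hm gm (esym Eg) F; have Fg' := full_edges W hm gm' (esym Eg') F.
have Tg := edges_T W gm hm Eg; have Tg' := edges_T W gm' hm Eg'.
have sub c u : c < m -> 0 < c -> par d c = h -> T c = T h -> up d c = u ->
    exists i, i \in T h /\ (if u then px else py) c i = x.
  move=> cm c0 pc Tc uc; have [l0 _ lm lp [lu _ [i [iT _ Ei _]]]] := pt_child xn Mx u.
  exists i; have ih : i \in T h by rewrite -/h in lp; rewrite -lp; apply: (anc_in W lm (anc_par W lm)).
  split=> //; suff <- : child x u = c by [].
  by apply: (sibH W lm cm l0 c0 _ _ iT); rewrite ?Tc // ?lp ?pc // lu uc.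
have [i0 [i0T E0]] := sub g false gm g0 pg Tg (negbTE ug).
have [j0 [j0T E0']] := sub g' true gm' g0' pg' Tg' ug'.
move=> i ih; split.
  have ig : i \in T g by rewrite Tg.
  have i0g : i0 \in T g by rewrite Tg.
  by have [_ H _] := lowH W gm g0 ug; rewrite -E0 -pg -H //; apply: Fg.
have ig : i \in T g' by rewrite Tg'.
have j0g : j0 \in T g' by rewrite Tg'.
by have [_ H _] := upH W gm' g0' ug'; rewrite -E0' -pg' -H //; apply: Fg'.
Qed.

(** Hosts in one family have the same tracks. If they are separated, a common track connects the two
    points through [kk_complete]. If one is nested in the other, the outer point bounds the child
    containing the inner host. Equal hosts mean equal arrival times. *)
Lemma kk_proper x y (h := host x) (h' := host y) : x < n -> y < n -> M x -> M y ->
  kind_of x = 1 -> kind_of y = 1 -> sr d h = sr d h' -> r x y || r y x.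
Proof.
move=> xn yn Mx My kx ky E.
have [hK K0 Ks Km [pK bK _ _ lh]] := pt_host xn Mx.
have [hK' K0' Ks' Km' [pK' bK' _ _ lh']] := pt_host yn My.
rewrite -/h -/h' in hK hK' pK pK' lh lh'.
have Cx := kk_complete xn Mx kx; have Cy := kk_complete yn My ky; rewrite -/h -/h' in Cx Cy.
have hm : h < m by lia.
have hm' : h' < m by lia.
have Th : T h = T h' by have [-> _] := sr_T W hm erefl; have [-> _] := sr_T W hm' erefl; rewrite E.
have nest z t (u := host z) (v := host t) : z < n -> t < n -> M z -> M t ->
    u < m -> v < m -> T u = T v -> u \in ancs d v -> u != v ->
    (forall i, i \in T v -> r (px v i) t /\ r t (py v i)) -> r z t || r t z.
  move=> zn tn Mz Mt um vm Tuv uv ne Ct.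
  have [g [g0 gm pg gv]] := anc_child W vm uv ne.
  have [l0 _ lm lp [lu lb [i [iT _ Ei Dz]]]] := pt_child zn Mz (up d g).
  have iu : i \in T u by rewrite -/u in lp; rewrite -lp; apply: (anc_in W lm (anc_par W lm)).
  have iv : i \in T v by rewrite -Tuv.
  have ig : i \in T g by apply: (anc_in W vm gv).
  have El : child z (up d g) = g by apply: (sibH W lm gm l0 g0 _ _ iT ig) => //; rewrite lp pg.
  have [r1 r2] := Ct i iv; have Dt : D t by rewrite /bl tn (du_mark DU tn Mt).1.
  rewrite El in Ei; case: (up d g) Ei => <-; apply/orP; [left|right].
    by apply: (rt (Dx W gm ig) (Dx W vm iv) Dt _ r1); apply: (anc_px W).
  by apply: (rt Dt (Dy W vm iv) (Dy W gm ig) r2); apply: (anc_py W).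
have [_ Dx' [i [iT _ _ _]]] := lh; have iT' : i \in T h' by rewrite -Th.
have [_ Dy' _] := lh'.
have [ne|ne] := eqVneq h h'.
  have := bn_sib W Km Km' K0 K0'; rewrite pK pK' => /(_ ne); rewrite bK bK' => ->; by rewrite rr.
case: (sep W hm hm' iT iT') => H.
- exact: (nest x y).
- by rewrite orbC; apply: (nest y x) => //; rewrite eq_sym.
- apply/orP; left; apply: (rt Dx' (Dy W hm iT) Dy' (Cx i iT).2).
  apply: (rt (Dy W hm iT) (Dx W hm' iT') Dy' _ (Cy i iT').1).
  exact: (vb_le W).
apply/orP; right; apply: (rt Dy' (Dy W hm' iT') Dx' (Cy i iT').2).
apply: (rt (Dy W hm' iT') (Dx W hm iT) Dx' _ (Cx i iT).1).
exact: (vb_le W).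
Qed.

(** Different anchors are handled by [col_proper]. With a common anchor, kind 0 is settled by [loc]
    or, in the same node, by the inner colouring; kind 1 by [kk_proper]; kind 2 forces the same
    birth time, hence [x = y]. *)
Lemma points_proper x y : x < n -> y < n -> M x -> M y ->
  label x = label y -> link x = link y ->
  inner x = inner y -> r x y || r y x.
Proof.
move=> xn yn Mx My Ec Eh Es.
have Px := (du_mark DU xn Mx).1; have Py := (du_mark DU yn My).1.
have same : kind_of x = 0 -> kind_of y = 0 -> node_of x = node_of y -> r x y || r y x.
  move=> kx ky En; move: Es; rewrite /psml Px Py kx ky eqxx /= En; apply: (asg_proper _ _ xn yn).2.
    by rewrite /asg Mx Px kx En !eqxx.
  by rewrite /asg My Py ky !eqxx.
case ax : (is_anchored x); case ay : (is_anchored y).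
- have [[Sm sS bS lS] [F1 F2]] := pcol_final xn Mx ax.
  have [[Sm' sS' bS' lS'] [F1' F2']] := pcol_final yn My ay.
  rewrite {}F1 {}F1' in Ec; rewrite {}F2 {}F2' in Eh.
  have [Is lI kd3 kd0 [kd1 kd2]] := pnode_spec xn Mx.
  have [Is' lI' kd3' kd0' [kd1' kd2']] := pnode_spec yn My.
  have [sm _] := pst_pre xn; have [sm' _] := pst_pre yn.
  have Im := leq_trans Is sm; have Im' := leq_trans Is' sm'.
  have Ek : kind_of x = kind_of y by case: Ec.
  move: ax ay; rewrite /anchored -Ek in kd0' kd1' kd2' sS' bS' lS' Sm' Ec Eh * => ax ay.
  have El : kind_of x = 0 -> loc cup cdeg d (node_of x) = loc cup cdeg d (node_of y).
    by move=> k0; move: Ec; rewrite k0 /= /loc => -[-> -> -> _].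
  have Ecol : col b cup cdeg d (sr d (if kind_of x == 0 then par d (node_of x) else node_of x)) =
              col b cup cdeg d (sr d (if kind_of x == 0 then par d (node_of y) else node_of y)).
    by move: Ec; case: (kind_of x == 0); rewrite /loc /= => -[].
  have [SE|Sne] := eqVneq (sr d (if kind_of x == 0 then par d (node_of x) else node_of x))
              (sr d (if kind_of x == 0 then par d (node_of y) else node_of y)); last first.
    apply: (lies_tri2 lS lS'); apply: (col_proper W Cup Cdeg Cq bp bq) => //.
  have [k0|k0] := eqVneq (kind_of x) 0.
    have [IE|Ine] := eqVneq (node_of x) (node_of y); first by apply: same => //; rewrite -Ek.
    rewrite k0 /= in ax ay SE.
    have [_ []] := kd0 k0 => [I0|[I0 _ sI]]; first by rewrite I0 in ax.
    have [_ []] := kd0' k0 => [I0'|[I0' _ sI']]; first by rewrite I0' in ay.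
    apply: (lies_tri2 lI lI'); apply: (loc_proper W Cup Cdeg) => //; exact: El.
  have [e1|e1] := eqVneq (kind_of x) 1.
    have [hx _] := kd1 e1; have [hy _] := kd1' e1; rewrite e1 /= hx hy in SE.
    by apply: kk_proper => //; rewrite -Ek.
  have k2' : kind_of x = 2 by lia.
  have [_ _ sI bI] := kd2 k2'; have [_ _ sI' bI'] := kd2' k2'.
  by rewrite k2' /= sI sI' in SE; rewrite SE bI' in bI; rewrite bI rr // /bl xn.
- by move: Ec; have [_ [-> _]] := pcol_final xn Mx ax; rewrite /pcol ay.
- by move: Ec; have [_ [-> _]] := pcol_final yn My ay; rewrite /pcol ax.
move: ax ay; rewrite /anchored => /negbT; rewrite negb_or !negbK => /andP[/eqP kx /eqP nx] /negbT.
by rewrite negb_or !negbK => /andP[/eqP ky /eqP ny]; apply: same; rewrite ?nx ?ny.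
Qed.

Lemma points_bound x : 0 < k1 -> 0 < k2 -> x < n -> M x ->
  [/\ size (label x) <= 16, all (fun a => a < Bd w) (label x),
     link x < k1 & inner x < k2].
Proof.
move=> k1p k2p xn Mx; have Px := (du_mark DU xn Mx).1.
have s2 : inner x < k2.
  rewrite /psml Px /=; case: eqP => // k0.
  by apply: (asg_proper _ _ xn xn).1; rewrite /asg Mx Px k0 !eqxx.
case ax : (is_anchored x); last by rewrite /pcol /pchn ax /Bd; split=> //=; rewrite !addnS.
have [[Sm sS bS lS] [-> ->]] := pcol_final xn Mx ax.
have [Is lI kd3 kd0 _] := pnode_spec xn Mx; have [sm _] := pst_pre xn; have Im := leq_trans Is sm.
have [c1 c2] := col_bound W Cup Cdeg bp bq Sm sS bS.
have B3 : 3 < Bd w by rewrite /Bd; lia.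
split=> //; last exact: (chn_bound W Cq bp bq Sm sS bS).
  rewrite !size_cat; apply: (@leq_trans (2 + (3 + 11))) => //; rewrite leq_add2l; apply: leq_add c1.
  by case: (_ == 0).
rewrite !all_cat c2 andbT; apply/andP; split; first by rewrite /= andbT; apply/andP; split; lia.
case: eqP => // k0; have [I0 sI] : 0 < node_of x /\ sr d (node_of x) = node_of x.
  have [_ [I0|[]]] := kd0 k0 => //; by move: ax; rewrite /anchored k0 I0.
have l1 := lraw_bound W Cup Cdeg Im I0 sI; have l2 := sidx_bound W Im; have l3 := kind_lt d (node_of x).
have ww : w <= w * w by case: (w) => // a; rewrite leq_pmulr.
rewrite /loc /= andbT; do !(apply/andP; split) => //; rewrite /Bd.
- by lia.
- by lia.
by lia.
Qed.

End Proper.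

(** * The recursion *)

(** Digits are shifted to be nonzero, so lists of different lengths have different codes. *)
Definition enc B (s : seq nat) := foldr (fun a c => a.+1 + B.+1 * c) 0 s.

Lemma enc_lt B s n : all (fun a => a < B) s -> size s <= n -> enc B s < B.+1 ^ n.
Proof.
elim: s n => [|a s IH] n /=; first by rewrite expn_gt0.
move=> /andP[aB sB]; case: n => // n /(IH n sB); rewrite expnS => h.
apply: (@leq_trans (B.+1 + B.+1 * enc B s)); first by rewrite -addSn leq_add2r.
by rewrite -mulnS leq_mul2l h orbT.
Qed.

Lemma digits B a a' c c' : a < B -> a' < B -> a + B * c = a' + B * c' -> a = a' /\ c = c'.
Proof.
move=> aB aB' E; have B0 : 0 < B by lia.
have Ec : c = c'.
  have := congr1 (divn^~ B) E; by rewrite !(addnC _ (B * _)) !(mulnC B) !divnMDl // !divn_small // !addn0.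
by split=> //; move: E; rewrite Ec => /addIn.
Qed.

Lemma enc_inj B s t : all (fun a => a < B) s -> all (fun a => a < B) t -> enc B s = enc B t -> s = t.
Proof.
elim: s t => [|a s IH] [|a' t] //= /andP[aB sB] /andP[aB' tB] E.
by have [||[->] /IH->] := @digits B.+1 a.+1 a'.+1 _ _ _ _ E.
Qed.

(** Labels have at most 16 entries below [Bd w], by [points_bound]. *)
Definition NN w := (Bd w).+1 ^ 16.

Definition pcode w b k1 (cq cup cdeg cb : colouring) (r : rel nat) (P M : pred nat) x :=
  enc (Bd w) (pcol w b cup cdeg r P M x) + NN w * (pchn w b cq r P M x + k1 * psml w b cb r P M x).

(** * Adding a bottom and a top antichain by renumbering *)

Section Shift.
Variable w : nat.
Definition shP (P : pred nat) : pred nat := fun y => (y < 2 * w) || P (y - 2 * w).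
Definition shM (M : pred nat) : pred nat := fun y => (2 * w <= y) && M (y - 2 * w).
Definition shr (r : rel nat) : rel nat := fun y z =>
  if y < w then (if z < w then y == z else true)
  else if z < w then false
  else if y < 2 * w then y == z
  else if z < 2 * w then true
  else r (y - 2 * w) (z - 2 * w).

Lemma sh_agr x P P' r r' : agr x P P' r r' -> agr (x + 2 * w) (shP P) (shP P') (shr r) (shr r').
Proof.
move=> [A1 A2]; split=> [y yx|y z yx zx]; rewrite /shP /shr.
  by case: ltnP => //= yw; apply: A1; lia.
case: (ltnP y (2 * w)) => //= yw; case: (ltnP z (2 * w)) => //= zw Py Pz.
do 2!case: ifP => // _; apply: A2 => //; lia.
Qed.

Variables (n : nat) (P M : pred nat) (r : rel nat).
Hypotheses (HO : ord (bl n P) r) (HW : wid (bl n P) r w).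

Let D' := bl (n + 2 * w) (shP P).

Lemma sh_in y : D' y -> 2 * w <= y -> bl n P (y - 2 * w).
Proof. by case/andP=> yn; rewrite /shP /bl => + yw; rewrite ltnNge yw /= => ->; rewrite andbT; lia. Qed.

Lemma sh_ord : ord D' (shr r).
Proof.
have [rr ra rt] := HO; split=> [x Dx|x y Dx Dy|y x z Dx Dy Dz]; rewrite /shr.
- case: ltnP => xw; rewrite ?eqxx //; case: ltnP => xw'; rewrite ?eqxx //.
  by apply: rr; apply: sh_in.
- case: (ltnP x w) => xw; case: (ltnP y w) => yw //; first by move/eqP.
  case: (ltnP x (2 * w)) => xw'; first by move/eqP.
  case: (ltnP y (2 * w)) => yw' h1; first by move/eqP.
  move=> h2; have := ra _ _ (sh_in Dx xw') (sh_in Dy yw') h1 h2; lia.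
case: (ltnP x w) => xw; case: (ltnP y w) => yw; case: (ltnP z w) => zw //.
- by move/eqP->.
case: (ltnP x (2 * w)) => xw'.
  by move/eqP <-; rewrite xw'.
case: (ltnP y (2 * w)) => yw'; case: (ltnP z (2 * w)) => zw' //.
  by move=> _ /eqP E; lia.
apply: rt; exact: sh_in.
Qed.

Lemma sh_wid : wid D' (shr r) w.
Proof.
move=> s [us A] sD.
have [/hasP[a as' aw]|/hasPn nb] := boolP (has (fun y => y < w) s).
  rewrite -(size_iota 0 w); apply: uniq_leq_size => // y ys; rewrite mem_iota add0n leq0n andTb.
  apply: contraT => yw; have := A a y as' ys; rewrite /shr aw (negbTE yw) => /(_ isT) E; by rewrite -E aw in yw.
have [/hasP[a ta aw]|/hasPn nt] := boolP (has (fun y => y < 2 * w) s).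
  rewrite -(size_iota w w); apply: uniq_leq_size => // y ys; rewrite mem_iota.
  have yw := nb y ys; have aw' := nb a ta.
  apply: contraT => yw'; have := A y a ys ta; rewrite /shr (negbTE yw) (negbTE aw') aw.
  case: ltnP => h; first by lia.
  by move=> /(_ isT) E; lia.
rewrite -(size_map (subn^~ (2 * w))); apply: HW.
  split.
    rewrite map_inj_in_uniq // => x y /nt xw /nt yw E; by lia.
  move=> _ _ /mapP[x xs ->] /mapP[y ys ->] h; congr (_ - _); apply: A => //.
  by rewrite /shr (negbTE (nb x xs)) (negbTE (nb y ys)) (negbTE (nt x xs)) (negbTE (nt y ys)).
move=> _ /mapP[x xs ->]; apply: sh_in; first exact: sD.
by have := nt x xs; rewrite -leqNgt.
Qed.

Lemma sh_dummied : (forall x, x < n -> M x -> P x /\ exists s, [/\ anti r s, x \in s, size s = w &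
       forall y, y \in s -> y <= x /\ P y]) -> dummied w (n + 2 * w) (shP P) (shM M) (shr r).
Proof.
move=> HM; split.
- by move=> i iw; rewrite /shP iw.
- by move=> i iw; rewrite /shM leqNgt iw.
- by move=> i j iw jw; rewrite /shr iw jw.
- by move=> i j iw jw; rewrite /shr !ltnNge; case/andP: iw => -> iw; case/andP: jw => -> jw; rewrite /= -ltnNge iw.
- by move=> i y iw /andP[yw yn] _; rewrite /shr iw ltnNge yw.
- move=> i y /andP[wi iw] yn h _; rewrite /shr (ltnNge i) wi /=.
  case: (ltnP y w) h => //= yw h; by rewrite ltnNge h iw.
move=> x xn /andP[wx Mx]; have [|Px [s [[us A] xs sz sP]]] := HM (x - 2 * w) _ Mx; first by lia.
split; first by rewrite /shP Px orbT.
exists [seq y + 2 * w | y <- s]; split.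
- split; first by rewrite map_inj_uniq //; apply: addIn.
  move=> _ _ /mapP[y ys ->] /mapP[z zs ->]; rewrite /shr !addnK.
  have aux t : (t + 2 * w < w) = false by lia.
  have aux2 t : (t + 2 * w < 2 * w) = false by lia.
  by rewrite !aux !aux2 => /A->.
- by apply/mapP; exists (x - 2 * w); rewrite // subnK.
- by rewrite size_map.
by move=> _ /mapP[y /sP[yx Py] ->]; rewrite /shP addnK Py orbT; split=> //; lia.
Qed.

End Shift.

Lemma marked_game w b q k1 k2 : 0 < b -> 0 < w -> w <= b * q -> 0 < k1 -> 0 < k2 -> onl q k1 -> onl b.-1 k2 ->
  monl (fun _ _ _ => True) w (NN w * k1 * k2).
Proof.
move=> bp w0 bq k1p k2p [cq [Lq Cq']] [cb [Lb Cb']].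
have [cup [Lup Cup]] := cut_online (Om w); have [cdeg [Ldeg Cdeg]] := deg_online (Om w).
have Cq n P r : ord (bl n P) r -> wid (bl n P) r q -> cproper n P r k1 (cq r P) by move=> O W; apply: Cq'.
have Cb n P r : ord (bl n P) r -> wid (bl n P) r b.-1 -> cproper n P r k2 (cb r P) by move=> O W; apply: Cb'.
exists (fun r P M x => pcode w b k1 cq cup cdeg cb (shr w r) (shP w P) (shM w M) (x + 2 * w)); split.
  move=> r r' P P' M M' x A E Mx.
  have [] := @pcol_agr w b cq cup cdeg cb Lb _ _ _ _ (shM w M) (shM w M') _ (sh_agr w A).
  - by move=> y yx; rewrite /shM; case: leqP => //= yw; apply: E; lia.
  - by rewrite /shM leq_addl addnK.
  by rewrite /pcode => -> -> ->.
move=> n P M r HO HW _ HM.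
have DU := sh_dummied HM; have O := sh_ord w HO; have W := sh_wid HW.
have [chi HC] := dilworth_bl O W.
have mk x : x < n -> M x -> x + 2 * w < n + 2 * w /\ shM w M (x + 2 * w).
  by move=> xn Mx; rewrite /shM leq_addl addnK ltn_add2r.
have bnd x : x < n -> M x -> [/\ size (pcol w b cup cdeg (shr w r) (shP w P) (shM w M) (x + 2 * w)) <= 16,
    all (fun a => a < Bd w) (pcol w b cup cdeg (shr w r) (shP w P) (shM w M) (x + 2 * w)),
    pchn w b cq (shr w r) (shP w P) (shM w M) (x + 2 * w) < k1 &
    psml w b cb (shr w r) (shP w P) (shM w M) (x + 2 * w) < k2].
  move=> xn Mx; have [xn' Mx'] := mk x xn Mx; have [RG RC] := amb_root O DU w0 xn' Mx'.
  exact: (points_bound Lq Lup Ldeg Cup Cdeg Cq Cb bp bq w0 O W DU HC RG RC k1p k2p xn' Mx').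
have encb x (xn : x < n) (Mx : M x) : enc (Bd w) (pcol w b cup cdeg (shr w r) (shP w P) (shM w M) (x + 2 * w)) < NN w.
  by have [h1 h2 _ _] := bnd x xn Mx; apply: enc_lt.
split=> [x xn Mx|x y xn yn Mx My].
  have [_ _ h3 h4] := bnd x xn Mx; have h5 := encb x xn Mx; rewrite /pcode.
  set e := enc _ _ in h5 *; set a := pchn _ _ _ _ _ _ _ in h3 *; set s := psml _ _ _ _ _ _ _ in h4 *.
  apply: (@leq_trans (NN w * (a + k1 * s).+1)); first by rewrite mulnS; lia.
  rewrite -mulnA leq_mul2l; apply/orP; right.
  by apply: (@leq_trans (k1 * s.+1)); [rewrite mulnS; lia|rewrite leq_mul2l h4 orbT].
rewrite /pcode => E; have [_ b1 c1 s1] := bnd x xn Mx; have [_ b2 c2 s2] := bnd y yn My.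
have [E1 E2] := digits (encb x xn Mx) (encb y yn My) E.
have [E3 E4] := digits c1 c2 E2.
have [xn' Mx'] := mk x xn Mx; have [yn' My'] := mk y yn My; have [RG RC] := amb_root O DU w0 xn' Mx'.
have := points_proper Lq Lup Ldeg Cup Cdeg Cq Cb bp bq w0 O W DU HC RG RC xn' yn' Mx' My' (enc_inj b1 b2 E1) E3 E4.
have aux t : (t + 2 * w < w) = false by lia.
have aux2 t : (t + 2 * w < 2 * w) = false by lia.
by rewrite /shr !aux !aux2 !addnK.
Qed.

Lemma Bd_mono v w : v <= w -> Bd v <= Bd w.
Proof.
move=> vw; rewrite /Bd /Om !leq_add // ?leq_mul // ?leq_mul //.
Qed.

(** Level [i] is played in width [i] with the same [b] and [q]: only [i <= b * q] matters there, and
    [Bd] is monotone in the width. *)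
Lemma onl_step b q k1 k2 : 0 < b -> 0 < k1 -> 0 < k2 -> onl q k1 -> onl b.-1 k2 ->
  onl (b * q) (b * q * (NN (b * q) * k1 * k2)).
Proof.
move=> bp k1p k2p Hq Hb; apply: levels => // i i0 iw.
have [c [Lc C]] := marked_game bp i0 iw k1p k2p Hq Hb.
exists c; split=> // n P M r O W _ HM; have [h1 h2] := C n P M r O W I HM.
split=> // x xn Mx; apply: leq_trans (h1 x xn Mx) _.
by rewrite !leq_mul2r leq_exp2r // ltnS Bd_mono ?orbT.
Qed.

(* Numerical estimates and passage to on-line algorithms *)
From Stdlib Require Import Reals Lra.
From mathcomp Require Import ssrnat.

Lemma onl_one : onl 1 1.
Proof.
exists (fun _ _ _ => 0); split=> // n P r [rr _ _] W _; split=> // x y xn yn Px Py _.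
have Dx : bl n P x by rewrite /bl xn.
have Dy : bl n P y by rewrite /bl yn.
apply: contraT; rewrite negb_or => /andP[n1 n2].
have : size [:: x; y] <= 1.
  apply: W => [|z]; last by rewrite !inE => /orP[] /eqP->.
  split=> [|a c]; first by rewrite /= inE andbT; apply: contraNneq n1 => ->; apply: rr.
  rewrite !inE => /orP[] /eqP-> /orP[] /eqP-> //; first by rewrite (negbTE n1).
  by rewrite (negbTE n2).
by [].
Qed.

(** From [Om w <= w ^ 4] one gets [Bd w + 1 <= w ^ 9]; sixteen digits and one more factor [w] give
    [145 = 9 * 16 + 1]. *)
Lemma NN_bound w : 1 < w -> w * NN w <= w ^ 145.
Proof.
move=> w1; rewrite (expnS w 144) leq_mul2l; apply/orP; right.
rewrite /NN (_ : 144 = 9 * 16) // expnM leq_exp2r // /Bd.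
have e2 : 4 <= w ^ 2 by rewrite (_ : 4 = 2 ^ 2) // leq_exp2r.
have O : Om w <= w ^ 4.
  rewrite /Om (_ : w ^ 4 = w * (w * w ^ 2)); last by rewrite !expnS expn0; lia.
  rewrite leq_mul2l; apply/orP; right; have : w * 4 <= w * w ^ 2 by rewrite leq_mul2l e2 orbT.
  by lia.
have O2 : Om w * Om w <= w ^ 8 by rewrite (expnD w 4 4) leq_mul.
have e4 : 4 * 4 <= w ^ 4 by rewrite (expnD w 2 2) leq_mul.
have e6 : 16 * (w * w) <= w ^ 8.
  rewrite (_ : w ^ 8 = w ^ 4 * (w ^ 2 * (w * w))); last by rewrite mulnn -!expnD.
  by rewrite [leqRHS]mulnA leq_mul2r; apply/orP; right; apply: (@leq_trans (w ^ 4 * 4)); [lia|rewrite leq_mul2l e2 orbT].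
have e8 : 2 * w ^ 8 <= w ^ 9 by rewrite (expnS w 8) leq_mul2r w1 orbT.
by rewrite expnS expn1 in e2; lia.
Qed.

(** For [b = q = 2 ^ 2 ^ k] the exponent [e] becomes [145 * 2 ^ k.+1 + 2 * e], and
    [145 * k.+1 * 2 ^ k] solves this recursion. *)
Lemma onl_tower k : onl (2 ^ 2 ^ k) (2 ^ (145 * k.+1 * 2 ^ k)).
Proof.
elim: k => [|k IH].
  (* Base case [b = 2], [q = 1]: both auxiliary games have width [1]. *)
  have := @onl_step 2 1 1 1 isT isT isT onl_one onl_one.
  rewrite !muln1 expn0 expn1.
  move=> H; apply: onl_mono (leqnn 2) _ H; exact: (@NN_bound 2 isT).
set W := 2 ^ 2 ^ k in IH *; set K := 2 ^ (145 * _ * _) in IH.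
have W2 : 1 < W by rewrite -[1](expn0 2) ltn_exp2l // expn_gt0.
have IHb : onl W.-1 K by apply: onl_mono IH => //; lia.
have K0 : 0 < K by rewrite expn_gt0.
have EW : W * W = 2 ^ 2 ^ k.+1 by rewrite -expnD addnn -mul2n -expnS.
have := onl_step (ltnW W2) K0 K0 IH IHb; rewrite EW; apply: onl_mono => //.
have W2' : 1 < 2 ^ 2 ^ k.+1 by rewrite -EW; apply: leq_trans W2 _; rewrite leq_pmulr //; lia.
have := NN_bound W2'; move: (NN _) => N h; rewrite !mulnA.
apply: (@leq_trans ((2 ^ 2 ^ k.+1) ^ 145 * K * K)); first exact: leq_mul (leq_mul h (leqnn K)) (leqnn K).
by rewrite -expnM /K -!expnD leq_exp2l // expnS; lia.
Qed.

(** The algorithm ignores the chains assigned before, since a local colouring depends on the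
    subposet alone. Indices not yet seen are sent to a default by [inord], which locality makes
    harmless. *)
Lemma onl_online w k : onl w k -> exists A : online_alg, online_partitions A w k.
Proof.
case=> c [Lc C].
pose ext i (rho : rel 'I_i.+1) : rel nat := fun x y => rho (inord x) (inord y).
exists (fun i rho _ => c (ext i rho) xpredT i) => n le [rr [ra rt]] W; set A := fun i => _.
have O : ord (bl n xpredT) le.
  by split=> [x /andP[xn _]|x y /andP[xn _] /andP[yn _]|y x z /andP[xn _] /andP[yn _] /andP[zn _]]; auto; apply: rt.
have Wl : wid (bl n xpredT) le w.
  move=> s [us As] sP; pose S := [set i : 'I_n | val i \in s].
  have <- : #|S| = size s.
    rewrite cardE -(size_map val); apply/perm_size/uniq_perm => //.
      by rewrite map_inj_uniq ?enum_uniq //; apply: val_inj.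
    move=> x; apply/mapP/idP => [[i]|xs]; first by rewrite mem_enum inE => h ->.
    have /andP[xn _] := sP x xs; by exists (Ordinal xn); rewrite ?mem_enum ?inE.
  apply: W => x y; rewrite !inE => xs ys ne; apply/andP; split; apply: contra ne => h; apply/eqP/val_inj.
    exact: As.
  by symmetry; apply: As.
have [C1 C2] := C n xpredT le O Wl I.
have sz m : size (run A le m) = m by elim: m => //= m IH; rewrite size_rcons IH.
have nthE m x : x < m -> nth 0 (run A le m) x = c le xpredT x.
  elim: m => //= m IH; rewrite ltnS leq_eqVlt nth_rcons sz => /orP[/eqP->|xm]; last by rewrite xm; apply: IH.
  rewrite ltnn eqxx /A; apply: Lc => //; split=> // y z ym zm _ _.
  by rewrite /ext /= !inordK.
split=> [x y xn yn|]; first by rewrite !nthE //; apply: C2.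
rewrite -(size_iota 0 k); apply: uniq_leq_size; first exact: undup_uniq.
move=> a; rewrite mem_undup => /(nthP 0)[x]; rewrite sz => xn <-.
by rewrite mem_iota nthE // C1.
Qed.

Lemma INR_exp2 e : INR (2 ^ e) = Rpower 2 (INR e).
Proof.
rewrite Rpower_pow; last by lra.
elim: e => [//|e IH].
by rewrite expnS mult_INR IH.
Qed.

Lemma ln_mono x y : (0 < x)%R -> (x <= y)%R -> (ln x <= ln y)%R.
Proof. by move=> x0 [xy|->]; [left; apply: ln_increasing|right]. Qed.

Lemma exp_mono x y : (x <= y)%R -> (exp x <= exp y)%R.
Proof. by move=> [xy|->]; [left; apply: exp_increasing|right]. Qed.

(** From [2 ^ k * ln 2 <= ln w] the exponent costs at most [290 * k.+2 * ln w]. As [ln 2 > 1 / 2],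
    also [ln (ln w) >= (k - 1) / 2], so [k.+2 <= 5 * ln (ln w)] once [3 <= k]; and
    [1450 = 290 * 5]. *)
Lemma tower_bound w k : 3 <= k -> 2 ^ 2 ^ k < w ->
  (INR (2 ^ (145 * k.+2 * 2 ^ k.+1)) <= Rpower (INR w) (1450 * ln (ln (INR w))))%R.
Proof.
move=> k3 lt; have l2 := ln_lt_2.
have l1 : (ln 2 < 1)%R.
  by have := exp_ineq1 1 R1_neq_R0 => h; rewrite -[X in (_ < X)%R]ln_exp; apply: ln_increasing; lra.
set e := 2 ^ k in lt.
have e0 : (0 < INR e)%R by apply: lt_0_INR; apply/ltP; rewrite expn_gt0.
have lw : (INR e * ln 2 <= ln (INR w))%R.
  have -> : (INR e * ln 2 = ln (INR (2 ^ e)))%R by rewrite INR_exp2 /Rpower ln_exp.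
  apply: ln_mono; first by apply: lt_0_INR; apply/ltP; rewrite expn_gt0.
  by apply: le_INR; apply/leP/ltnW.
have le2 : (0 < INR e * ln 2)%R by apply: Rmult_lt_0_compat; lra.
have llw : (INR k * ln 2 - ln 2 <= ln (ln (INR w)))%R.
  apply: (Rle_trans _ (ln (INR e * ln 2))); last exact: ln_mono.
  rewrite ln_mult //; last by lra.
  have -> : ln (INR e) = (INR k * ln 2)%R by rewrite /e INR_exp2 /Rpower ln_exp.
  have h : (- ln 2 <= ln (ln 2))%R.
    by rewrite -ln_Rinv; [apply: ln_mono|]; lra.
  by lra.
have K3 : (3 <= INR k)%R by have /leP/le_INR := k3; rewrite /=; lra.
have key : (INR (k.+2) <= 5 * ln (ln (INR w)))%R.
  rewrite !S_INR; apply: (Rle_trans _ (5 * ((INR k - 1) * ln 2))); last by lra.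
  have : ((INR k - 1) * / 2 <= (INR k - 1) * ln 2)%R by apply: Rmult_le_compat_l; lra.
  by lra.
rewrite INR_exp2 /Rpower; apply: exp_mono; rewrite !mult_INR expnS mult_INR -/e.
have -> : INR 145 = 145%R by rewrite INR_IZR_INZ.
have -> : INR 2 = 2%R by rewrite /=; lra.
have k0 : (0 <= INR k.+2)%R by apply: pos_INR.
apply: (Rle_trans _ (290 * INR k.+2 * ln (INR w))).
  have : (INR k.+2 * (INR e * ln 2) <= INR k.+2 * ln (INR w))%R by apply: Rmult_le_compat_l.
  by lra.
apply: Rmult_le_compat_r; lra.
Qed.

Theorem theorem4 :
  exists (C : R) (w0 : nat), forall w : nat, w0 <= w ->
    exists (A : online_alg) (k : nat),
      online_partitions A w k /\
      (INR k <= Rpower (INR w) (C * ln (ln (INR w))))%R.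
Proof.
(* The threshold is [257 = 2 ^ 2 ^ 3 + 1], which ensures [3 <= k] for the [k] chosen below. *)
exists 1450%R, 257 => w w257.
have [k [k3 lo hi]] : exists k, [/\ 3 <= k, 2 ^ 2 ^ k < w & w <= 2 ^ 2 ^ k.+1].
  have ex : exists j, w <= 2 ^ 2 ^ j.
    by exists w; apply: ltnW; apply: ltn_trans (ltn_expl w (ltnSn 1)) (ltn_expl _ (ltnSn 1)).
  case: (ex_minnP ex) => -[|j] hj hmin.
    by have := leq_trans w257 hj.
  have lj : 2 ^ 2 ^ j < w by rewrite ltnNge; apply/negP => /hmin; rewrite ltnn.
  exists j; split=> //; rewrite leqNgt; apply/negP => j3.
  have : w <= 2 ^ 2 ^ 3 by apply: leq_trans hj _; rewrite !leq_exp2l.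
  by move/(leq_trans w257).
have [A HA] : exists A, online_partitions A w (2 ^ (145 * k.+2 * 2 ^ k.+1)).
  by apply: onl_online; apply: onl_mono hi (leqnn _) (onl_tower k.+1).
by exists A, (2 ^ (145 * k.+2 * 2 ^ k.+1)); split=> //; apply: tower_bound.
Qed.
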